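(* Let $\Phi(t)=e^t-t-1$ for $t\ge0$, and let $\mu$ be a positive regular Borel measure on $\mathbb{C}_+$. Then $\mathcal{L}\colon L^\Phi(0,1)\to L^2(\mathbb{C}_+,\mu)$ is bounded if and only if $$\sum_{n=1}^\infty n^2\,\mathcal{C}_2[\mu_n]+\sup_{I\subset i\mathbb{R}\text{ interval},\,|I|=2}\mu(Q_I)<\infty,$$ with an associated equivalence of norms (the left-hand side is comparable to the square of the norm of the embedding, with constants independent of $\mu$).
   Context: $\mathbb{C}_+=\{z\in\mathbb{C}:\operatorname{Re}z>0\}$. The Laplace transform of a function $f$ on $(0,\infty)$ is $\mathcal{L}f(z)=\int_0^\infty e^{-zt}f(t)\,dt$, $z\in\mathbb{C}_+$; a function on $(0,1)$ is extended by $0$ to $(0,\infty)$. $L^\Phi(0,1)$ is the Orlicz space of measurable $f\colon(0,1)\to\mathbb{C}$ for which $\Phi(k^{-1}|f|)$ is integrable for some $k>0$, with norm $\|f\|_{L^\Phi}=\inf\{k>0:\int_0^1\Phi(k^{-1}|f(s)|)\,ds\le1\}$. For an interval $I\subset i\mathbb{R}$ with length $|I|\in(0,\infty)$, $Q_I=\{x+iy: iy\in I,\ 0<x\le|I|\}$. For a positive regular Borel measure $\mu$ on $\mathbb{C}_+$ and $\beta>0$, $\mathcal{C}_\beta[\mu]=\sup_{I}\mu(Q_I)/|I|^\beta$, the supremum over all intervals $I\subset i\mathbb{R}$. For $n\in\mathbb{Z}$ let $S_n=\{x+iy: y\in\mathbb{R},\ 2^n\le x<2^{n+1}\}$ and $\mu_n(E)=\mu(E\cap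 S_n)$. *)

(* Defs.v *)
From HB Require Import structures.
From mathcomp Require Import all_boot all_order all_algebra.
From mathcomp Require Import complex.
From mathcomp Require Import all_classical all_reals all_analysis.

Set Implicit Arguments.
Unset Strict Implicit.
Unset Printing Implicit Defensive.

Import Order.TTheory GRing.Theory Num.Theory.
Import numFieldNormedType.Exports.

Local Open Scope classical_set_scope.
Local Open Scope complex_scope.
Local Open Scope ring_scope.

Notation borel T := (g_sigma_algebraType (@open T)).

(* The regular algebra R[i]^o carries the topology of the modulus, which R[i]
   itself does not. *)
Notation Cplane R := (GRing.regular R[i]).

Notation modulus := Normc.normc.

Definition half_plane (R : realType) : set (Cplane R) :=
  [set z | 0 < complex.Re z].
Arguments half_plane R : clear implicits.

(* The right half-plane with its subspace topology; open, compact and Borel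
   are therefore relative to it. *)
Definition Cplus (R : realType) : Type := set_type (half_plane R).
HB.instance Definition _ (R : realType) := Topological.on (Cplus R).

Lemma half_plane1 (R : realType) : (1 : Cplane R) \in half_plane R.
Proof. by rewrite inE /half_plane /= ltr01. Qed.

HB.instance Definition _ (R : realType) :=
  isPointed.Build (Cplus R) (exist _ 1 (half_plane1 R)).

Definition Cval (R : realType) (z : Cplus R) : R[i] := sval z.

(* Outer and inner regularity on all Borel sets. Finiteness on compact sets is
   not required. *)
Definition regular_measure (R : realType) (T : ptopologicalType)
    (mu : set (borel T) -> \bar R) : Prop :=
  forall E : set (borel T), measurable E ->
    mu E = ereal_inf [set mu V | V in [set V | @open T V /\ E `<=` V]] /\
    mu E = ereal_sup [set mu K | K in [set K | @compact T K /\ K `<=` E]].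

Definition cexp (R : realType) (z : R[i]) : R[i] :=
  (expR (complex.Re z))%:C *
  (cos (complex.Im z) +i* sin (complex.Im z)).

Definition Cintegral (R : realType) (D : set R) (f : R -> R[i]) : R[i] :=
  Rintegral lebesgue_measure D (fun t => complex.Re (f t)) +i*
  Rintegral lebesgue_measure D (fun t => complex.Im (f t)).

Definition laplace (R : realType) (f : R -> R[i]) (z : Cplus R) : R[i] :=
  Cintegral `]0, +oo[ (fun t => cexp (- Cval z * t%:C) * f t).

(* A function on (0, 1) is represented by a total function of which only the
   values on ]0, 1[ are used; ext0 is its extension by 0. *)
Definition unit_itv (R : realType) : set R := `]0, 1[.
Arguments unit_itv R : clear implicits.

Definition ext0 (R : realType) (f : R -> R[i]) (t : R) : R[i] :=
  if t \in unit_itv R then f t else 0.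

Definition orlicz_space (R : realType) (Phi : R -> R) : set (R -> R[i]) :=
  [set f | measurable_fun (unit_itv R) (f : R -> borel (Cplane R)) /\
    exists2 k : R, 0 < k &
      lebesgue_measure.-integrable (unit_itv R)
        (fun s => (Phi (k^-1 * modulus (f s)))%:E)].

Definition orlicz_norm (R : realType) (Phi : R -> R) (f : R -> R[i]) : R :=
  inf [set k : R | 0 < k /\
    (\int[lebesgue_measure]_(s in unit_itv R)
       (Phi (k^-1 * modulus (f s)))%:E <= 1)%E].

Definition L2_norm (R : realType) (mu : {measure set (borel (Cplus R)) -> \bar R})
    (F : Cplus R -> R[i]) : \bar R :=
  Lnorm mu 2%:E (fun z => (modulus (F z))%:E).

Definition L2_space (R : realType)
    (mu : {measure set (borel (Cplus R)) -> \bar R}) : set (Cplus R -> R[i]) :=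
  [set F | measurable_fun setT (F : borel (Cplus R) -> borel (Cplane R)) /\
    (L2_norm mu F < +oo)%E].

Definition laplace_bounded (R : realType) (Phi : R -> R)
    (mu : {measure set (borel (Cplus R)) -> \bar R}) : Prop :=
  exists K : R, forall f, orlicz_space Phi f ->
    L2_space mu (laplace (ext0 f)) /\
    (L2_norm mu (laplace (ext0 f)) <= (K * orlicz_norm Phi f)%:E)%E.

(* +oo when the Laplace transform is unbounded *)
Definition laplace_opnorm (R : realType) (Phi : R -> R)
    (mu : {measure set (borel (Cplus R)) -> \bar R}) : \bar R :=
  ereal_sup [set L2_norm mu (laplace (ext0 f)) | f in
    [set f | orlicz_space Phi f /\ orlicz_norm Phi f <= 1]].

(* An interval of the imaginary axis is given by its imaginary parts; any
   endpoint may be included or excluded. *)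
Definition itv_length (R : realType) (I : interval R) : \bar R :=
  lebesgue_measure [set` I].

Definition carleson_square (R : realType) (I : interval R) : set (Cplus R) :=
  [set z | complex.Im (Cval z) \in I /\
    0 < complex.Re (Cval z) /\
    ((complex.Re (Cval z))%:E <= itv_length I)%E].

Definition carleson (R : realType) (beta : R) (mu : set (Cplus R) -> \bar R) :
    \bar R :=
  ereal_sup [set (mu (carleson_square I) *
                  ((fine (itv_length I) `^ beta)^-1)%:E)%E | I in
    [set I : interval R | (0 < itv_length I < +oo)%E]].

Definition strip (R : realType) (n : int) : set (Cplus R) :=
  [set z | (2 : R) ^ n <= complex.Re (Cval z) < (2 : R) ^ (n + 1)].
Arguments strip R n : clear implicits.

Definition strip_measure (R : realType) (mu : set (Cplus R) -> \bar R)
    (n : int) (E : set (Cplus R)) : \bar R :=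
  mu (E `&` strip R n).

Definition Phi_exp (R : realType) (t : R) : R := expR t - t - 1.
Arguments Phi_exp R t : clear implicits.

Definition embedding_constant (R : realType) (mu : set (Cplus R) -> \bar R) :
    \bar R :=
  (\sum_(1 <= n <oo) (n%:R ^+ 2)%:E * carleson 2 (strip_measure mu n%:Z) +
   ereal_sup [set mu (carleson_square I) | I in
     [set I : interval R | itv_length I = 2%:E]])%E.

(* Main.v *)
Require Import Defs.
From HB Require Import structures.
From mathcomp Require Import all_boot all_order all_algebra.
From mathcomp Require Import complex.
From mathcomp Require Import all_classical all_reals all_analysis.
From mathcomp Require Import measurable_realfun.
From mathcomp Require Import ring lra.

(** The transform is tested against the half-plane cut into the strips
    2 ^ n <= Re z < 2 ^ (n + 1) for n >= 1, and 0 < Re z < 2.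

    Upper bound. Each strip is cut into boxes of height 2 ^ (n + 1), of mass at
    most a constant times 4 ^ n times the Carleson constant of the strip
    measure or, in the lowest strip, at most the mass of a square of side 2. It
    remains to sum over the boxes the squares of the suprema of the
    transform. On an interval of length L = 2 ^ (- n) the frequencies k * (2 / L)
    are orthogonal up to enlarging the interval by the factor pi; the other
    points of a box differ from such a frequency by a bounded multiple of 1 / L,
    and integration by parts turns them into averages of primitives, whose
    Fourier coefficients obey the Bessel inequality uniformly
    ([laplace_interval]). Cutting ]0, 1] into 2 ^ n pieces, the factor
    e ^ (- Re z t) damps the m-th piece geometrically ([laplace_strip]). The
    resulting damped integral of |f| ^ 2 is of order (n / 2 ^ n) ^ 2 when f is in
    the unit ball of the Orlicz space, because 2 ^ n v ^ 2 is bounded by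
    2 ^ n n ^ 2 plus Phi v ([laplace_strip_orlicz]). Summation over the strips
    is [integral_laplace_le].

    Lower bound. A wave (m / 4) e ^ (i y t) supported in
    ]2 ^ (- m - 1), 2 ^ (- m)] has a transform of size at least a constant times
    m / 2 ^ m on the part of the m-th strip where y <= Im z < y + 2 ^ m. Such
    waves for different m have disjoint supports, and a sum of them with
    arbitrary signs and frequencies stays in the unit ball of the Orlicz space,
    as log (1 / t) would. The parallelogram law provides signs for which the
    square norm of the transform of the sum dominates the sum of the square
    norms ([exists_signs]); hence the tiles of all the strips are tested at once
    ([dyadic_tiles_le]). Carleson squares are covered by tiles
    ([carleson_le_tile]). The squares of side 2 are tested by single waves
    ([square_sup_le]). *)

Set Implicit Arguments.
Unset Strict Implicit.
Unset Printing Implicit Defensive.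

Import Order.TTheory GRing.Theory Num.Theory.
Import numFieldNormedType.Exports.

Local Open Scope classical_set_scope.
Local Open Scope ring_scope.

(** * Square-integrable real functions and the Bessel inequality *)

Section Rintegrable.
Context d {T : measurableType d} {R : realType}.
Variable mu : {measure set T -> \bar R}.
Variable D : set T.
Hypothesis mD : measurable D.
Implicit Types f g h : T -> R.

(** Integrability of a real-valued function, through its embedding in the
    extended reals. *)
Definition Rintegrable f := mu.-integrable D (EFin \o f).

Lemma Rintegrable_measurable f : Rintegrable f -> measurable_fun D f.
Proof. by move=> /measurable_int/measurable_EFinP. Qed.

Lemma RintegrableD f g : Rintegrable f -> Rintegrable g ->
  Rintegrable (fun x => f x + g x).
Proof.
move=> If Ig; apply: (@eq_integrable _ _ _ mu D mD _ _ _ (integrableD mD If Ig)).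
by move=> x _.
Qed.

Lemma RintegrableZ (k : R) f : Rintegrable f -> Rintegrable (fun x => k * f x).
Proof.
move=> If; apply: (@eq_integrable _ _ _ mu D mD _ _ _ (integrableZl mD k If)).
by move=> x _.
Qed.

Lemma RintegrableB f g : Rintegrable f -> Rintegrable g ->
  Rintegrable (fun x => f x - g x).
Proof.
move=> If Ig; apply: (@eq_integrable _ _ _ mu D mD _ _ _ (integrableB mD If Ig)).
by move=> x _.
Qed.

Lemma Rintegrable_sum I (s : seq I) (h : I -> T -> R) :
  (forall i, Rintegrable (h i)) -> Rintegrable (fun x => \sum_(i <- s) h i x).
Proof.
move=> Ih; have := @integrable_sum _ _ _ mu D mD _ s xpredT (fun i => EFin \o h i)
  (fun i _ => Ih i).
apply: (@eq_integrable _ _ _ mu D mD) => x _ /=.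
by rewrite sumEFin.
Qed.

Lemma Rintegral_sum I (s : seq I) (h : I -> T -> R) :
  (forall i, Rintegrable (h i)) ->
  \int[mu]_(x in D) (\sum_(i <- s) h i x) = \sum_(i <- s) \int[mu]_(x in D) h i x.
Proof.
move=> Ih; elim: s => [|i s IHs].
  rewrite big_nil; under eq_Rintegral do rewrite big_nil.
  by rewrite Rintegral_cst// mul0r.
rewrite big_cons -IHs -RintegralD//; [|exact: Ih|exact: Rintegrable_sum].
by apply: eq_Rintegral => x _; rewrite big_cons.
Qed.

Lemma Rintegrable_le f g : measurable_fun D f -> Rintegrable g ->
  (forall x, D x -> `|f x| <= g x) -> Rintegrable f.
Proof.
move=> mf Ig fg; apply: (le_integrable mD _ _ Ig); first exact/measurable_EFinP.
move=> x Dx /=; rewrite lee_fin (le_trans (fg _ Dx))//; exact: ler_norm.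
Qed.

Lemma eq_Rintegrable f g : {in D, f =1 g} -> Rintegrable f -> Rintegrable g.
Proof.
by move=> fg; apply: (@eq_integrable _ _ _ mu D mD) => x xD /=; rewrite fg.
Qed.

Lemma Rintegrable_bounded f (M : R) : (mu D < +oo)%E -> measurable_fun D f ->
  (forall x, D x -> `|f x| <= M) -> Rintegrable f.
Proof.
move=> Dfin mf fM; apply: (@Rintegrable_le _ (cst M)) => //.
apply/integrableP; split; first exact/measurable_EFinP/measurable_cst.
have -> : (\int[mu]_(x in D) `|(EFin \o cst M) x| = \int[mu]_(x in D) cst `|M|%:E x)%E by [].
by rewrite integral_cst//= lte_mul_pinfty.
Qed.

Lemma RintegrableM_bounded f g (M : R) : Rintegrable f -> measurable_fun D g ->
  (forall x, D x -> `|g x| <= M) -> Rintegrable (fun x => g x * f x).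
Proof.
move=> If mg gM; apply: (@Rintegrable_le _ (fun x => M * `|f x|)).
- by apply: measurable_funM => //; exact: Rintegrable_measurable.
- by apply: RintegrableZ; apply: integrable_norm.
- by move=> x Dx; rewrite normrM ler_wpM2r// gM.
Qed.

(** The product of two square-integrable functions is integrable. *)
Lemma Rintegrable_sqrM f g : measurable_fun D f -> measurable_fun D g ->
  Rintegrable (fun x => f x ^+ 2) -> Rintegrable (fun x => g x ^+ 2) ->
  Rintegrable (fun x => f x * g x).
Proof.
move=> mf mg If Ig; apply: (Rintegrable_le (measurable_funM mf mg) (RintegrableD If Ig)).
move=> x _; rewrite normrM -(real_normK (num_real (f x))) -(real_normK (num_real (g x))).
have := sqr_ge0 (`|f x| - `|g x|); have := normr_ge0 (f x); have := normr_ge0 (g x).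
nra.
Qed.

Lemma Rintegrable_sqr_int f : (mu D < +oo)%E -> measurable_fun D f ->
  Rintegrable (fun x => f x ^+ 2) -> Rintegrable f.
Proof.
move=> Dfin mf If.
have I1 : Rintegrable (cst 1) by apply: (@Rintegrable_bounded _ 1) => // x _; rewrite normr1.
apply: (Rintegrable_le mf (RintegrableD I1 If)) => x _ /=.
rewrite -(real_normK (num_real (f x))).
by have := sqr_ge0 (`|f x| - 1); have := normr_ge0 (f x); nra.
Qed.

(** The Cauchy-Schwarz inequality against the constant function 1. *)
Lemma sqr_Rintegral_le f : (mu D < +oo)%E -> measurable_fun D f ->
  Rintegrable (fun x => f x ^+ 2) ->
  (\int[mu]_(x in D) f x) ^+ 2 <= fine (mu D) * \int[mu]_(x in D) (f x ^+ 2).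
Proof.
move=> Dfin mf If2.
have If := Rintegrable_sqr_int Dfin mf If2.
have I1 k : Rintegrable (cst k).
  by apply: (@Rintegrable_bounded _ `|k|) => // x _ /=.
set l := fine (mu D); set c := \int[mu]_(x in D) f x.
have l0 : 0 <= l by exact: fine_ge0.
(* The quadratic polynomial t |-> int (f - t)^2 is nonnegative; its value at
   the mean c / l is the claim. *)
have key (t : R) : 0 <= \int[mu]_(x in D) (f x ^+ 2) - 2 * t * c + t ^+ 2 * l.
  have -> : \int[mu]_(x in D) (f x ^+ 2) - 2 * t * c + t ^+ 2 * l =
      \int[mu]_(x in D) ((f x - t) ^+ 2).
    rewrite (_ : (fun x => (f x - t) ^+ 2) = (fun x => (f x ^+ 2 - (2 * t) * f x) + t ^+ 2)); last first.
      by apply/funext => x; ring.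
    rewrite RintegralD//; [|exact: RintegrableB If2 (RintegrableZ _ If)|exact: I1].
    rewrite RintegralB//; last exact: RintegrableZ.
    by rewrite RintegralZl// Rintegral_cst.
  by apply: Rintegral_ge0 => x _; exact: sqr_ge0.
have [l_gt0|] := ltP 0 l.
  have := key (c / l).
  set J := \int[mu]_(x in D) (f x ^+ 2).
  have -> : J - 2 * (c / l) * c + (c / l) ^+ 2 * l = J - c ^+ 2 / l.
    by field; rewrite gt_eqF.
  by rewrite subr_ge0 ler_pdivrMr// mulrC.
move=> l_le0; have l_eq0 : l = 0 by apply/eqP; rewrite eq_le l_le0.
suff -> : c = 0 by rewrite l_eq0 mul0r expr0n.
have D0 : mu D = 0%E.
  by rewrite -(@fineK _ (mu D)) ?ge0_fin_numE// -/l l_eq0.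
rewrite /c /Rintegral; rewrite null_set_integral//.
by apply/measurable_EFinP.
Qed.

(** Bessel's inequality for a finite orthogonal family of functions whose square
    norms are only assumed to be at most B. *)
Lemma bessel (e : nat -> T -> R) (B : R) g K :
  0 < B ->
  measurable_fun D g -> Rintegrable (fun x => g x ^+ 2) ->
  (forall k, measurable_fun D (e k)) ->
  (forall k, Rintegrable (fun x => e k x ^+ 2)) ->
  (forall k, \int[mu]_(x in D) (e k x ^+ 2) <= B) ->
  (forall j k, (j < k)%N -> \int[mu]_(x in D) (e j x * e k x) = 0) ->
  \sum_(k < K) (\int[mu]_(x in D) (g x * e k x)) ^+ 2 <=
    B * \int[mu]_(x in D) (g x ^+ 2).
Proof.
move=> B0 mg Ig me Ie eB eorth.
pose c k := \int[mu]_(x in D) (g x * e k x).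
pose S K x := \sum_(k < K) c k * e k x.
have mS n : measurable_fun D (S n).
  by apply: measurable_sum => k; exact: measurable_funM.
have Iee j k : Rintegrable (fun x => e j x * e k x) by exact: Rintegrable_sqrM.
have Ige k : Rintegrable (fun x => g x * e k x) by exact: Rintegrable_sqrM.
have SS n x : S n.+1 x = S n x + c n * e n x by rewrite /S big_ord_recr.
have S0 x : S 0 x = 0 by rewrite /S big_ord0.
have ISe n k : Rintegrable (fun x => S n x * e k x).
  elim: n => [|n IHn].
    by apply: (eq_Rintegrable _ (RintegrableZ 0 (Ie 0%N))) => x _; rewrite S0 !mul0r.
  apply: (eq_Rintegrable _ (RintegrableD IHn (RintegrableZ (c n) (Iee n k)))) => x _.
  by rewrite SS; ring.
have IS2 n : Rintegrable (fun x => S n x ^+ 2).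
  elim: n => [|n IHn].
    by apply: (eq_Rintegrable _ (RintegrableZ 0 (Ie 0%N))) => x _; rewrite S0 mul0r expr0n.
  apply: (eq_Rintegrable _ (RintegrableD IHn (RintegrableD
   (RintegrableZ (2 * c n) (ISe n n)) (RintegrableZ (c n ^+ 2) (Ie n))))) => x _.
  by rewrite SS; ring.
have IgS n : Rintegrable (fun x => g x * S n x) by exact: Rintegrable_sqrM.
have Se n k : (n <= k)%N -> \int[mu]_(x in D) (S n x * e k x) = 0.
  elim: n => [|n IHn] nk.
    rewrite -[RHS](mul0r (fine (mu D))) -Rintegral_cst//.
    by apply: eq_Rintegral => x _; rewrite S0 mul0r.
  transitivity (\int[mu]_(x in D) (S n x * e k x + c n * (e n x * e k x))).
    by apply: eq_Rintegral => x _; rewrite SS; ring.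
  rewrite RintegralD//; [|exact: ISe|exact/RintegrableZ/Iee].
  have -> : \int[mu]_(x in D) (c n * (e n x * e k x)) = 0.
    by rewrite RintegralZl; [rewrite eorth// mulr0|exact: mD|exact: Iee].
  by rewrite IHn ?addr0// ltnW.
have gS n : \int[mu]_(x in D) (g x * S n x) = \sum_(k < n) c k ^+ 2.
  elim: n => [|n IHn].
    rewrite big_ord0 -[RHS](mul0r (fine (mu D))) -Rintegral_cst//.
    by apply: eq_Rintegral => x _; rewrite S0 mulr0.
  rewrite big_ord_recr/= -IHn expr2 -[X in _ + X * _]/(c n) -RintegralZl//; last exact: Ige.
  rewrite -RintegralD//; [|exact: IgS|exact/RintegrableZ/Ige].
  by apply: eq_Rintegral => x _; rewrite SS; ring.
have S2 n : \int[mu]_(x in D) (S n x ^+ 2) <= B * \sum_(k < n) c k ^+ 2.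
  elim: n => [|n IHn].
    rewrite big_ord0 mulr0 -[leRHS](mul0r (fine (mu D))) -Rintegral_cst//.
    rewrite le_eqVlt; apply/orP; left; apply/eqP.
    by apply: eq_Rintegral => x _; rewrite S0 expr0n.
  have -> : \int[mu]_(x in D) (S n.+1 x ^+ 2) =
     \int[mu]_(x in D) (S n x ^+ 2) + c n ^+ 2 * \int[mu]_(x in D) (e n x ^+ 2).
    transitivity (\int[mu]_(x in D) (S n x ^+ 2 + ((2 * c n) * (S n x * e n x) + c n ^+ 2 * e n x ^+ 2))).
      by apply: eq_Rintegral => x _; rewrite SS; ring.
    have I1 := RintegrableZ (2 * c n) (ISe n n).
    have I2 := RintegrableZ (c n ^+ 2) (Ie n).
    rewrite RintegralD//; [|exact: IS2|exact: RintegrableD].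
    rewrite RintegralD//.
    rewrite RintegralZl//; last exact: ISe.
    by rewrite Se// mulr0 add0r RintegralZl//; exact: Ie.
  rewrite big_ord_recr/= mulrDr lerD// mulrC ler_wpM2r//; exact: sqr_ge0.
(* The coefficients are divided by the common bound B rather than by the norms
   of the e k, which may be smaller. *)
have : 0 <= \int[mu]_(x in D) ((g x - B^-1 * S K x) ^+ 2).
  by apply: Rintegral_ge0 => x _; exact: sqr_ge0.
have -> : \int[mu]_(x in D) ((g x - B^-1 * S K x) ^+ 2) =
    \int[mu]_(x in D) (g x ^+ 2) - (2 * B^-1) * \sum_(k < K) c k ^+ 2
     + B^-1 ^+ 2 * \int[mu]_(x in D) (S K x ^+ 2).
  have I1 := RintegrableZ (2 * B^-1) (IgS K).
  have I2 := RintegrableZ (B^-1 ^+ 2) (IS2 K).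
  rewrite -gS -(RintegralZl _ mD (IgS K)) -(RintegralZl _ mD (IS2 K)).
  rewrite -RintegralB// -RintegralD//; last exact: RintegrableB.
  by apply: eq_Rintegral => x _; ring.
move: (S2 K); change (\sum_(k < K) (\int[mu]_(x in D) (g x * e k x)) ^+ 2) with (\sum_(k < K) c k ^+ 2).
set s := \sum_(k < K) c k ^+ 2; set J := \int[mu]_(x in D) (g x ^+ 2).
set X := \int[mu]_(x in D) (S K x ^+ 2) => XB H.
have : B^-1 ^+ 2 * X <= B^-1 * s.
  have -> : B^-1 * s = B^-1 ^+ 2 * (B * s) by field; rewrite gt_eqF.
  by rewrite ler_wpM2l// sqr_ge0.
move=> H2.
have : B^-1 * s <= J by lra.
by rewrite mulrC ler_pdivrMr// mulrC.
Qed.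

End Rintegrable.

(** * Trigonometric orthogonality and integrals over a triangle *)

Lemma Rintegral0 d (T : measurableType d) (R : realType)
    (mu : {measure set T -> \bar R}) (D : set T) :
  \int[mu]_(x in D) (0 : R) = 0.
Proof. by rewrite /Rintegral integral0. Qed.

Section Interval.
Context {R : realType}.
Notation mu := (@lebesgue_measure R).
Implicit Types (f g u : R -> R) (c d : R).

Lemma RintegralZl_itv (i : interval R) f k : Rintegrable mu [set` i] f ->
  \int[mu]_(x in [set` i]) (k * f x) = k * \int[mu]_(x in [set` i]) f x.
Proof. by apply: RintegralZl; exact: measurable_itv. Qed.

Lemma lebesgue_itvoc c d : c <= d -> mu `]c, d] = (d - c)%:E.
Proof.
move=> cd; rewrite lebesgue_measure_itv/= lte_fin.
by case: ltgtP cd => // -> _; rewrite subrr.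
Qed.

Lemma lebesgue_itvoc_fin c d : (mu `]c, d] < +oo)%E.
Proof.
have [cd|dc] := leP c d; first by rewrite lebesgue_itvoc// ltry.
by rewrite set_itv_ge ?measure0// bnd_simp -leNgt ltW.
Qed.

Lemma continuous_Rintegrable f c d : continuous f -> Rintegrable mu `]c, d] f.
Proof.
move=> cf; apply: (@integrableS _ _ _ mu `[c, d]) => //.
  by apply: subset_itvr; rewrite bnd_simp.
apply: continuous_compact_integrable; first exact: segment_compact.
exact: continuous_subspaceT.
Qed.

Lemma FTC2_itvoc f F c d : c < d -> continuous f ->
  (forall x : R, is_derive x 1 F (f x)) -> \int[mu]_(x in `]c, d]) f x = F d - F c.
Proof.
move=> cd cf dF.
have dF1 (x : R) : derivable F x 1 by have [] := dF x.
rewrite Rintegral_itv_obnd_cbnd; last exact: continuous_Rintegrable.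
rewrite /Rintegral (@continuous_FTC2 _ f F)//.
- exact: continuous_subspaceT.
- have cF : continuous F by move=> x; apply/differentiable_continuous/derivable1_diffP.
  split => //.
  + exact/cvg_at_right_filter/cF.
  + exact/cvg_at_left_filter/cF.
- by move=> x _; rewrite derive1E; have [_ ->] := dF x.
Qed.

Lemma is_derive_cos_primitive (w x : R) : w != 0 ->
  is_derive x 1 (fun t => w^-1 * sin (w * t)) (cos (w * x)).
Proof.
move=> w0.
have h : is_derive x 1 (fun t : R => w * t) w.
  by apply: is_derive_eq; rewrite -[w *: 1]/(w * 1) mulr1.
have h2 := @is_derive1_comp R sin (fun t => w * t) x _ _ (is_derive_sin _) h.
have := is_deriveZ w^-1 h2.
rewrite (_ : w^-1 *: _ = cos (w * x)); first by [].
by rewrite -[_ *: _]/(w^-1 * (cos (w * x) * w)) mulrCA mulVf ?mulr1.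
Qed.

Lemma continuous_cosM (w : R) : continuous (fun t => cos (w * t)).
Proof.
move=> x; apply: continuous_comp; last exact: continuous_cos.
by apply: continuousM; [exact: cst_continuous|exact: cvg_id].
Qed.

Lemma continuous_sinM (w : R) : continuous (fun t => sin (w * t)).
Proof.
move=> x; apply: continuous_comp; last exact: continuous_sin.
by apply: continuousM; [exact: cst_continuous|exact: cvg_id].
Qed.

(** The frequency w and the length T of the interval are such that the interval
    holds p full periods. *)
Lemma Rintegral_cos_period w c T p : w != 0 -> 0 < T ->
  w * T = (pi *+ 2) *+ p -> \int[mu]_(x in `]c, c + T]) cos (w * x) = 0.
Proof.
move=> w0 T0 wT; have cT : c < c + T by rewrite ltrDl.
rewrite (FTC2_itvoc cT (@continuous_cosM w) (fun x => is_derive_cos_primitive x w0)).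
by rewrite mulrDr wT (periodicn (@sinD2pi R)) subrr.
Qed.

Section trig_orthogonality.
Variables (w T c : R).
Hypotheses (w0 : 0 < w) (T0 : 0 < T) (wT : w * T = pi *+ 2).

Let I k := continuous_Rintegrable c (c + T) (@continuous_cosM k).

Let period (j k : nat) : (j < k)%N ->
  \int[mu]_(x in `]c, c + T]) cos ((k%:R * w - j%:R * w) * x) = 0 /\
  \int[mu]_(x in `]c, c + T]) cos ((k%:R * w + j%:R * w) * x) = 0.
Proof.
move=> jk; split.
- apply: (@Rintegral_cos_period _ _ _ (k - j)) => //.
    by rewrite -mulrBl mulf_neq0 ?gt_eqF// subr_gt0 ltr_nat.
  by rewrite -mulrBl -mulrA wT -natrB ?mulr_natl// ltnW.
- apply: (@Rintegral_cos_period _ _ _ (k + j)) => //.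
    by rewrite -mulrDl mulf_neq0 ?gt_eqF// -natrD ltr0n addn_gt0 (leq_ltn_trans _ jk).
  by rewrite -mulrDl -mulrA wT -natrD mulr_natl.
Qed.

Lemma cos_orthogonal (j k : nat) : (j < k)%N ->
  \int[mu]_(x in `]c, c + T]) (cos (j%:R * w * x) * cos (k%:R * w * x)) = 0.
Proof.
move=> /period[P1 P2].
transitivity (\int[mu]_(x in `]c, c + T])
    (2^-1 * (cos ((k%:R * w - j%:R * w) * x) + cos ((k%:R * w + j%:R * w) * x)))).
  by apply: eq_Rintegral => x _; rewrite mulrBl mulrDl cosB cosD; field.
rewrite RintegralZl//; last exact: RintegrableD.
by rewrite RintegralD//; [rewrite P1 P2 addr0 mulr0|exact: I|exact: I].
Qed.

Lemma sin_orthogonal (j k : nat) : (j < k)%N ->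
  \int[mu]_(x in `]c, c + T]) (sin (j%:R * w * x) * sin (k%:R * w * x)) = 0.
Proof.
move=> /period[P1 P2].
transitivity (\int[mu]_(x in `]c, c + T])
    (2^-1 * (cos ((k%:R * w - j%:R * w) * x) - cos ((k%:R * w + j%:R * w) * x)))).
  by apply: eq_Rintegral => x _; rewrite mulrBl mulrDl cosB cosD; field.
rewrite RintegralZl//; last exact: RintegrableB.
by rewrite RintegralB//; [rewrite P1 P2 subr0 mulr0|exact: I|exact: I].
Qed.

End trig_orthogonality.

Section parts.
Variables (c d : R) (g : R -> R).
Hypotheses (cd : c < d) (Ig : Rintegrable mu `]c, d] g).
Let D : set R := `]c, d].
Let gg := g \_ D.
(* The integrand v(y) g(x) on the triangle c < x < y <= d, extended by zero to
   the plane. *)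
Let H (v : R -> R) (p : R * R) := gg p.1 * (v p.2 * (if p.1 < p.2 then 1 else 0)).

Let mD : measurable D. Proof. exact: measurable_itv. Qed.
Let mgg : measurable_fun setT gg.
Proof.
by apply/(measurable_restrictT _ _).1 => //; exact: Rintegrable_measurable Ig.
Qed.
Let Igg : Rintegrable mu setT gg.
Proof.
have := (@integrable_mkcond _ _ _ mu D (EFin \o g) mD).1 Ig.
by rewrite restrict_EFin.
Qed.

Section kernel.
Variables (v : R -> R) (M : R).
Hypotheses (mv : measurable_fun setT v) (vM : forall x, `|v x| <= M)
  (vD : forall x, ~ D x -> v x = 0).

Let M0 : 0 <= M. Proof. exact: le_trans (normr_ge0 _) (vM 0). Qed.

Let mH : measurable_fun setT (H v).
Proof.
apply: measurable_funM; first exact: measurableT_comp.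
apply: measurable_funM; first exact: measurableT_comp.
apply: measurable_fun_ifT => //.
by apply: measurable_fun_ltr; [exact: measurable_fst|exact: measurable_snd].
Qed.

Let H_le x y : `|H v (x, y)| <= `|gg x| * (M * \1_D y).
Proof.
rewrite /H/= !normrM ler_wpM2l//.
rewrite indicE; case: (boolP (y \in D)) => yD.
  rewrite mulr1; apply: (@le_trans _ _ (`|v y| * 1)); last by rewrite mulr1.
  by rewrite ler_wpM2l//; case: ifP; rewrite ?normr1 ?normr0.
by rewrite vD ?normr0 ?mul0r ?mulr0//; move/negP: yD; rewrite inE.
Qed.

Let IH : (mu \x mu)%E.-integrable setT (EFin \o H v).
Proof.
have mA : measurable_fun setT (fun p => `|(H v p)%:E|%E).
  by apply: measurableT_comp => //; exact/measurable_EFinP.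
apply/integrable12ltyP; first exact/measurable_EFinP.
apply: (@le_lt_trans _ _ (\int[mu]_x ((M * (d - c))%:E * `|(gg x)%:E|))%E).
  apply: ge0_le_integral => //.
  - by move=> x _; exact: integral_ge0.
  - exact: (@measurable_fun_fubini_tonelli_F _ _ _ _ _ mu _ mA (fun _ => abse_ge0 _)).
  - by apply: measurable_funeM; apply: measurableT_comp => //; exact/measurable_EFinP.
  move=> x _; apply: (@le_trans _ _ (\int[mu]_y ((`|gg x| * M)%:E * (\1_D y)%:E))%E).
    apply: ge0_le_integral => //.
    - apply: measurableT_comp => //; apply/measurable_EFinP.
      by apply: (measurableT_comp mH); exact: measurable_pair1.
    - by apply: measurable_funeM; exact/measurable_EFinP/measurable_indic.
    by move=> y _; rewrite -EFinM lee_fin -mulrA.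
  rewrite ge0_integralZl//; first last.
  - by rewrite lee_fin mulr_ge0.
  - exact/measurable_EFinP/measurable_indic.
  rewrite integral_indic// setIT.
  rewrite [X in (_ * X)%E](_ : _ = (d - c)%:E); last by apply: lebesgue_itvoc; exact: ltW.
  by rewrite -!EFinM lee_fin/= mulrC mulrA [M * _]mulrC mulrAC.
rewrite ge0_integralZl//.
- rewrite lte_mul_pinfty// ?lee_fin ?mulr_ge0// ?subr_ge0 ?(ltW cd)//.
  by case/integrableP : Igg.
- by apply: measurableT_comp => //; exact/measurable_EFinP.
- by rewrite lee_fin mulr_ge0// subr_ge0 ltW.
Qed.

Let IHx x : Rintegrable mu setT (fun y => H v (x, y)).
Proof.
apply: (@Rintegrable_le _ _ R mu setT measurableT (fun y => H v (x, y)) (fun y => `|gg x| * (M * \1_D y))) => //.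
  by apply: (measurableT_comp mH); exact: measurable_pair1.
do 2 apply: RintegrableZ => //.
exact: (@integrable_indic_itv R c d false false).
Qed.

Let IHy y : Rintegrable mu setT (fun x => H v (x, y)).
Proof.
apply: (@Rintegrable_le _ _ R mu setT measurableT (fun x => H v (x, y)) (fun x => M * `|gg x|)) => //.
- by apply: (measurableT_comp mH); exact: measurable_pair2.
- by apply: RintegrableZ => //; exact: integrable_norm.
- move=> x _; apply: (le_trans (H_le x y)); rewrite mulrC ler_wpM2r//.
  by rewrite indicE ler_piMr//; case: (_ \in _).
Qed.

Let Rfubini : \int[mu]_x (\int[mu]_y H v (x, y)) = \int[mu]_y (\int[mu]_x H v (x, y)).
Proof.
have := Fubini IH => /(congr1 fine) FH.
transitivity (fine (\int[mu]_x \int[mu]_y (EFin \o H v) (x, y))%E).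
  congr fine; apply: eq_integral => x _; rewrite /Rintegral fineK//.
  by apply: integrable_fin_num => //; exact: IHx.
rewrite FH; congr fine; apply: eq_integral => y _; rewrite /Rintegral fineK//.
by apply: integrable_fin_num => //; exact: IHy.
Qed.

Let Hy y : D y -> \int[mu]_x H v (x, y) = v y * \int[mu]_(x in `]c, y[) g x.
Proof.
move=> Dy.
have Dyc : `]c, y[ `<=` D.
  move=> x; move: Dy; rewrite /D /= !in_itv/= => /andP[_ yd] /andP[-> xy] /=.
  exact: le_trans (ltW xy) yd.
have I : Rintegrable mu `]c, y[ g.
  by rewrite /Rintegrable; exact: (@integrableS _ _ _ mu D `]c, y[ (EFin \o g) mD (measurable_itv _) Dyc Ig).
rewrite -(RintegralZl_itv (v y) I).
rewrite [RHS]Rintegral_mkcond; apply: eq_Rintegral => x _.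
rewrite /H /gg /= !patchE (_ : point = 0)//; case: ifPn => xD; case: ifPn => xy; case: ifPn => xcy.
- by rewrite mulr1 mulrC.
- case/negP: xcy; apply: mem_set; have := set_mem xD; rewrite /D/= !in_itv/=.
  by move=> /andP[-> _].
- by have /= := set_mem xcy; rewrite in_itv/= (negbTE xy) andbF.
- by rewrite !mulr0.
- by case/negP: xD; apply: mem_set; apply: Dyc; exact: set_mem.
- by rewrite mul0r.
- by case/negP: xD; apply: mem_set; apply: Dyc; exact: set_mem.
- by rewrite mul0r.
Qed.

(** The primitive of g, multiplied by v, is a partial integral of a function
    that is integrable on the plane, hence measurable. *)
Lemma measurable_mul_primitive : measurable_fun D (fun y => v y * \int[mu]_(x in `]c, y[) g x).
Proof.
apply: (@eq_measurable_fun _ _ _ _ _ (fun y => \int[mu]_x H v (x, y))).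
  by move=> y /set_mem/Hy.
apply: measurable_funTS; apply: measurableT_comp => //.
exact: (measurable_fubini_G IH).
Qed.

(** The two iterated integrals of g x * v y over the triangle c < x < y <= d
    agree. *)
Lemma Rintegral_triangle : \int[mu]_(x in D) (g x * \int[mu]_(y in `]x, d]) v y) =
  \int[mu]_(y in D) (v y * \int[mu]_(x in `]c, y[) g x).
Proof.
rewrite [LHS]Rintegral_mkcond [RHS]Rintegral_mkcond.
transitivity (\int[mu]_x (\int[mu]_y H v (x, y))); last first.
  rewrite Rfubini; apply: eq_Rintegral => y _.
  rewrite patchE; case: ifPn => [/set_mem/Hy//|/negP yD].
  rewrite -[RHS](Rintegral0 mu setT).
  apply: eq_Rintegral => x _; rewrite /H/= vD ?mul0r ?mulr0//.
  by move=> Dy; apply: yD; exact: mem_set.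
apply: eq_Rintegral => x _; rewrite patchE; case: ifPn => [xD|xD]; last first.
  rewrite -[LHS](Rintegral0 mu setT).
  by apply: eq_Rintegral => y _; rewrite /H/= /gg patchE (negbTE xD) mul0r.
have Dxd : `]x, d] `<=` D.
  move=> y; have := set_mem xD; rewrite /D /= !in_itv/= => /andP[cx _] /andP[xy ->].
  by rewrite (lt_trans cx xy).
rewrite -RintegralZl_itv//; last first.
  apply: (@Rintegrable_bounded _ _ _ _ _ _ _ M) => //.
  - exact: lebesgue_itvoc_fin.
  - exact: measurable_funTS.
rewrite [LHS]Rintegral_mkcond; apply: eq_Rintegral => y _.
rewrite patchE /H /gg /= patchE xD (_ : point = 0)//; case: ifPn => yxd; case: ifPn => xy.
- by rewrite mulr1.
- by have /= := set_mem yxd; rewrite in_itv/= (negbTE xy).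
- rewrite vD ?mul0r ?mulr0// /D /= in_itv/= => /andP[_ yd].
  by case/negP: yxd; apply: mem_set; rewrite /= in_itv/= xy.
- by rewrite !mulr0.
Qed.

End kernel.

End parts.
End Interval.

(** * Integration by parts against an integrable function *)

Section Parts.
Context {R : realType}.
Notation mu := (@lebesgue_measure R).
Implicit Types (f g u : R -> R) (c d : R).

Lemma RintegrableS_itv (i j : interval R) f : [set` i] `<=` [set` j] ->
  Rintegrable mu [set` j] f -> Rintegrable mu [set` i] f.
Proof.
move=> ij If; rewrite /Rintegrable.
exact: (@integrableS _ _ _ mu [set` j] [set` i] (EFin \o f) (measurable_itv _) (measurable_itv _) ij If).
Qed.

Lemma Rintegrable_le_itv (i : interval R) f g : measurable_fun [set` i] f ->
  Rintegrable mu [set` i] g -> (forall x, x \in i -> `|f x| <= g x) ->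
  Rintegrable mu [set` i] f.
Proof.
move=> mf Ig fg.
exact: (@Rintegrable_le _ _ R mu [set` i] (measurable_itv _) f g mf Ig fg).
Qed.

Lemma sub_itvoo_oc c d y : y \in `]c, d] -> [set` `]c, y[] `<=` [set` `]c, d]].
Proof.
rewrite in_itv/= => /andP[_ yd] x /=; rewrite !in_itv/= => /andP[-> xy].
exact: le_trans (ltW xy) yd.
Qed.

(** Integration by parts when g is merely integrable: u is the primitive of u',
    and the order of integration is exchanged. *)
Lemma Rintegral_by_parts c d g u u' (M : R) : c < d ->
  Rintegrable mu `]c, d] g -> continuous u' ->
  (forall x : R, is_derive x 1 u (u' x)) ->
  (forall x, x \in `]c, d] -> `|u' x| <= M) ->
  \int[mu]_(x in `]c, d]) (u x * g x) =
  u d * (\int[mu]_(x in `]c, d]) g x) -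
  \int[mu]_(y in `]c, d]) (u' y * \int[mu]_(x in `]c, y[) g x).
Proof.
move=> cd Ig cu' du u'M.
have mu' : measurable_fun [set: R] u' by exact: continuous_measurable_fun.
have cu : continuous u.
  by move=> x; apply/differentiable_continuous/derivable1_diffP; have [] := du x.
pose D : set R := [set` `]c, d]].
have mD : measurable D by exact: measurable_itv.
pose v := u' \_ D.
have mv : measurable_fun [set: R] v.
  by apply: (measurable_restrictT u' mD).1; exact: measurable_funTS.
have M0 : 0 <= M by apply: le_trans (u'M d _); rewrite ?in_itv/= ?cd ?lexx.
have vM x : `|v x| <= M.
  by rewrite /v patchE; case: ifPn => [/set_mem/u'M//|_]; rewrite normr0.
have vD x : ~ D x -> v x = 0.
  by move=> Dx; rewrite /v patchE; case: ifPn => // /set_mem.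
have := Rintegral_triangle cd Ig mv vM vD.
have -> : \int[mu]_(y in `]c, d]) (v y * \int[mu]_(x in `]c, y[) g x) =
          \int[mu]_(y in `]c, d]) (u' y * \int[mu]_(x in `]c, y[) g x).
  by apply: eq_Rintegral => y yD; rewrite /v patchE yD.
move=> <-.
have cub : exists B : R, forall x, x \in `]c, d] -> `|u x| <= B.
  have cu0 : {within `[c, d], continuous u} by exact: continuous_subspaceT.
  have [x1 x1D Hx1] := EVT_max (ltW cd) cu0.
  have [x2 x2D Hx2] := EVT_min (ltW cd) cu0.
  exists (`|u x1| + `|u x2|) => x; rewrite in_itv/= => /andP[cx xd].
  have xcd : x \in `[c, d] by rewrite in_itv/= (ltW cx) xd.
  have := Hx1 x xcd; have := Hx2 x xcd; rewrite ler_norml.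
  have := ler_norm (u x1); have := ler_norm (- u x2).
  by rewrite normrN; have := normr_ge0 (u x1); have := normr_ge0 (u x2); lra.
have [B uB] := cub.
have Iug : Rintegrable mu `]c, d] (fun x => u x * g x).
  apply: (@RintegrableM_bounded _ _ _ _ _ _ _ _ B) => //.
  by apply: measurable_funTS; exact: continuous_measurable_fun.
have -> : \int[mu]_(x in `]c, d]) (g x * \int[mu]_(y in `]x, d]) v y) =
          \int[mu]_(x in `]c, d]) (u d * g x - u x * g x); last first.
  rewrite RintegralB; [|exact: measurable_itv|exact: RintegrableZ|exact: Iug].
  by rewrite (RintegralZl_itv _ Ig); ring.
apply: eq_Rintegral => x /set_mem/= xD.
suff -> : \int[mu]_(y in `]x, d]) v y = u d - u x by ring.
move: xD; rewrite in_itv/= => /andP[cx xd].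
have -> : \int[mu]_(y in `]x, d]) v y = \int[mu]_(y in `]x, d]) u' y.
  apply: eq_Rintegral => y /set_mem/=; rewrite in_itv/= => /andP[xy yd].
  by rewrite /v patchE ifT// inE /D/= in_itv/= yd (lt_trans cx).
move: xd; rewrite le_eqVlt => /orP[/eqP ->|xd].
  by rewrite set_itvoc0 Rintegral_set0 subrr.
by rewrite (FTC2_itvoc xd cu' du).
Qed.

Lemma measurable_primitive c d g : c < d -> Rintegrable mu `]c, d] g ->
  measurable_fun `]c, d] (fun y => \int[mu]_(x in `]c, y[) g x).
Proof.
move=> cd Ig; pose D : set R := [set` `]c, d]].
have mD : measurable D by exact: measurable_itv.
have mv : measurable_fun [set: R] (\1_D : R -> R) by exact: measurable_indic.
have v1 x : `|(\1_D x : R)| <= 1 by rewrite indicE; case: (_ \in _); rewrite ?normr1 ?normr0.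
have vD x : ~ D x -> \1_D x = 0 :> R by move=> Dx; rewrite indicE memNset.
apply: eq_measurable_fun (measurable_mul_primitive cd Ig mv v1 vD) => y yD.
by rewrite indicE yD mul1r.
Qed.

Lemma primitive_bounded c d g y : Rintegrable mu `]c, d] g -> y \in `]c, d] ->
  `|\int[mu]_(x in `]c, y[) g x| <= \int[mu]_(x in `]c, d]) `|g x|.
Proof.
move=> Ig yD; have sub := sub_itvoo_oc yD.
have Ig' := RintegrableS_itv sub Ig.
apply: le_trans (@le_normr_Rintegral _ _ R mu [set` `]c, y[] g (measurable_itv _) Ig') _.
rewrite Rintegral_mkcond [leRHS]Rintegral_mkcond.
have In (i : interval R) : Rintegrable mu [set` i] g ->
    Rintegrable mu setT ((fun x => `|g x|) \_ [set` i]).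
  move=> Ii; have := integrable_norm Ii.
  move=> /(@integrable_mkcond _ _ _ mu [set` i] _ (measurable_itv _)).
  by rewrite restrict_EFin.
apply: le_Rintegral; [exact: measurableT|exact: (In _ Ig')|exact: (In _ Ig)|move=> x _].
rewrite !patchE (_ : point = 0)//; case: ifPn => [xy|_]; last by case: ifPn.
by rewrite ifT//; apply: mem_set; apply: sub; exact: set_mem.
Qed.

Lemma Rintegrable_primitive_sqr c d g : c < d -> Rintegrable mu `]c, d] g ->
  Rintegrable mu `]c, d] (fun y => (\int[mu]_(x in `]c, y[) g x) ^+ 2).
Proof.
move=> cd Ig; set B := \int[mu]_(x in `]c, d]) `|g x|.
apply: (@Rintegrable_bounded _ _ _ _ _ _ _ (B ^+ 2)) => //.
- exact: lebesgue_itvoc_fin.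
- exact: measurable_funX (measurable_primitive cd Ig).
- move=> y yD; rewrite normrX lerXn2r ?nnegrE//; last exact: primitive_bounded.
  by apply: Rintegral_ge0 => x _.
Qed.

(** Integration against a slowly varying weight u is controlled by the primitives
    of the integrand, with constants that depend on u through A and M only. *)
Lemma Rintegral_sqr_by_parts c d g u u' (A M : R) : c < d ->
  Rintegrable mu `]c, d] g -> continuous u' ->
  (forall x : R, is_derive x 1 u (u' x)) ->
  `|u d| <= A -> (forall x, x \in `]c, d] -> `|u' x| <= M) ->
  (\int[mu]_(x in `]c, d]) (u x * g x)) ^+ 2 <=
  2 * (A ^+ 2 * (\int[mu]_(x in `]c, d]) g x) ^+ 2 +
       (d - c) * M ^+ 2 *
       \int[mu]_(y in `]c, d]) ((\int[mu]_(x in `]c, y[) g x) ^+ 2)).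
Proof.
move=> cd Ig cu' du uA u'M.
rewrite (Rintegral_by_parts cd Ig cu' du u'M).
set X := \int[mu]_(x in `]c, d]) g x.
pose G y := \int[mu]_(x in `]c, y[) g x.
set Y := \int[mu]_(y in `]c, d]) _; set Z := \int[mu]_(y in `]c, d]) _.
have mG := measurable_primitive cd Ig.
have IG2 := Rintegrable_primitive_sqr cd Ig.
have mu' : measurable_fun `]c, d] u'.
  by apply: measurable_funTS; exact: continuous_measurable_fun.
have H x : x \in `]c, d] -> (u' x * G x) ^+ 2 <= M ^+ 2 * G x ^+ 2.
  move=> xD; rewrite exprMn ler_wpM2r ?sqr_ge0//.
  by rewrite -(real_normK (num_real (u' x))) lerXn2r ?nnegrE//; [exact: le_trans (u'M _ xD)|exact: u'M].
have IuG2 : Rintegrable mu `]c, d] (fun x => (u' x * G x) ^+ 2).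
  apply: (@Rintegrable_le_itv _ _ (fun x => M ^+ 2 * G x ^+ 2)) => //.
  - by apply: measurable_funX; exact: measurable_funM.
  - exact: RintegrableZ.
  - by move=> x xD; rewrite ger0_norm ?sqr_ge0//; exact: H.
have YZ : Y ^+ 2 <= (d - c) * M ^+ 2 * Z.
  have D0 := @lebesgue_itvoc_fin R c d.
  apply: le_trans (sqr_Rintegral_le _ D0 _ IuG2) _ => //; first exact: measurable_funM.
  rewrite [X in fine X](lebesgue_itvoc (ltW cd))/= -mulrA ler_wpM2l ?subr_ge0 ?(ltW cd)//.
  rewrite -(RintegralZl_itv _ IG2); apply: le_Rintegral => //; exact: RintegrableZ.
have XA : (u d * X) ^+ 2 <= A ^+ 2 * X ^+ 2.
  rewrite exprMn ler_wpM2r ?sqr_ge0// -(real_normK (num_real (u d))).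
  by rewrite lerXn2r ?nnegrE//; exact: le_trans uA.
apply: (@le_trans _ _ (2 * ((u d * X) ^+ 2 + Y ^+ 2))).
  by have := sqr_ge0 (u d * X + Y); lra.
by rewrite ler_wpM2l// lerD.
Qed.

End Parts.

(** * Bessel majorants for slowly varying weights *)

Section LaplaceInterval.
Context {R : realType}.
Notation mu := (@lebesgue_measure R).
Implicit Types (f g u a : R -> R) (c d : R).

Lemma Rintegrable_restrict_itv (i j : interval R) f : [set` i] `<=` [set` j] ->
  Rintegrable mu [set` i] f -> Rintegrable mu [set` j] (f \_ [set` i]).
Proof.
move=> ij If; rewrite /Rintegrable -restrict_EFin.
apply: (@integrable_restrict _ _ R mu [set` i] (measurable_itv _) [set` j] (measurable_itv _) (EFin \o f)).1.
by rewrite setIidr.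
Qed.

Lemma Rintegral_restrict_itv (i j : interval R) f : [set` i] `<=` [set` j] ->
  \int[mu]_(x in [set` j]) (f \_ [set` i]) x = \int[mu]_(x in [set` i]) f x.
Proof. by move=> ij; rewrite -Rintegral_mkcondr setIidr. Qed.

Lemma Rintegral_subset_itv (i j : interval R) f : [set` i] `<=` [set` j] ->
  Rintegrable mu [set` j] f -> (forall x, 0 <= f x) ->
  \int[mu]_(x in [set` i]) f x <= \int[mu]_(x in [set` j]) f x.
Proof.
move=> ij If f0; rewrite -(Rintegral_restrict_itv _ ij).
apply: (@le_Rintegral _ _ R mu [set` j] _ _ (measurable_itv _)) => //.
  exact: Rintegrable_restrict_itv (RintegrableS_itv ij If).
by move=> x _; rewrite patchE (_ : point = 0)//; case: ifPn.
Qed.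

Section orthogonal_family.
Variables (c d T : R) (e : nat -> R -> R).
Hypotheses (cd : c < d) (dT : d <= c + T).
Hypotheses (ce : forall k, continuous (e k)) (e1 : forall k x, `|e k x| <= 1).
Hypothesis eorth : forall j k, (j < k)%N ->
  \int[mu]_(x in `]c, c + T]) (e j x * e k x) = 0.

Let T0 : 0 < T. Proof. by have := lt_le_trans cd dT; rewrite ltrDl. Qed.

Let me (D : set R) k : measurable_fun D (e k).
Proof. by apply: measurable_funTS; exact: continuous_measurable_fun. Qed.

Variable a : R -> R.
Hypotheses (ma : measurable_fun `]c, d] a)
           (Ia2 : Rintegrable mu `]c, d] (fun x => a x ^+ 2)).

Let Ia : Rintegrable mu `]c, d] a.
Proof. by apply: Rintegrable_sqr_int => //; exact: lebesgue_itvoc_fin. Qed.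

Let Iae k : Rintegrable mu `]c, d] (fun x => a x * e k x).
Proof.
apply: (Rintegrable_le_itv _ (integrable_norm Ia)).
  exact: measurable_funM.
by move=> x xD /=; rewrite normrM ler_piMr.
Qed.

(** Bessel's inequality for the Fourier coefficients of a over a part of ]c, d],
    the family being orthogonal on the longer interval ]c, c + T]. *)
Lemma bessel_itv (i : interval R) K : [set` i] `<=` `]c, d] ->
  \sum_(k < K) (\int[mu]_(x in [set` i]) (a x * e k x)) ^+ 2 <=
  T * \int[mu]_(x in `]c, d]) (a x ^+ 2).
Proof.
move=> id.
have dT' : [set` `]c, d]] `<=` [set` `]c, c + T]].
  by apply: subset_itvl; rewrite bnd_simp.
have iT := subset_trans id dT'.
(* Restricting a to the interval turns the integral over it into a Fourier
   coefficient over the full period. *)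
pose b := a \_ [set` i].
have mb : measurable_fun [set` `]c, c + T]] b.
  apply: (measurable_restrict a (measurable_itv _) (measurable_itv _)).1.
  by rewrite setIidr//; apply: measurable_funS id ma => //; exact: measurable_itv.
have b2 : (fun x => b x ^+ 2) = (fun x => a x ^+ 2) \_ [set` i].
  apply/funext => x; rewrite /b !patchE (_ : point = 0)//.
  by case: ifPn => // _; rewrite expr0n.
have Ib2 : Rintegrable mu [set` `]c, c + T]] (fun x => b x ^+ 2).
  by rewrite b2; apply: Rintegrable_restrict_itv => //; exact: RintegrableS_itv Ia2.
have e2 k : Rintegrable mu [set` `]c, c + T]] (fun x => e k x ^+ 2).
  apply: continuous_Rintegrable => x; under eq_fun do rewrite expr2.
  by apply: continuousM; exact: ce.
have cT : c <= c + T by rewrite lerDl ltW.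
have e2T k : \int[mu]_(x in `]c, c + T]) (e k x ^+ 2) <= T.
  apply: (@le_trans _ _ (\int[mu]_(x in `]c, c + T]) (cst 1 x))).
    apply: le_Rintegral => //.
    - exact: e2.
    - apply: continuous_Rintegrable; exact: cst_continuous.
    - by move=> x _; rewrite -(real_normK (num_real _)) expr_le1.
  rewrite Rintegral_cst//= mul1r [X in fine X](lebesgue_itvoc cT)/=.
  by rewrite addrAC subrr add0r.
have := @bessel _ _ R mu [set` `]c, c + T]] (measurable_itv _) e T b K T0 mb Ib2
  (fun k => me _) e2 e2T eorth.
rewrite b2 Rintegral_restrict_itv// => H.
under eq_bigr => k _.
  rewrite -(Rintegral_restrict_itv _ iT).
  rewrite (_ : _ \_ _ = (fun x => b x * e k x)); last first.
    apply/funext => x; rewrite /b !patchE (_ : point = 0)//.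
    by case: ifPn => // _; rewrite mul0r.
  over.
apply: (le_trans H); rewrite ler_wpM2l ?(ltW T0)//.
by apply: Rintegral_subset_itv => // x; exact: sqr_ge0.
Qed.

Let G k y := \int[mu]_(x in `]c, y[) (a x * e k x).

(** A bound for the square of the integral of u * a * e_k over ]c, d] that holds
    for all weights u which vary slowly at the scale d - c; it involves the
    primitives of a * e_k but not u. *)
Definition laplace_majorant k : R :=
  2 * ((\int[mu]_(x in `]c, d]) (a x * e k x)) ^+ 2 +
       16 / (d - c) * \int[mu]_(y in `]c, d]) (G k y ^+ 2)).

Lemma laplace_majorant_ge0 k : 0 <= laplace_majorant k.
Proof.
rewrite mulr_ge0// addr_ge0 ?sqr_ge0// mulr_ge0//.
  by rewrite divr_ge0// subr_ge0 ltW.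
by apply: Rintegral_ge0 => y _; exact: sqr_ge0.
Qed.

(** Bessel's inequality applies to the values at each point of the primitives
    of a * e_k, hence the majorants are summable. *)
Lemma laplace_majorant_sum K :
  \sum_(k < K) laplace_majorant k <= 34 * T * \int[mu]_(x in `]c, d]) (a x ^+ 2).
Proof.
set J := \int[mu]_(x in _) _.
have IG k : Rintegrable mu `]c, d] (fun y => G k y ^+ 2).
  exact: Rintegrable_primitive_sqr.
have B1 := bessel_itv K (@subset_refl _ [set` `]c, d]]).
have B2 : \sum_(k < K) \int[mu]_(y in `]c, d]) (G k y ^+ 2) <= (d - c) * (T * J).
  rewrite -Rintegral_sum//.
  apply: (@le_trans _ _ (\int[mu]_(x in `]c, d]) (cst (T * J) x))).
    apply: le_Rintegral => //.
    - exact: Rintegrable_sum.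
    - apply: continuous_Rintegrable; exact: cst_continuous.
    - by move=> y yD; apply: bessel_itv; exact: sub_itvoo_oc.
  rewrite Rintegral_cst//= [X in _ * fine X](lebesgue_itvoc (ltW cd))/=.
  by rewrite mulrC.
rewrite /laplace_majorant -mulr_sumr big_split/= -mulr_sumr.
have -> : 34 * T * J = 2 * (T * J + 16 * (T * J)) by ring.
rewrite ler_wpM2l// lerD// -mulrA ler_wpM2l//.
by rewrite mulrC ler_pdivrMr ?subr_gt0// mulrC.
Qed.

Lemma laplace_majorantP k u u' (A : R) :
  continuous u' -> (forall x : R, is_derive x 1 u (u' x)) ->
  `|u d| <= A -> (forall x, x \in `]c, d] -> `|u' x| <= 4 / (d - c) * A) ->
  (\int[mu]_(x in `]c, d]) (u x * (a x * e k x))) ^+ 2 <=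
    A ^+ 2 * laplace_majorant k.
Proof.
move=> cu' du uA u'A.
apply: (le_trans (Rintegral_sqr_by_parts cd (Iae k) cu' du uA u'A)).
rewrite le_eqVlt; apply/orP; left; apply/eqP.
rewrite /laplace_majorant /G; field.
by rewrite subr_eq0 gt_eqF.
Qed.

End orthogonal_family.
End LaplaceInterval.

(** * Exponentially damped trigonometric weights on one interval *)

Section LaplaceTrig.
Context {R : realType}.
Notation mu := (@lebesgue_measure R).
Implicit Types (x y : R).

Lemma is_derive_mulr (w t : R) : is_derive t 1 (fun s : R => w * s) w.
Proof. by apply: is_derive_eq; rewrite -[w *: 1]/(w * 1) mulr1. Qed.

Lemma is_derive_cosM (w t : R) :
  is_derive t 1 (fun s => cos (w * s)) (- w * sin (w * t)).
Proof.
have := @is_derive1_comp R cos (fun t => w * t) t _ _ (is_derive_cos _) (is_derive_mulr w t).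
by move=> H; apply: (is_derive_eq H); rewrite -[LHS]/(- sin (w * t) * w); ring.
Qed.

Lemma is_derive_sinM (w t : R) :
  is_derive t 1 (fun s => sin (w * s)) (w * cos (w * t)).
Proof.
have := @is_derive1_comp R sin (fun t => w * t) t _ _ (is_derive_sin _) (is_derive_mulr w t).
by move=> H; apply: (is_derive_eq H); rewrite -[LHS]/(cos (w * t) * w) mulrC.
Qed.

Lemma is_derive_expRM (w t : R) :
  is_derive t 1 (fun s => expR (w * s)) (w * expR (w * t)).
Proof.
have := @is_derive1_comp R expR (fun t => w * t) t _ _ (is_derive_expR _) (is_derive_mulr w t).
by move=> H; apply: (is_derive_eq H); rewrite -[LHS]/(expR (w * t) * w) mulrC.
Qed.

Lemma continuous_expRM (w : R) : continuous (fun t => expR (w * t)).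
Proof.
move=> x; apply: continuous_comp; last exact: continuous_expR.
by apply: continuousM; [exact: cst_continuous|exact: cvg_id].
Qed.

(** Real part of t |-> e^(-(x - i h) t). *)
Definition dcos (x h : R) (t : R) : R := expR (- x * t) * cos (h * t).
(** Imaginary part of t |-> e^(-(x - i h) t). *)
Definition dsin (x h : R) (t : R) : R := expR (- x * t) * sin (h * t).

Lemma is_derive_dcos x h (t : R) :
  is_derive t 1 (dcos x h) (- x * dcos x h t - h * dsin x h t).
Proof.
have := is_deriveM (is_derive_expRM (- x) t) (is_derive_cosM h t).
move=> H; apply: (is_derive_eq H); rewrite /dcos /dsin -![_ *: _]/(_ * _); ring.
Qed.

Lemma is_derive_dsin x h (t : R) :
  is_derive t 1 (dsin x h) (- x * dsin x h t + h * dcos x h t).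
Proof.
have := is_deriveM (is_derive_expRM (- x) t) (is_derive_sinM h t).
move=> H; apply: (is_derive_eq H); rewrite /dcos /dsin -![_ *: _]/(_ * _); ring.
Qed.

Lemma continuous_dcos x h : continuous (dcos x h).
Proof.
by move=> t; apply: (@cvgM _ R^o _ _ (fun s => expR (- x * s)) (fun s => cos (h * s)));
  [exact: continuous_expRM|exact: continuous_cosM].
Qed.

Lemma continuous_dsin x h : continuous (dsin x h).
Proof.
by move=> t; apply: (@cvgM _ R^o _ _ (fun s => expR (- x * s)) (fun s => sin (h * s)));
  [exact: continuous_expRM|exact: continuous_sinM].
Qed.

Lemma dcos_le x h c t : 0 <= x -> c <= t -> `|dcos x h t| <= expR (- x * c).
Proof.
move=> x0 ct; rewrite normrM ger0_norm ?expR_ge0//.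
rewrite -[leRHS]mulr1 ler_pM ?expR_ge0 ?cos_max//.
by rewrite ler_expR !mulNr lerN2 ler_wpM2l.
Qed.

Lemma dsin_le x h c t : 0 <= x -> c <= t -> `|dsin x h t| <= expR (- x * c).
Proof.
move=> x0 ct; rewrite normrM ger0_norm ?expR_ge0//.
rewrite -[leRHS]mulr1 ler_pM ?expR_ge0 ?sin_max//.
by rewrite ler_expR !mulNr lerN2 ler_wpM2l.
Qed.

Lemma dcosD x p h t :
  dcos x (p + h) t = dcos x h t * cos (p * t) - dsin x h t * sin (p * t).
Proof. by rewrite /dcos /dsin mulrDl cosD; ring. Qed.

Lemma dsinD x p h t :
  dsin x (p + h) t = dcos x h t * sin (p * t) + dsin x h t * cos (p * t).
Proof. by rewrite /dcos /dsin mulrDl sinD; ring. Qed.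

Lemma sqr_sum_le (A X Y m n : R) : X ^+ 2 <= A ^+ 2 * m -> Y ^+ 2 <= A ^+ 2 * n ->
  0 <= m -> 0 <= n ->
  (X - Y) ^+ 2 <= A ^+ 2 * (4 * (m + n)) /\ (X + Y) ^+ 2 <= A ^+ 2 * (4 * (m + n)).
Proof.
move=> Xm Yn m0 n0; have A20 := sqr_ge0 A.
have := mulr_ge0 A20 m0; have := mulr_ge0 A20 n0.
by have := sqr_ge0 (X - Y); have := sqr_ge0 (X + Y); split; lra.
Qed.

(** The frequency axis is cut into cells of length 2 / L. The suprema over all
    cells of the transform of a function carried by an interval of length L are
    square-summable. The frequencies k * (2 / L) are orthogonal on any interval
    of length pi * L, and the interval ]c, c + L] fits into one of those. *)
Lemma laplace_interval (c L : R) (a : R -> R) : 0 < L ->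
  measurable_fun `]c, c + L] a ->
  Rintegrable mu `]c, c + L] (fun t => a t ^+ 2) ->
  exists M : nat -> R, [/\ forall k, 0 <= M k,
    forall K, \sum_(k < K) M k <=
      272 * pi * L * \int[mu]_(t in `]c, c + L]) (a t ^+ 2) &
    forall k x h, 0 <= x <= 2 / L -> 0 <= h <= 2 / L ->
      (\int[mu]_(t in `]c, c + L]) (dcos x (k%:R * (2 / L) + h) t * a t)) ^+ 2
        <= expR (- x * c) ^+ 2 * M k /\
      (\int[mu]_(t in `]c, c + L]) (dsin x (k%:R * (2 / L) + h) t * a t)) ^+ 2
        <= expR (- x * c) ^+ 2 * M k].
Proof.
move=> L0 ma Ia2.
pose w := 2 / L; pose T := pi * L.
have w0 : 0 < w by rewrite divr_gt0.
have T0 : 0 < T by rewrite mulr_gt0// pi_gt0.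
have wT : w * T = pi *+ 2 by rewrite /w /T; field; rewrite gt_eqF.
have cd : c < c + L by rewrite ltrDl.
have dT : c + L <= c + T by rewrite lerD2l /T ler_peMl ?(ltW L0)// (le_trans _ (pi_ge2 _))// ler1n.
pose ec k t := cos (k%:R * w * t); pose es k t := sin (k%:R * w * t).
have cec k : continuous (ec k) by exact: continuous_cosM.
have ces k : continuous (es k) by exact: continuous_sinM.
have ec1 k x : `|ec k x| <= 1 by exact: cos_max.
have es1 k x : `|es k x| <= 1 by exact: sin_max.
have oc j k : (j < k)%N -> \int[mu]_(x in `]c, c + T]) (ec j x * ec k x) = 0.
  exact: cos_orthogonal.
have os j k : (j < k)%N -> \int[mu]_(x in `]c, c + T]) (es j x * es k x) = 0.
  exact: sin_orthogonal.
(* The addition formulas reduce cos ((k w + h) t) and sin ((k w + h) t) to the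
   two orthogonal families ec and es with slowly varying weights. *)
pose Mc := laplace_majorant c (c + L) ec a.
pose Ms := laplace_majorant c (c + L) es a.
have Mc0 k : 0 <= Mc k by exact: laplace_majorant_ge0.
have Ms0 k : 0 <= Ms k by exact: laplace_majorant_ge0.
have dc : c + L - c = L by ring.
have Ia : Rintegrable mu `]c, c + L] a.
  by apply: Rintegrable_sqr_int => //; exact: lebesgue_itvoc_fin.
exists (fun k => 4 * (Mc k + Ms k)); split.
- by move=> k; apply: mulr_ge0; [exact: ler0n|exact: addr_ge0 (Mc0 k) (Ms0 k)].
- move=> K; rewrite -mulr_sumr big_split/=.
  have Hc := laplace_majorant_sum cd dT cec ec1 oc ma Ia2 K.
  have Hs := laplace_majorant_sum cd dT ces es1 os ma Ia2 K.
  set J := \int[mu]_(t in _) _ in Hc Hs *.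
  have -> : 272 * pi * L * J = 4 * (34 * T * J + 34 * T * J) by rewrite /T; ring.
  by apply: ler_wpM2l; [exact: ler0n|exact: lerD Hc Hs].
move=> k x h /andP[x0 xL] /andP[h0 hL].
set A := expR (- x * c).
have A0 : 0 <= A by exact: expR_ge0.
have bound (p q t : R) : t \in `]c, c + L] -> `|p| <= A -> `|q| <= A ->
    `|- x * p - h * q| <= 4 / (c + L - c) * A /\
    `|- x * p + h * q| <= 4 / (c + L - c) * A.
  move=> _ pA qA; rewrite dc.
  have xp : `|- x * p| <= 2 / L * A by rewrite normrM normrN (ger0_norm x0) ler_pM.
  have hq : `|h * q| <= 2 / L * A by rewrite normrM (ger0_norm h0) ler_pM.
  have -> : 4 / L * A = 2 / L * A + 2 / L * A by ring.
  by split; [apply: le_trans (ler_normB _ _) _|apply: le_trans (ler_normD _ _) _];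
     rewrite lerD.
have ct t : t \in `]c, c + L] -> c <= t by rewrite in_itv/= => /andP[/ltW].
have dA : c <= c + L by exact: ltW.
have cc' : continuous (fun t => - x * dcos x h t - h * dsin x h t).
  move=> t; apply: cvgB; apply: cvgM; [exact: cvg_cst|exact: continuous_dcos|
    exact: cvg_cst|exact: continuous_dsin].
have cs' : continuous (fun t => - x * dsin x h t + h * dcos x h t).
  move=> t; apply: cvgD; apply: cvgM; [exact: cvg_cst|exact: continuous_dsin|
    exact: cvg_cst|exact: continuous_dcos].
have ubc t : t \in `]c, c + L] -> `|- x * dcos x h t - h * dsin x h t| <= 4 / (c + L - c) * A.
  move=> tD; exact: (bound _ _ t tD (dcos_le _ x0 (ct t tD)) (dsin_le _ x0 (ct t tD))).1.
have ubs t : t \in `]c, c + L] -> `|- x * dsin x h t + h * dcos x h t| <= 4 / (c + L - c) * A.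
  move=> tD; exact: (bound _ _ t tD (dsin_le _ x0 (ct t tD)) (dcos_le _ x0 (ct t tD))).2.
have Pcc := laplace_majorantP cd cec ec1 ma Ia2 k cc' (is_derive_dcos x h) (dcos_le h x0 dA) ubc.
have Pcs := laplace_majorantP cd ces es1 ma Ia2 k cc' (is_derive_dcos x h) (dcos_le h x0 dA) ubc.
have Psc := laplace_majorantP cd cec ec1 ma Ia2 k cs' (is_derive_dsin x h) (dsin_le h x0 dA) ubs.
have Pss := laplace_majorantP cd ces es1 ma Ia2 k cs' (is_derive_dsin x h) (dsin_le h x0 dA) ubs.
have mc (u : R -> R) : continuous u -> measurable_fun `]c, c + L] u.
  by move=> cu; apply: measurable_funTS; exact: continuous_measurable_fun.
have I (u v : R -> R) : continuous u -> (forall t, t \in `]c, c + L] -> `|u t| <= A) ->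
    continuous v -> (forall t, `|v t| <= 1) ->
    Rintegrable mu `]c, c + L] (fun t => u t * (a t * v t)).
  move=> cu uA cv v1.
  apply: (Rintegrable_le_itv _ (RintegrableZ _ A (integrable_norm Ia))) => //.
    by apply: measurable_funM; [exact: mc|apply: measurable_funM => //; exact: mc].
  move=> t tD /=; rewrite !normrM ler_pM ?mulr_ge0//; first exact: uA.
  by rewrite ler_piMr.
have dcA t : t \in `]c, c + L] -> `|dcos x h t| <= A by move=> tD; exact: dcos_le (ct t tD).
have dsA t : t \in `]c, c + L] -> `|dsin x h t| <= A by move=> tD; exact: dsin_le (ct t tD).
have Icc := I _ _ (@continuous_dcos x h) dcA (cec k) (ec1 k).
have Ics := I _ _ (@continuous_dcos x h) dcA (ces k) (es1 k).
have Isc := I _ _ (@continuous_dsin x h) dsA (cec k) (ec1 k).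
have Iss := I _ _ (@continuous_dsin x h) dsA (ces k) (es1 k).
split.
- have -> : \int[mu]_(t in `]c, c + L]) (dcos x (k%:R * (2 / L) + h) t * a t) =
    \int[mu]_(t in `]c, c + L]) (dcos x h t * (a t * ec k t)) -
    \int[mu]_(t in `]c, c + L]) (dsin x h t * (a t * es k t)).
    rewrite -RintegralB//; apply: eq_Rintegral => t _.
    by rewrite dcosD /ec /es /w; ring.
  exact: (sqr_sum_le Pcc Pss (Mc0 k) (Ms0 k)).1.
- have -> : \int[mu]_(t in `]c, c + L]) (dsin x (k%:R * (2 / L) + h) t * a t) =
    \int[mu]_(t in `]c, c + L]) (dsin x h t * (a t * ec k t)) +
    \int[mu]_(t in `]c, c + L]) (dcos x h t * (a t * es k t)).
    rewrite -RintegralD//; apply: eq_Rintegral => t _.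
    by rewrite dsinD /ec /es /w; ring.
  exact: (sqr_sum_le Psc Pcs (Mc0 k) (Ms0 k)).2.
Qed.

End LaplaceTrig.

(** * Summation over the subintervals of a dyadic partition *)

Section LaplaceStrip.
Context {R : realType}.
Notation mu := (@lebesgue_measure R).

Lemma Rintegral_split (L : R) (f : R -> R) (K : nat) : 0 < L ->
  Rintegrable mu `]0, K%:R * L] f ->
  \int[mu]_(t in `]0, K%:R * L]) f t =
  \sum_(m < K) \int[mu]_(t in `]m%:R * L, m%:R * L + L]) f t.
Proof.
move=> L0; elim: K => [|K IHK] If.
  by rewrite big_ord0 mul0r set_itvoc0 Rintegral_set0.
have e : K.+1%:R * L = K%:R * L + L by rewrite -natr1 mulrDl mul1r.
have KL : 0 <= K%:R * L by rewrite mulr_ge0// ltW.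
have If' : Rintegrable mu `]0, K%:R * L] f.
  by apply: RintegrableS_itv If; apply: subset_itvl; rewrite bnd_simp e lerDl ltW.
rewrite big_ord_recr/= -(IHK If') addrC.
rewrite -(@Rintegral_itvB _ f (BRight 0) (BRight (K%:R * L + L)) (K%:R * L)).
- by rewrite e subrK.
- by rewrite -e.
- by rewrite bnd_simp.
- by rewrite bnd_simp lerDl ltW.
Qed.

Lemma sum_half_exprn n : \sum_(m < n) (2^-1 : R) ^+ m = 2 - 2 * 2^-1 ^+ n.
Proof.
elim: n => [|n IHn]; first by rewrite big_ord0 expr0; ring.
by rewrite big_ord_recr/= IHn exprS; field.
Qed.

(** The Cauchy-Schwarz inequality with geometric weights. *)
Lemma geometric_CS (X M : nat -> R) K :
  (forall m, (m < K)%N -> X m ^+ 2 <= (2^-1 ^+ m) ^+ 2 * M m) ->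
  (\sum_(m < K) X m) ^+ 2 <= 2 * \sum_(m < K) 2^-1 ^+ m * M m.
Proof.
move=> XM.
(* The linearized form 2 t S <= W t^2 + Q is additive in the number of terms. *)
have step t n : (n <= K)%N -> 2 * t * (\sum_(m < n) X m) <=
    (\sum_(m < n) (2^-1 : R) ^+ m) * t ^+ 2 + \sum_(m < n) 2^-1 ^+ m * M m.
  elim: n => [|n IHn] nK; first by rewrite !big_ord0; lra.
  rewrite !big_ord_recr/= mulrDr mulrDl.
  have := IHn (ltnW nK); have := XM n nK.
  set r : R := 2^-1 ^+ n; have r0 : 0 < r by rewrite exprn_gt0// invr_gt0.
  set x := X n; set y := M n => xy.
  have : 2 * t * x <= r * t ^+ 2 + r * y.
    rewrite -(ler_pM2l r0).
    have -> : r * (r * t ^+ 2 + r * y) = (r * t) ^+ 2 + r ^+ 2 * y by ring.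
    have := sqr_ge0 (r * t - x).
    have -> : r * (2 * t * x) = 2 * (r * t) * x by ring.
    by move: xy; clear; nra.
  by clear; lra.
set S := \sum_(m < K) X m; set Q := \sum_(m < K) _.
have := step (S / 2) K (leqnn K); rewrite sum_half_exprn -/S -/Q.
have r0 : 0 < (2^-1 : R) ^+ K by rewrite exprn_gt0// invr_gt0.
have := mulr_ge0 (ltW r0) (sqr_ge0 S).
set r := _ ^+ K; clear; nra.
Qed.

Lemma expR_le_half (m : nat) (y : R) : m%:R <= y -> expR (- y) <= 2^-1 ^+ m.
Proof.
move=> my; have : expR (- y) <= expR (- m%:R) by rewrite ler_expR lerN2.
move=> /le_trans; apply.
have -> : - m%:R = m%:R * (- 1) :> R by rewrite mulrN mulr1.
rewrite expRM_natl lerXn2r ?nnegrE ?expR_ge0 ?invr_ge0//.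
rewrite expRN lef_pV2 ?posrE ?expR_gt0//.
by apply: le_trans (expR_ge1Dx 1); lra.
Qed.

(** The interval ]0, 1] is cut into 2 ^ n pieces of length 2 ^ (- n). Where
    x >= 2 ^ n, the m-th piece is damped by the factor e^(- m) <= 2 ^ (- m). For
    n = 0 there is one piece and no damping is needed. *)
Lemma laplace_strip (n : nat) (a : R -> R) :
  let N : R := 2 ^+ n in let L := N^-1 in
  measurable_fun (`]0, 1] : set R) a ->
  Rintegrable mu `]0, 1] (fun t => a t ^+ 2) ->
  exists M : nat -> R, [/\ forall k, 0 <= M k,
    forall K, \sum_(k < K) M k <= 544 * pi * L *
       \sum_(m < 2 ^ n) 2^-1 ^+ m * \int[mu]_(t in `]m%:R * L, m%:R * L + L]) (a t ^+ 2) &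
    forall k x h, (0 < n)%N ==> (N <= x) -> 0 <= x <= 2 * N -> 0 <= h <= 2 * N ->
      (\int[mu]_(t in `]0, 1]) (dcos x (k%:R * (2 * N) + h) t * a t)) ^+ 2 <= M k /\
      (\int[mu]_(t in `]0, 1]) (dsin x (k%:R * (2 * N) + h) t * a t)) ^+ 2 <= M k].
Proof.
move=> N L ma Ia2.
have N0 : 0 < N by rewrite exprn_gt0.
have L0 : 0 < L by rewrite invr_gt0.
have NL : (2 ^ n)%:R * L = 1 by rewrite natrX mulfV// gt_eqF.
pose J m := [set` `]m%:R * L, m%:R * L + L]].
have J01 m : (m < 2 ^ n)%N -> J m `<=` [set` `]0, 1]].
  move=> mn t; rewrite /J/= !in_itv/= => /andP[mt tm].
  rewrite (le_lt_trans _ mt) ?mulr_ge0 ?(ltW L0)//=.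
  rewrite (le_trans tm)// -[leRHS]NL.
  have -> : m%:R * L + L = m.+1%:R * L by rewrite -natr1 mulrDl mul1r.
  by rewrite ler_wpM2r ?(ltW L0)// ler_nat.
have maJ m : (m < 2 ^ n)%N -> measurable_fun (J m) a.
  by move=> mn; apply: measurable_funS (J01 m mn) ma => //; exact: measurable_itv.
have IaJ m : (m < 2 ^ n)%N -> Rintegrable mu (J m) (fun t => a t ^+ 2).
  by move=> mn; exact: RintegrableS_itv (J01 m mn) Ia2.
have Ia : Rintegrable mu `]0, 1] a.
  by apply: Rintegrable_sqr_int => //; exact: lebesgue_itvoc_fin.
pose P (m : nat) (M : nat -> R) := [/\ forall k, 0 <= M k,
    forall K, \sum_(k < K) M k <= 272 * pi * L * \int[mu]_(t in J m) (a t ^+ 2) &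
    forall k x h, 0 <= x <= 2 / L -> 0 <= h <= 2 / L ->
      (\int[mu]_(t in J m) (dcos x (k%:R * (2 / L) + h) t * a t)) ^+ 2
        <= expR (- x * (m%:R * L)) ^+ 2 * M k /\
      (\int[mu]_(t in J m) (dsin x (k%:R * (2 / L) + h) t * a t)) ^+ 2
        <= expR (- x * (m%:R * L)) ^+ 2 * M k].
have HM (m : nat) : exists M, (m < 2 ^ n)%N -> P m M.
  case: (ltnP m (2 ^ n)) => mn; last by exists (fun=> 0).
  by have [M HM] := laplace_interval L0 (maJ m mn) (IaJ m mn); exists M.
have [M {}HM] := choice HM.
have LN : 2 / L = 2 * N by rewrite /L invrK.
exists (fun k => 2 * \sum_(m < 2 ^ n) 2^-1 ^+ m * M m k); split.
- move=> k; rewrite mulr_ge0// sumr_ge0// => m _.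
  by rewrite mulr_ge0 ?exprn_ge0 ?invr_ge0//; have [] := HM m (ltn_ord m).
- move=> K; rewrite -mulr_sumr exchange_big/=.
  have -> : 544 * pi * L = 2 * (272 * pi * L) by ring.
  rewrite -mulrA ler_wpM2l// mulr_sumr ler_sum// => m _.
  rewrite -mulr_sumr mulrCA ler_wpM2l ?exprn_ge0 ?invr_ge0//.
  by have [_ + _] := HM m (ltn_ord m); exact.
move=> k x h xN x2 h2.
have damp m : (m < 2 ^ n)%N -> expR (- x * (m%:R * L)) <= 2^-1 ^+ m.
  move=> mn; rewrite mulNr; apply: expR_le_half.
  case: m mn => [|m] mn; first by rewrite mul0r mulr0.
  have n0 : (0 < n)%N by case: (n) mn.
  have Nx : N <= x by move/implyP: xN; exact.
  rewrite mulrCA -[leLHS]mulr1 ler_wpM2l//.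
  by rewrite -[leLHS](mulfV (lt0r_neq0 N0)) ler_wpM2r// ltW.
have damp2 m z (y : R) : (m < 2 ^ n)%N -> 0 <= y ->
   z <= expR (- x * (m%:R * L)) ^+ 2 * y -> z <= (2^-1 ^+ m) ^+ 2 * y.
  move=> mn y0 /le_trans; apply; rewrite ler_wpM2r//.
  by apply: lerXn2r; rewrite ?nnegrE ?expR_ge0 ?exprn_ge0 ?invr_ge0//; exact: damp.
have split01 (f : R -> R) : Rintegrable mu `]0, 1] f ->
   \int[mu]_(t in `]0, 1]) f t = \sum_(m < 2 ^ n) \int[mu]_(t in J m) f t.
  by move=> If; have := @Rintegral_split L f (2 ^ n) L0; rewrite NL; exact.
have Iu (u : R -> R) : continuous u -> (forall t, t \in `]0, 1] -> `|u t| <= 1) ->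
    Rintegrable mu `]0, 1] (fun t => u t * a t).
  move=> cu u1; apply: (@RintegrableM_bounded _ _ R mu [set` `]0, 1]] (measurable_itv _) a u 1) => //.
  by apply: measurable_funTS; exact: continuous_measurable_fun.
have [x0 _] := andP x2.
have d1 (t : R) : t \in `]0, 1] -> 0 <= t by rewrite in_itv/= => /andP[/ltW].
rewrite (split01 _ (Iu _ (@continuous_dcos R x _) _)); last first.
  by move=> t /d1 t0; apply: (le_trans (dcos_le _ x0 t0)); rewrite mulr0 expR0.
rewrite (split01 _ (Iu _ (@continuous_dsin R x _) _)); last first.
  by move=> t /d1 t0; apply: (le_trans (dsin_le _ x0 t0)); rewrite mulr0 expR0.
rewrite -LN in x2 h2 *.
split; apply: (@geometric_CS (fun m => \int[mu]_(t in J m) _) (fun m => M m k)) => m mn.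
  by have [M0 _ /(_ k x h x2 h2)[H _]] := HM m mn; exact: damp2 H.
by have [M0 _ /(_ k x h x2 h2)[_ H]] := HM m mn; exact: damp2 H.
Qed.

End LaplaceStrip.

(** * The Young function and its dyadic estimate *)

Section OrliczStrip.
Context {R : realType}.
Notation mu := (@lebesgue_measure R).
Notation Phi := (Phi_exp R).

Lemma Phi_exp_ge0 (v : R) : 0 <= Phi v.
Proof. by rewrite /Phi_exp; have := expR_ge1Dx v; lra. Qed.

Lemma Phi_exp_homo (v w : R) : 0 <= v -> v <= w -> Phi v <= Phi w.
Proof.
move=> v0 vw; rewrite /Phi_exp.
have -> : w = v + (w - v) by ring.
rewrite expRD; have := expR_ge1Dx (w - v); have := expR_ge1Dx v.
set E := expR v; set F := expR (w - v) => E1 F1.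
have : E * (1 + (w - v)) <= E * F by rewrite ler_wpM2l ?expR_ge0.
by nra.
Qed.

Lemma continuous_Phi_exp : continuous Phi.
Proof.
move=> v; apply: cvgB; last exact: cvg_cst.
by apply: cvgB; [exact: continuous_expR|exact: cvg_id].
Qed.

Lemma measurable_Phi_exp : measurable_fun [set: R] Phi.
Proof. exact: continuous_measurable_fun continuous_Phi_exp. Qed.

Lemma expR_half_le_Phi (v : R) : 4 <= v -> expR (v / 2) <= Phi v.
Proof.
move=> v4; rewrite /Phi_exp.
have -> : v = v / 2 + v / 2 by field.
rewrite expRD -splitr; have := expR_ge1Dx (v / 2).
by set E := expR _; nra.
Qed.

Lemma sqr_le_expR (v : R) : 0 <= v -> v ^+ 2 <= 64 * expR (v / 4).
Proof.
move=> v0; have -> : v / 4 = v / 8 + v / 8 by field.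
rewrite expRD; have := expR_ge1Dx (v / 8).
by set E := expR _; nra.
Qed.

Lemma two_pow_le_expR n : (2 : R) ^+ n <= expR n%:R.
Proof.
rewrite -[n%:R]mulr1 expRM_natl; apply: lerXn2r; rewrite ?nnegrE ?expR_ge0//.
by apply: le_trans (expR_ge1Dx 1); lra.
Qed.

(** At the scale 2 ^ n, the square of a function with bounded Phi-integral is of
    order n ^ 2; maxn n 1 also covers n = 0. *)
Lemma sqr_le_Phi_exp n (v : R) : 0 <= v ->
  2 ^+ n * v ^+ 2 <= 64 * (2 ^+ n * (maxn n 1)%:R ^+ 2 + Phi v).
Proof.
move=> v0; set N : R := 2 ^+ n; set p : R := (maxn n 1)%:R.
have N0 : 0 < N by rewrite exprn_gt0.
have p1 : 1 <= p by rewrite ler1n leq_maxr.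
have pn : n%:R <= p by rewrite ler_nat leq_maxl.
have P0 := Phi_exp_ge0 v.
(* Above 4 p one has 2 ^ n <= e^(v/4), and the exponential absorbs v^2. *)
have [vp|pv] := leP v (4 * p).
  have : N * v ^+ 2 <= N * (64 * p ^+ 2) by rewrite ler_wpM2l ?(ltW N0)//; nra.
  by lra.
have h1 : N <= expR (v / 4).
  by apply: (le_trans (two_pow_le_expR n)); rewrite ler_expR; lra.
have h2 := sqr_le_expR v0.
have h3 : N * v ^+ 2 <= expR (v / 4) * (64 * expR (v / 4)).
  by apply: ler_pM => //; [exact: ltW|exact: sqr_ge0].
have h4 : expR (v / 4) * expR (v / 4) <= Phi v.
  rewrite -expRD (_ : v / 4 + v / 4 = v / 2); last by field.
  by apply: expR_half_le_Phi; lra.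
have := mulr_ge0 (ltW N0) (sqr_ge0 p).
by move: h3 h4; set E := expR _; lra.
Qed.

Section real_function.
Variables (kappa : R) (a : R -> R).
Hypotheses (k0 : 0 < kappa) (ma : measurable_fun (`]0, 1] : set R) a).
Hypothesis aPhi : (\int[mu]_(t in `]0%R, 1%R]) (Phi (kappa^-1 * `|a t|))%:E <= 1)%E.

Let mPhi : measurable_fun (`]0, 1] : set R) (fun t => Phi (kappa^-1 * `|a t|)).
Proof.
apply: (measurableT_comp measurable_Phi_exp).
by apply: measurable_funM => //; exact: measurableT_comp.
Qed.

Lemma orlicz_Rintegrable_Phi : Rintegrable mu `]0, 1] (fun t => Phi (kappa^-1 * `|a t|)).
Proof.
apply/integrableP; split; first exact/measurable_EFinP.
apply: le_lt_trans (ltry 1%R); apply: le_trans aPhi.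
rewrite le_eqVlt; apply/orP; left; apply/eqP; apply: eq_integral => t _ /=.
by rewrite ger0_norm// Phi_exp_ge0.
Qed.

Lemma orlicz_Rintegral_Phi :
  \int[mu]_(t in `]0, 1]) Phi (kappa^-1 * `|a t|) <= 1.
Proof.
rewrite -lee_fin /Rintegral fineK//.
by apply: integrable_fin_num => //; exact: orlicz_Rintegrable_Phi.
Qed.

Let aV n t : 2 ^+ n * a t ^+ 2 <=
  64 * kappa ^+ 2 * (2 ^+ n * (maxn n 1)%:R ^+ 2 + Phi (kappa^-1 * `|a t|)).
Proof.
have v0 : 0 <= kappa^-1 * `|a t| by rewrite mulr_ge0// invr_ge0 ltW.
have := sqr_le_Phi_exp n v0; rewrite -(ler_pM2l (exprn_gt0 2 k0)).
rewrite exprMn (real_normK (num_real _)) => H; apply: le_trans (le_trans H _).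
  rewrite le_eqVlt; apply/orP; left; apply/eqP; field.
  by rewrite gt_eqF.
rewrite le_eqVlt; apply/orP; left; apply/eqP; ring.
Qed.

Lemma orlicz_Rintegrable_sqr : Rintegrable mu `]0, 1] (fun t => a t ^+ 2).
Proof.
apply: (@Rintegrable_le_itv _ _ _ (fun t =>
  64 * kappa ^+ 2 * (1 + Phi (kappa^-1 * `|a t|)))).
- exact: measurable_funX.
- apply: RintegrableZ => //; apply: RintegrableD => //.
  + by apply: continuous_Rintegrable; exact: cst_continuous.
  + exact: orlicz_Rintegrable_Phi.
- move=> t _; rewrite ger0_norm ?sqr_ge0//.
  by have := aV 0 t; rewrite expr0 !mul1r max0n expr1n.
Qed.

Lemma orlicz_Rintegrable : Rintegrable mu `]0, 1] a.
Proof.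
apply: Rintegrable_sqr_int => //; first exact: lebesgue_itvoc_fin.
exact: orlicz_Rintegrable_sqr.
Qed.

(** The damped sum of the integrals of a ^ 2 over the dyadic pieces. *)
Lemma orlicz_dyadic n :
  \sum_(m < 2 ^ n) 2^-1 ^+ m *
    \int[mu]_(t in `]m%:R / 2 ^+ n, m%:R / 2 ^+ n + (2 ^+ n)^-1]) (a t ^+ 2) <=
  192 * kappa ^+ 2 * (maxn n 1)%:R ^+ 2 / 2 ^+ n.
Proof.
set L : R := (2 ^+ n)^-1; set p : R := (maxn n 1)%:R.
have N0 : 0 < (2 : R) ^+ n by rewrite exprn_gt0.
have L0 : 0 < L by rewrite invr_gt0.
have NL : (2 ^ n)%:R * L = 1 by rewrite natrX mulfV// gt_eqF.
have p1 : 1 <= p by rewrite ler1n leq_maxr.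
pose F t := Phi (kappa^-1 * `|a t|).
have F0 t : 0 <= F t by exact: Phi_exp_ge0.
pose J (m : nat) := `]m%:R * L, m%:R * L + L].
have J01 m : (m < 2 ^ n)%N -> [set` J m] `<=` [set` `]0, 1]].
  move=> mn t; rewrite /J/= !in_itv/= => /andP[mt tm].
  rewrite (le_lt_trans _ mt) ?mulr_ge0 ?(ltW L0)//=.
  rewrite (le_trans tm)// -[leRHS]NL.
  have -> : m%:R * L + L = m.+1%:R * L by rewrite -natr1 mulrDl mul1r.
  by rewrite ler_wpM2r ?(ltW L0)// ler_nat.
have IF := orlicz_Rintegrable_Phi.
have Ia2 := orlicz_Rintegrable_sqr.
have aJ m : (m < 2 ^ n)%N -> \int[mu]_(t in [set` J m]) (a t ^+ 2) <=
    64 * kappa ^+ 2 * L * (p ^+ 2 + \int[mu]_(t in [set` J m]) F t).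
  move=> mn; have sub := J01 m mn.
  have IFm := RintegrableS_itv sub IF.
  have Iam := RintegrableS_itv sub Ia2.
  have Ic : Rintegrable mu [set` J m] (fun=> 2 ^+ n * p ^+ 2).
    by apply: continuous_Rintegrable; exact: cst_continuous.
  have IcF : Rintegrable mu [set` J m] (fun t => 2 ^+ n * p ^+ 2 + F t).
    exact: (@RintegrableD _ _ R mu [set` J m] (measurable_itv _) _ _ Ic IFm).
  apply: (@le_trans _ _ (\int[mu]_(t in [set` J m])
      (64 * kappa ^+ 2 * L * (2 ^+ n * p ^+ 2 + F t)))).
    apply: le_Rintegral => //; first exact: RintegrableZ.
    by move=> t _; rewrite mulrAC /L ler_pdivlMr// mulrC; exact: aV.
  rewrite RintegralZl_itv// ler_wpM2l//.
    by rewrite mulr_ge0 ?(ltW L0)// mulr_ge0// sqr_ge0.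
  rewrite RintegralD// lerD2r Rintegral_cst//.
  rewrite [X in fine X](@lebesgue_itvoc R _ _ _) ?lerDl ?(ltW L0)//=.
  rewrite le_eqVlt; apply/orP; left; apply/eqP; rewrite /L; field.
  exact: lt0r_neq0.
have Fsum : \sum_(m < 2 ^ n) \int[mu]_(t in [set` J m]) F t <= 1.
  have := @Rintegral_split R L F (2 ^ n) L0; rewrite NL => /(_ IF) <-.
  exact: orlicz_Rintegral_Phi.
have geo2 K : \sum_(m < K) (2^-1 : R) ^+ m <= 2.
  have r0 : 0 <= (2^-1 : R) ^+ K by rewrite exprn_ge0 ?invr_ge0.
  by rewrite sum_half_exprn; lra.
set c := 64 * kappa ^+ 2 * L in aJ *.
have c0 : 0 <= c by rewrite mulr_ge0 ?(ltW L0)// mulr_ge0// sqr_ge0.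
have IJ0 m : 0 <= \int[mu]_(t in [set` J m]) F t by exact: Rintegral_ge0.
apply: (@le_trans _ _ (\sum_(m < 2 ^ n) (c * p ^+ 2 * 2^-1 ^+ m +
    c * \int[mu]_(t in [set` J m]) F t))).
  apply: ler_sum => m _.
  have r0 : 0 <= (2^-1 : R) ^+ m by rewrite exprn_ge0 ?invr_ge0.
  have r1 : (2^-1 : R) ^+ m <= 1 by apply: exprn_ile1; rewrite ?invr_ge0//; lra.
  apply: (@le_trans _ _ (2^-1 ^+ m * (c * (p ^+ 2 + \int[mu]_(t in [set` J m]) F t)))).
    by rewrite ler_wpM2l// aJ.
  have := ler_wpM2r (mulr_ge0 c0 (IJ0 m)) r1.
  by set I := \int[mu]_(t in _) _; lra.
rewrite big_split/= -!mulr_sumr.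
have -> : 192 * kappa ^+ 2 * p ^+ 2 * L = c * p ^+ 2 * 2 + c * p ^+ 2 * 1 by rewrite /c; ring.
apply: lerD.
  by apply: ler_wpM2l; [rewrite mulr_ge0// sqr_ge0|exact: geo2].
apply: (@le_trans _ _ (c * 1)); first by rewrite ler_wpM2l.
rewrite -mulrA ler_wpM2l// mulr1.
by rewrite -[leLHS](expr1n _ 2); apply: lerXn2r; rewrite ?nnegrE ?(le_trans _ p1).
Qed.

(** The majorants over the cells of the n-th strip sum to a multiple of
    (n / 2 ^ n) ^ 2. *)
Lemma laplace_strip_orlicz n : let N : R := 2 ^+ n in
  exists M : nat -> R, [/\ forall k, 0 <= M k,
    forall K, \sum_(k < K) M k <=
       544 * 192 * pi * kappa ^+ 2 * ((maxn n 1)%:R / N) ^+ 2 &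
    forall k x h, (0 < n)%N ==> (N <= x) -> 0 <= x <= 2 * N -> 0 <= h <= 2 * N ->
      (\int[mu]_(t in `]0, 1]) (dcos x (k%:R * (2 * N) + h) t * a t)) ^+ 2 <= M k /\
      (\int[mu]_(t in `]0, 1]) (dsin x (k%:R * (2 * N) + h) t * a t)) ^+ 2 <= M k].
Proof.
move=> N; have [M [M0 MS MP]] := laplace_strip n ma orlicz_Rintegrable_sqr.
exists M; split => // K; apply: (le_trans (MS K)).
apply: (le_trans (ler_wpM2l _ (orlicz_dyadic n))).
  apply: mulr_ge0; last by rewrite invr_ge0 exprn_ge0.
  by apply: mulr_ge0; [exact: ler0n|exact: pi_ge0].
rewrite le_eqVlt; apply/orP; left; apply/eqP; rewrite -/N; field.
by rewrite /N expf_neq0.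
Qed.

End real_function.
End OrliczStrip.

(** * The Borel sets of the complex plane *)

Section BorelComplex.
Context {R : realType}.
Implicit Types z w : R[i].

Lemma normc_Re z : `|complex.Re z| <= modulus z.
Proof.
case: z => a b /=; rewrite -sqrtr_sqr ler_sqrt ?addr_ge0 ?sqr_ge0//.
by rewrite lerDl sqr_ge0.
Qed.

Lemma normc_Im z : `|complex.Im z| <= modulus z.
Proof.
case: z => a b /=; rewrite -sqrtr_sqr ler_sqrt ?addr_ge0 ?sqr_ge0//.
by rewrite lerDr sqr_ge0.
Qed.

Lemma normc_le z : modulus z <= `|complex.Re z| + `|complex.Im z|.
Proof.
case: z => a b /=; have := normr_ge0 a; have := normr_ge0 b => b0 a0.
rewrite -[leRHS]ger0_norm ?addr_ge0// -sqrtr_sqr ler_sqrt ?sqr_ge0//.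
rewrite -(real_normK (num_real a)) -(real_normK (num_real b)).
by nra.
Qed.

Lemma sqr_normc z : modulus z ^+ 2 = complex.Re z ^+ 2 + complex.Im z ^+ 2.
Proof. by case: z => a b /=; rewrite sqr_sqrtr// addr_ge0 ?sqr_ge0. Qed.

Lemma modulus_ge0 z : 0 <= modulus z.
Proof. by case: z => a b; exact: sqrtr_ge0. Qed.

(** Open sets of the complex plane in terms of the real-valued modulus. *)
Lemma open_CplaneP (U : set (Cplane R)) : open U <->
  (forall z, U z -> exists2 r : R, 0 < r & forall w, modulus (z - w) < r -> U w).
Proof.
split=> [oU z Uz|H].
  have : nbhs (z : Cplane R) U by move: oU; rewrite openE; exact.
  move=> /nbhs_ballP[e /= e0 eU].
  have eE : e = (complex.Re e)%:C%C.
    by rewrite RRe_real//; exact: gtr0_real.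
  exists (complex.Re e); first by rewrite eE ltcR in e0.
  move=> w wz; apply: eU; rewrite -ball_normE /ball_/= eE ltcR.
  exact: wz.
rewrite openE => z Uz; have [r r0 rU] := H z Uz.
apply/nbhs_ballP; exists (r%:C%C) => /=; first by rewrite ltcR.
move=> w; rewrite -ball_normE /ball_/= ltcR; exact: rU.
Qed.

Lemma open_measurable_borel (T : ptopologicalType) (U : set T) :
  open U -> measurable (U : set (borel T)).
Proof. by move=> oU; exact: sub_sigma_algebra. Qed.

Lemma measurable_borel_Re :
  measurable_fun setT (fun z : borel (Cplane R) => complex.Re (z : R[i])).
Proof.
apply: (measurability _ (RGenOpens.measurableE R)).
move=> _ [_ [a [b ->] <-]]; rewrite setTI; apply: open_measurable_borel.
apply/open_CplaneP => z /=; rewrite in_itv/= => /andP[az zb].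
exists (Num.min (complex.Re z - a) (b - complex.Re z)).
  by rewrite lt_min !subr_gt0 az zb.
move=> w; rewrite lt_min => /andP[h1 h2].
have := le_lt_trans (normc_Re _) h1; have := le_lt_trans (normc_Re _) h2.
case: z az zb h1 h2 => [z1 z2] az zb h1 h2; case: w h1 h2 => [w1 w2] h1 h2 /=.
by rewrite in_itv/= !ltr_norml => /andP[? ?] /andP[? ?]; apply/andP; split; lra.
Qed.

Lemma measurable_borel_Im :
  measurable_fun setT (fun z : borel (Cplane R) => complex.Im (z : R[i])).
Proof.
apply: (measurability _ (RGenOpens.measurableE R)).
move=> _ [_ [a [b ->] <-]]; rewrite setTI; apply: open_measurable_borel.
apply/open_CplaneP => z /=; rewrite in_itv/= => /andP[az zb].
exists (Num.min (complex.Im z - a) (b - complex.Im z)).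
  by rewrite lt_min !subr_gt0 az zb.
move=> w; rewrite lt_min => /andP[h1 h2].
have := le_lt_trans (normc_Im _) h1; have := le_lt_trans (normc_Im _) h2.
case: z az zb h1 h2 => [z1 z2] az zb h1 h2; case: w h1 h2 => [w1 w2] h1 h2 /=.
by rewrite in_itv/= !ltr_norml => /andP[? ?] /andP[? ?]; apply/andP; split; lra.
Qed.

(** The open square of half-side r centred at p + i q. *)
Definition rectangle (p q r : R) : set (Cplane R) :=
  [set z | `|complex.Re (z : R[i]) - p| < r /\ `|complex.Im (z : R[i]) - q| < r].

Lemma open_rectangles (U : set (Cplane R)) : open U ->
  U = \bigcup_p \bigcup_q \bigcup_r
    (if `[< rectangle (ratr p) (ratr q) (ratr r) `<=` U >]
     then rectangle (ratr p) (ratr q) (ratr r) else set0).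
Proof.
move=> /open_CplaneP oU; apply/seteqP; split=> [z Uz|z]; last first.
  move=> [p _ [q _ [r _]]]; case: ifPn => // /asboolP; exact.
have [e e0 eU] := oU z Uz.
have [r /[!in_itv]/= /andP[r0 re]] : exists r : rat, ratr r \in `]0, e / 4[.
  by apply: rat_in_itvoo; lra.
have [p /[!in_itv]/= /andP[p1 p2]] : exists p : rat, ratr p \in `]complex.Re z - ratr r, complex.Re z + ratr r[.
  by apply: rat_in_itvoo; lra.
have [q /[!in_itv]/= /andP[q1 q2]] : exists q : rat, ratr q \in `]complex.Im z - ratr r, complex.Im z + ratr r[.
  by apply: rat_in_itvoo; lra.
exists p => //; exists q => //; exists r => //; case: asboolP => [_|].
  by split; rewrite ltr_norml; apply/andP; split; lra.
case=> w [] /=; rewrite !ltr_norml => /andP[h1 h2] /andP[h3 h4]; apply: eU.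
apply: (le_lt_trans (normc_le _)).
case: z w {Uz} p1 p2 q1 q2 h1 h2 h3 h4 => [z1 z2] [w1 w2] /= *.
have : `|z1 - w1| < e / 2 by rewrite ltr_norml; apply/andP; split; lra.
have : `|z2 - w2| < e / 2 by rewrite ltr_norml; apply/andP; split; lra.
by lra.
Qed.

(** A complex function is Borel measurable as soon as its real and imaginary
    parts are: an open set is a countable union of rational squares. *)
Lemma measurable_borel_complex d (T : measurableType d) (D : set T) (f : T -> R[i]) :
  measurable_fun D (fun t => complex.Re (f t)) ->
  measurable_fun D (fun t => complex.Im (f t)) ->
  measurable_fun D (f : T -> borel (Cplane R)).
Proof.
move=> mRe mIm; have [mD|nD] := pselect (measurable D); last by move=> /nD.
apply: (@measurability _ _ T (borel (Cplane R)) D f (@open (Cplane R))) => //.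
move=> _ [U oU <-]; rewrite (open_rectangles oU).
rewrite preimage_bigcup setI_bigcupr; apply: bigcupT_measurable_rat => p.
rewrite preimage_bigcup setI_bigcupr; apply: bigcupT_measurable_rat => q.
rewrite preimage_bigcup setI_bigcupr; apply: bigcupT_measurable_rat => r.
case: ifPn => _; last by rewrite preimage_set0 setI0.
rewrite (_ : D `&` _ =
  (D `&` (fun t => complex.Re (f t)) @^-1` [set x | `|x - ratr p| < ratr r]) `&`
  (D `&` (fun t => complex.Im (f t)) @^-1` [set x | `|x - ratr q| < ratr r])); last first.
  by apply/seteqP; split=> t /= => [[Dt [? ?]]|[[Dt ?] [_ ?]]].
have mball (x y : R) : measurable [set t : R | `|t - x| < y].
  rewrite (_ : [set t | _] = [set` `]x - y, x + y[]); first exact: measurable_itv.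
  by apply/seteqP; split=> t /=; rewrite in_itv/= ltr_norml => /andP[? ?];
    apply/andP; split; lra.
by apply: measurableI; [exact: mRe|exact: mIm].
Qed.

Lemma measurable_Rintegral_param d (T : measurableType d) (D : set R) (g : T * R -> R) :
  measurable D -> measurable_fun setT g ->
  measurable_fun setT (fun x => \int[@lebesgue_measure R]_(t in D) g (x, t)).
Proof.
move=> mD mg; apply: measurableT_comp => //=.
pose h (p : T * R) := g p * \1_D p.2.
have mh : measurable_fun setT h.
  apply: measurable_funM => //.
  by apply: measurableT_comp => //; exact: measurable_indic.
have mF (k : T * R -> \bar R) : measurable_fun setT k -> (forall p, (0 <= k p)%E) ->
    measurable_fun setT (fun x => \int[@lebesgue_measure R]_t k (x, t))%E.
  move=> mk k0.
  exact: (@measurable_fun_fubini_tonelli_F _ _ _ _ _ (@lebesgue_measure R) k mk k0).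
rewrite (_ : (fun x => _) = (fun x => \int[@lebesgue_measure R]_t ((EFin \o h)^\+ (x, t)) -
    \int[@lebesgue_measure R]_t ((EFin \o h)^\- (x, t)))%E); last first.
  apply/funext => x; rewrite integral_mkcond integralE.
  have E : (fun t => (g (x, t))%:E) \_ D = (fun t => (EFin \o h) (x, t)).
    by apply/funext => t; rewrite patchE /h /= indicE; case: ifPn => _; rewrite ?mulr1 ?mulr0.
  by rewrite E (_ : (fun t => _) = (EFin \o h) \o pair x)// funepos_comp funeneg_comp.
apply: emeasurable_funB; apply: mF => //.
- by apply: measurable_funepos; exact/measurable_EFinP.
- by apply: measurable_funeneg; exact/measurable_EFinP.
Qed.

End BorelComplex.

(** * The Laplace transform in real coordinates *)

Section LaplaceReal.
Context {R : realType}.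
Notation mu := (@lebesgue_measure R).
Notation Phi := (Phi_exp R).
Implicit Types (a b : R -> R) (f : R -> R[i]) (z : Cplus R).

(** Real part of the Laplace transform of a + i b at x + i y. *)
Definition lapRe a b (x y : R) : R :=
  \int[mu]_(t in `]0, 1]) (dcos x y t * a t + dsin x y t * b t).

(** Imaginary part of the Laplace transform of a + i b at x + i y. *)
Definition lapIm a b (x y : R) : R :=
  \int[mu]_(t in `]0, 1]) (dcos x y t * b t - dsin x y t * a t).

(** Real part of f, extended by zero outside ]0, 1[. *)
Definition re0 f (t : R) : R := complex.Re (ext0 f t).
(** Imaginary part of f, extended by zero outside ]0, 1[. *)
Definition im0 f (t : R) : R := complex.Im (ext0 f t).

Lemma Rintegral_unit (F : R -> R) : (forall t, t \notin unit_itv R -> F t = 0) ->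
  \int[mu]_(t in `]0, +oo[) F t = \int[mu]_(t in `]0, 1]) F t.
Proof.
move=> F0; rewrite [LHS]Rintegral_mkcond [RHS]Rintegral_mkcond.
apply: eq_Rintegral => t _; rewrite !patchE (_ : point = 0)//.
have [t01|t01] := boolP (t \in unit_itv R); last first.
  by rewrite F0//; case: ifP; case: ifP.
have := set_mem t01; rewrite /unit_itv/= in_itv/= => /andP[t0 t1].
rewrite !mem_set//= in_itv/= ?t0 ?(ltW t1)//.
Qed.

Lemma laplace_ext0E f z : laplace (ext0 f) z =
  Complex (lapRe (re0 f) (im0 f) (complex.Re (Cval z)) (complex.Im (Cval z)))
          (lapIm (re0 f) (im0 f) (complex.Re (Cval z)) (complex.Im (Cval z))).
Proof.
rewrite /laplace /Cintegral; set w := Cval z.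
have E t : cexp (- w * t%:C%C) * ext0 f t =
    Complex (dcos (complex.Re w) (complex.Im w) t * re0 f t + dsin (complex.Re w) (complex.Im w) t * im0 f t)
      (dcos (complex.Re w) (complex.Im w) t * im0 f t - dsin (complex.Re w) (complex.Im w) t * re0 f t).
  rewrite /re0 /im0; case: (ext0 f t) => a b; case: w => x y.
  rewrite /cexp /dcos /dsin /=.
  have -> : - x * t - - y * 0 = - x * t by ring.
  have -> : - x * 0 + - y * t = - (y * t) by ring.
  rewrite cosN sinN; set e := expR _.
  by apply/eqP; rewrite eq_complex/=; apply/andP; split; apply/eqP; ring.
have ext00 t : t \notin unit_itv R -> re0 f t = 0 /\ im0 f t = 0.
  by move=> /negbTE t01; rewrite /re0 /im0 /ext0 t01.
under eq_Rintegral do rewrite E /=.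
under [X in Complex _ X]eq_Rintegral do rewrite E /=.
by rewrite !Rintegral_unit// => t /ext00[-> ->]; rewrite !mulr0 ?addr0 ?subr0.
Qed.

Lemma sqr_modulus_laplace f z : modulus (laplace (ext0 f) z) ^+ 2 =
  lapRe (re0 f) (im0 f) (complex.Re (Cval z)) (complex.Im (Cval z)) ^+ 2 +
  lapIm (re0 f) (im0 f) (complex.Re (Cval z)) (complex.Im (Cval z)) ^+ 2.
Proof. by rewrite sqr_normc laplace_ext0E. Qed.

Lemma Cplus_Re_gt0 z : 0 < complex.Re (Cval z).
Proof. by rewrite /Cval; case: z => z /= /set_mem. Qed.

Section measurable_f.
Variable f : R -> R[i].
Hypothesis mf : measurable_fun (unit_itv R) (f : R -> borel (Cplane R)).

Let mU : measurable (unit_itv R). Proof. exact: measurable_itv. Qed.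

Lemma measurable_re0 : measurable_fun setT (re0 f).
Proof.
rewrite (_ : re0 f = (fun t => complex.Re (f t)) \_ (unit_itv R)); last first.
  by apply/funext => t; rewrite /re0 /ext0 patchE; case: ifP.
apply: (measurable_restrictT _ mU).1.
exact: (measurableT_comp measurable_borel_Re mf).
Qed.

Lemma measurable_im0 : measurable_fun setT (im0 f).
Proof.
rewrite (_ : im0 f = (fun t => complex.Im (f t)) \_ (unit_itv R)); last first.
  by apply/funext => t; rewrite /im0 /ext0 patchE; case: ifP.
apply: (measurable_restrictT _ mU).1.
exact: (measurableT_comp measurable_borel_Im mf).
Qed.

Lemma measurable_modulus : measurable_fun (unit_itv R) (fun t => modulus (f t)).
Proof.
rewrite (_ : (fun t => _) = (fun t => Num.sqrt (complex.Re (f t) ^+ 2 + complex.Im (f t) ^+ 2))).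
  apply: (@measurableT_comp _ _ _ _ _ _ (@Num.sqrt R)); first by apply: continuous_measurable_fun; exact: sqrt_continuous.
  apply: measurable_funD; apply: measurable_funX.
    exact: (measurableT_comp measurable_borel_Re mf).
  exact: (measurableT_comp measurable_borel_Im mf).
by apply/funext => t; case: (f t).
Qed.

Variable kappa : R.
Hypothesis k0 : 0 < kappa.

Lemma orlicz_component (a : R -> R) : measurable_fun setT a ->
  (forall t, t \in unit_itv R -> `|a t| <= modulus (f t)) ->
  (\int[mu]_(t in unit_itv R) (Phi (kappa^-1 * modulus (f t)))%:E <= 1)%E ->
  (\int[mu]_(t in `]0%R, 1%R]) (Phi (kappa^-1 * `|a t|))%:E <= 1)%E.
Proof.
move=> ma af; apply: le_trans.
have mphi g : measurable_fun (unit_itv R) g ->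
    measurable_fun (unit_itv R) (fun t => (Phi (kappa^-1 * g t))%:E).
  move=> mg; apply/measurable_EFinP; apply: (measurableT_comp measurable_Phi_exp).
  exact: measurable_funM.
have ma' : measurable_fun (unit_itv R) (fun t => `|a t|).
  by apply: measurableT_comp => //; exact: measurable_funTS.
rewrite -(@integral_itv_bndo_bndc R (BRight 0) 1); last first.
  by apply/measurable_EFinP/measurable_EFinP; exact: mphi.
apply: ge0_le_integral => //.
- by move=> t _; rewrite lee_fin Phi_exp_ge0.
- exact: mphi.
- by apply: mphi; exact: measurable_modulus.
- move=> t t01; rewrite lee_fin; apply: Phi_exp_homo.
    by rewrite mulr_ge0// invr_ge0 ltW.
  by rewrite ler_wpM2l ?invr_ge0 ?(ltW k0)//; apply: af; exact: mem_set.
Qed.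

Lemma re0_le t : t \in unit_itv R -> `|re0 f t| <= modulus (f t).
Proof. by move=> t01; rewrite /re0 /ext0 t01 normc_Re. Qed.

Lemma im0_le t : t \in unit_itv R -> `|im0 f t| <= modulus (f t).
Proof. by move=> t01; rewrite /im0 /ext0 t01 normc_Im. Qed.

End measurable_f.

Lemma dcosN x y (t : R) : dcos x (- y) t = dcos x y t.
Proof. by rewrite /dcos (mulNr y) cosN. Qed.

Lemma dsinN x y (t : R) : dsin x (- y) t = - dsin x y t.
Proof. by rewrite /dsin (mulNr y) sinN mulrN. Qed.

Lemma Rintegrable_dcos a x y : 0 <= x -> Rintegrable mu `]0, 1] a ->
  Rintegrable mu `]0, 1] (fun t => dcos x y t * a t).
Proof.
move=> x0 Ia; apply: (@RintegrableM_bounded _ _ R mu [set` `]0, 1]] (measurable_itv _) a _ 1) => //.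
  by apply: measurable_funTS; apply: continuous_measurable_fun; exact: continuous_dcos.
move=> t /=; rewrite in_itv/= => /andP[t0 _].
by apply: (le_trans (dcos_le _ x0 (ltW t0))); rewrite mulr0 expR0.
Qed.

Lemma Rintegrable_dsin a x y : 0 <= x -> Rintegrable mu `]0, 1] a ->
  Rintegrable mu `]0, 1] (fun t => dsin x y t * a t).
Proof.
move=> x0 Ia; apply: (@RintegrableM_bounded _ _ R mu [set` `]0, 1]] (measurable_itv _) a _ 1) => //.
  by apply: measurable_funTS; apply: continuous_measurable_fun; exact: continuous_dsin.
move=> t /=; rewrite in_itv/= => /andP[t0 _].
by apply: (le_trans (dsin_le _ x0 (ltW t0))); rewrite mulr0 expR0.
Qed.

Lemma lapReE a b x y : 0 <= x -> Rintegrable mu `]0, 1] a -> Rintegrable mu `]0, 1] b ->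
  lapRe a b x y = \int[mu]_(t in `]0, 1]) (dcos x y t * a t) +
                  \int[mu]_(t in `]0, 1]) (dsin x y t * b t).
Proof.
by move=> x0 Ia Ib; rewrite /lapRe RintegralD//;
  [exact: Rintegrable_dcos|exact: Rintegrable_dsin].
Qed.

Lemma lapImE a b x y : 0 <= x -> Rintegrable mu `]0, 1] a -> Rintegrable mu `]0, 1] b ->
  lapIm a b x y = \int[mu]_(t in `]0, 1]) (dcos x y t * b t) -
                  \int[mu]_(t in `]0, 1]) (dsin x y t * a t).
Proof.
by move=> x0 Ia Ib; rewrite /lapIm RintegralB//;
  [exact: Rintegrable_dcos|exact: Rintegrable_dsin].
Qed.

Lemma sqr_dcos_norm a x y :
  (\int[mu]_(t in `]0, 1]) (dcos x y t * a t)) ^+ 2 =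
  (\int[mu]_(t in `]0, 1]) (dcos x `|y| t * a t)) ^+ 2.
Proof.
have [y0|y0] := leP 0 y; first by rewrite ger0_norm.
by rewrite (ltr0_norm y0); under [in RHS]eq_Rintegral do rewrite dcosN.
Qed.

Lemma sqr_dsin_norm a x y : 0 <= x -> Rintegrable mu `]0, 1] a ->
  (\int[mu]_(t in `]0, 1]) (dsin x y t * a t)) ^+ 2 =
  (\int[mu]_(t in `]0, 1]) (dsin x `|y| t * a t)) ^+ 2.
Proof.
move=> x0 Ia; have [y0|y0] := leP 0 y; first by rewrite ger0_norm.
rewrite (ltr0_norm y0).
under [in RHS]eq_Rintegral do rewrite dsinN mulNr -mulN1r.
rewrite RintegralZl//; last exact: Rintegrable_dsin.
by rewrite mulN1r sqrrN.
Qed.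

(** The constant of the sum of the majorants over one strip. It is a product of
    small factors because numerals are unary. *)
Definition strip_constant : R := 8 * (544 * 192 * pi).

Lemma strip_constant_gt0 : 0 < strip_constant.
Proof.
apply: mulr_gt0; first by rewrite ltr0n.
by apply: mulr_gt0; [apply: mulr_gt0; rewrite ltr0n|exact: pi_gt0].
Qed.

(** The strip 2 ^ n <= Re z <= 2 ^ (n + 1), the one with n = 0 being widened to
    0 < Re z <= 2, is cut into boxes of height 2 ^ (n + 1); the square sum over
    the boxes of the supremum of the Laplace transform is of order
    (n / 2 ^ n) ^ 2, where n is read as 1 if it is 0. *)
Lemma laplace_strip_sup f kappa n : 0 < kappa ->
  measurable_fun (unit_itv R) (f : R -> borel (Cplane R)) ->
  (\int[mu]_(t in unit_itv R) (Phi (kappa^-1 * modulus (f t)))%:E <= 1)%E ->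
  exists M : nat -> R, [/\ forall k, 0 <= M k,
    forall K, \sum_(k < K) M k <=
       strip_constant * kappa ^+ 2 * ((maxn n 1)%:R / 2 ^+ n) ^+ 2 &
    forall k z, (0 < n)%N ==> (2 ^+ n <= complex.Re (Cval z)) ->
      complex.Re (Cval z) <= 2 * 2 ^+ n ->
      k%:R * (2 * 2 ^+ n) <= `|complex.Im (Cval z)| <= k.+1%:R * (2 * 2 ^+ n) ->
      modulus (laplace (ext0 f) z) ^+ 2 <= M k].
Proof.
move=> k0 mf fPhi.
have ma := measurable_re0 mf; have mb := measurable_im0 mf.
have aPhi := orlicz_component mf k0 ma (re0_le f) fPhi.
have bPhi := orlicz_component mf k0 mb (im0_le f) fPhi.
have ma1 : measurable_fun (`]0, 1] : set R) (re0 f) by exact: measurable_funTS.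
have mb1 : measurable_fun (`]0, 1] : set R) (im0 f) by exact: measurable_funTS.
have Ia := orlicz_Rintegrable k0 ma1 aPhi.
have Ib := orlicz_Rintegrable k0 mb1 bPhi.
have [Ma [Ma0 MaS MaP]] := laplace_strip_orlicz k0 ma1 aPhi n.
have [Mb [Mb0 MbS MbP]] := laplace_strip_orlicz k0 mb1 bPhi n.
exists (fun k => 4 * (Ma k + Mb k)); split.
- by move=> k; apply: mulr_ge0 => //; exact: addr_ge0.
- move=> K; rewrite -mulr_sumr big_split/=.
  have := lerD (MaS K) (MbS K); rewrite /strip_constant.
  set X := 544 * 192 * pi; set Y := _ ^+ 2; set Z := (_ / _) ^+ 2.
  by move=> H; apply: (le_trans (ler_wpM2l _ H)) => //; rewrite le_eqVlt;
    apply/orP; left; apply/eqP; ring.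
move=> k z Nx xN /andP[ky yk].
rewrite sqr_modulus_laplace.
set x := complex.Re (Cval z) in Nx xN *; set y := complex.Im (Cval z) in ky yk *.
have x0 : 0 <= x by apply: ltW; exact: Cplus_Re_gt0.
have x2 : 0 <= x <= 2 * 2 ^+ n by rewrite x0.
pose h := `|y| - k%:R * (2 * 2 ^+ n).
have h2 : 0 <= h <= 2 * 2 ^+ n.
  by rewrite /h subr_ge0 ky/= lerBlDl; move: yk; rewrite -natr1 mulrDl mul1r.
have yE : `|y| = k%:R * (2 * 2 ^+ n) + h by rewrite /h; ring.
have [] := MaP k x h Nx x2 h2; have [] := MbP k x h Nx x2 h2.
rewrite -yE -!sqr_dcos_norm -(sqr_dsin_norm y x0 Ia) -(sqr_dsin_norm y x0 Ib).
rewrite (lapReE y x0 Ia Ib) (lapImE y x0 Ia Ib).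
set A := \int[mu]_(t in _) _; set B := \int[mu]_(t in _) _.
set C := \int[mu]_(t in _) _; set D := \int[mu]_(t in _) _ => h_1 h_2 h_3 h_4.
have := sqr_ge0 (C - B); have := sqr_ge0 (A + D).
by move: h_1 h_2 h_3 h_4; clear; nra.
Qed.

End LaplaceReal.

(** * The upper bound for the square integral *)

Section UpperBound.
Context {R : realType}.
Notation Phi := (Phi_exp R).
Implicit Types (z : Cplus R).
Local Open Scope ereal_scope.

Lemma nneseries_le (u : (\bar R)^nat) (B : \bar R) : (forall n, 0 <= u n) ->
  (forall K, \sum_(k < K) u k <= B) -> \sum_(k <oo) u k <= B.
Proof.
move=> u0 uB; apply: lime_le; first exact: is_cvg_nneseries.
by apply: nearW => K; rewrite big_mkord.
Qed.

Lemma measurable_Cval :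
  measurable_fun setT (@Cval R : borel (Cplus R) -> borel (Cplane R)).
Proof.
apply: (@measurability _ _ (borel (Cplus R)) (borel (Cplane R)) setT (@Cval R)
  (@open (Cplane R))) => //.
move=> _ [U oU <-]; rewrite setTI; apply: open_measurable_borel.
have := @initial_continuous (Cplus R) (Cplane R) (@Cval R).
by move/continuousP => /(_ U oU).
Qed.

Lemma measurable_Cplus_Re :
  measurable_fun setT (fun z : borel (Cplus R) => complex.Re (Cval z)).
Proof. exact: (measurableT_comp measurable_borel_Re measurable_Cval). Qed.

Lemma measurable_Cplus_Im :
  measurable_fun setT (fun z : borel (Cplus R) => complex.Im (Cval z)).
Proof. exact: (measurableT_comp measurable_borel_Im measurable_Cval). Qed.

Lemma measurable_Cplus_rect (i j : interval R) :
  measurable ([set z | complex.Re (Cval z) \in i /\ complex.Im (Cval z) \in j]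
    : set (borel (Cplus R))).
Proof.
have := measurable_Cplus_Re measurableT (measurable_itv i).
have := measurable_Cplus_Im measurableT (measurable_itv j).
rewrite !setTI => mj mi.
exact: measurableI mi mj.
Qed.

Lemma measurable_lap (a b : R -> R) : measurable_fun setT a -> measurable_fun setT b ->
  measurable_fun setT (fun z : borel (Cplus R) =>
     lapRe a b (complex.Re (Cval z)) (complex.Im (Cval z))) /\
  measurable_fun setT (fun z : borel (Cplus R) =>
     lapIm a b (complex.Re (Cval z)) (complex.Im (Cval z))).
Proof.
move=> ma mb.
have m2 (g : R -> R) : measurable_fun setT g ->
    measurable_fun setT (fun p : borel (Cplus R) * R => g p.2).
  by move=> mg; exact: measurableT_comp mg measurable_snd.
have mRe : measurable_fun setT (fun p : borel (Cplus R) * R => complex.Re (Cval p.1)).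
  exact: measurableT_comp measurable_Cplus_Re measurable_fst.
have mIm : measurable_fun setT (fun p : borel (Cplus R) * R => complex.Im (Cval p.1)).
  exact: measurableT_comp measurable_Cplus_Im measurable_fst.
have mid : measurable_fun setT (fun p : borel (Cplus R) * R => p.2) by exact: measurable_snd.
have me : measurable_fun setT (fun p : borel (Cplus R) * R =>
    expR (- complex.Re (Cval p.1) * p.2)%R).
  apply: measurableT_comp => //; apply: measurable_funM => //.
  exact: measurableT_comp.
have mc : measurable_fun setT (fun p : borel (Cplus R) * R =>
    dcos (complex.Re (Cval p.1)) (complex.Im (Cval p.1)) p.2).
  apply: measurable_funM => //; apply: (@measurableT_comp _ _ _ _ _ _ (@cos R)).
    by apply: continuous_measurable_fun; exact: continuous_cos.
  exact: measurable_funM.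
have ms : measurable_fun setT (fun p : borel (Cplus R) * R =>
    dsin (complex.Re (Cval p.1)) (complex.Im (Cval p.1)) p.2).
  apply: measurable_funM => //; apply: (@measurableT_comp _ _ _ _ _ _ (@sin R)).
    by apply: continuous_measurable_fun; exact: continuous_sin.
  exact: measurable_funM.
have ma2 := m2 _ ma; have mb2 := m2 _ mb.
split.
- apply: (@measurable_Rintegral_param R _ (borel (Cplus R)) `]0%R, 1%R]
   (fun p => dcos (complex.Re (Cval p.1)) (complex.Im (Cval p.1)) p.2 * a p.2 +
       dsin (complex.Re (Cval p.1)) (complex.Im (Cval p.1)) p.2 * b p.2)%R).
    exact: measurable_itv.
  by apply: measurable_funD; exact: measurable_funM.
- apply: (@measurable_Rintegral_param R _ (borel (Cplus R)) `]0%R, 1%R]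
   (fun p => dcos (complex.Re (Cval p.1)) (complex.Im (Cval p.1)) p.2 * b p.2 -
       dsin (complex.Re (Cval p.1)) (complex.Im (Cval p.1)) p.2 * a p.2)%R).
    exact: measurable_itv.
  by apply: measurable_funB; exact: measurable_funM.
Qed.

Lemma measurable_laplace (f : R -> R[i]) :
  measurable_fun (unit_itv R) (f : R -> borel (Cplane R)) ->
  measurable_fun setT (laplace (ext0 f) : borel (Cplus R) -> borel (Cplane R)).
Proof.
move=> mf.
have [mRe mIm] := measurable_lap (measurable_re0 mf) (measurable_im0 mf).
apply: measurable_borel_complex.
- by under eq_fun do rewrite laplace_ext0E.
- by under eq_fun do rewrite laplace_ext0E.
Qed.

Lemma measurable_sqr_laplace (f : R -> R[i]) :
  measurable_fun (unit_itv R) (f : R -> borel (Cplane R)) ->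
  measurable_fun setT (fun z : borel (Cplus R) => (modulus (laplace (ext0 f) z) ^+ 2)%:E).
Proof.
move=> mf; apply/measurable_EFinP.
have [mRe mIm] := measurable_lap (measurable_re0 mf) (measurable_im0 mf).
under eq_fun do rewrite sqr_modulus_laplace.
by apply: measurable_funD; exact: measurable_funX.
Qed.


Lemma measurable_carleson_square (I : interval R) :
  measurable (carleson_square I : set (borel (Cplus R))).
Proof.
have := measurable_Cplus_Im measurableT (measurable_itv I); rewrite setTI => mI.
rewrite (_ : carleson_square I = (fun z => complex.Im (Cval z)) @^-1` [set` I] `&`
   (setT `&` [set z | (complex.Re (Cval z))%:E <= itv_length I])); last first.
  apply/seteqP; split=> z /=; first by move=> [? [? ?]].
  by move=> [? [_ ?]]; split=> //; split=> //; exact: Cplus_Re_gt0.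
apply: (measurableI _ _ mI); apply: measurable_lee => //.
by apply/measurable_EFinP; exact: measurable_Cplus_Re.
Qed.

(** The range of Re z in the n-th strip; the lowest one is the whole of ]0, 2[. *)
Definition dyadic_itv (n : nat) : interval R :=
  Interval (if n is 0 then BRight 0%R else BLeft (2 ^+ n)%R) (BLeft (2 * 2 ^+ n)%R).

(** The half-plane is the disjoint union of these strips. *)
Definition dyadic_strip (n : nat) : set (Cplus R) :=
  [set z | complex.Re (Cval z) \in dyadic_itv n].

(** The k-th box of the n-th strip together with its complex conjugate. *)
Definition dyadic_box (n k : nat) : set (Cplus R) :=
  dyadic_strip n `&`
  [set z | (k%:R * (2 * 2 ^+ n) <= `|complex.Im (Cval z)| < k.+1%:R * (2 * 2 ^+ n))%R].

Lemma dyadic_stripP n z : dyadic_strip n z <->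
  (((0 < n)%N ==> (2 ^+ n <= complex.Re (Cval z))) /\
   complex.Re (Cval z) < 2 * 2 ^+ n)%R.
Proof.
rewrite /dyadic_strip /dyadic_itv /=; case: n => [|n]; rewrite in_itv/=.
  by rewrite Cplus_Re_gt0/=; split=> [->//|[]].
by split=> [/andP[-> ->]|[-> ->]].
Qed.

Lemma dyadic_strip_cover : \bigcup_n dyadic_strip n = setT.
Proof.
apply/seteqP; split=> // z _; set x := complex.Re (Cval z).
have ex : exists n, (x < 2 * 2 ^+ n)%R.
  exists (Num.truncn x); apply: (lt_le_trans (truncnS_gt x)).
  apply: (@le_trans _ _ (2 ^+ (Num.truncn x))%R).
    by rewrite -natrX ler_nat ltn_expl.
  by rewrite ler_peMl// ?exprn_ge0// ler1n.
case: (ex_minnP ex) => n xn nmin; exists n => //; apply/dyadic_stripP; split => //.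
case: n xn nmin => [//|n] xn nmin /=; rewrite -/x leNgt; apply/negP => xlt.
by have := nmin n; rewrite -exprS => /(_ xlt); rewrite ltnn.
Qed.

Lemma dyadic_strip_trivIset : trivIset setT dyadic_strip.
Proof.
have H i j z : (i < j)%N -> dyadic_strip i z -> dyadic_strip j z -> False.
  move=> ij /dyadic_stripP[_ h1] /dyadic_stripP[h2 _].
  have j0 : (0 < j)%N by exact: leq_ltn_trans ij.
  move: h2; rewrite j0/= => h2; have := le_lt_trans h2 h1.
  by rewrite -exprS ltr_eXn2l ?ltr1n// ltnS leqNgt ij.
apply/trivIsetP => i j _ _ ij; apply/seteqP; split=> // z [zi zj].
by case: (ltngtP i j) ij => // ij _; [exact: (H _ _ z ij)|exact: (H _ _ z ij)].
Qed.

Lemma dyadic_box_cover n : \bigcup_k dyadic_box n k = dyadic_strip n.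
Proof.
apply/seteqP; split=> z; first by move=> [k _ []].
move=> zn; have N0 : (0 < 2 * 2 ^+ n :> R)%R by rewrite mulr_gt0// exprn_gt0.
exists (Num.truncn (`|complex.Im (Cval z)| / (2 * 2 ^+ n))%R) => //; split=> //=.
by rewrite -ler_pdivlMr// -ltr_pdivrMr// truncn_itv// divr_ge0// ltW.
Qed.

Lemma dyadic_box_trivIset n : trivIset setT (dyadic_box n).
Proof.
have N0 : (0 < 2 * 2 ^+ n :> R)%R by rewrite mulr_gt0// exprn_gt0.
have H i j z : (i < j)%N -> dyadic_box n i z -> dyadic_box n j z -> False.
  move=> ij [_ /= /andP[_ h1]] [_ /= /andP[h2 _]]; have := le_lt_trans h2 h1.
  by rewrite ltr_pM2r// ltr_nat ltnS leqNgt ij.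
apply/trivIsetP => i j _ _ ij; apply/seteqP; split=> // z [zi zj].
by case: (ltngtP i j) ij => // ij _; [exact: (H _ _ z ij)|exact: (H _ _ z ij)].
Qed.

Lemma measurable_dyadic_strip n : measurable (dyadic_strip n : set (borel (Cplus R))).
Proof.
have := measurable_Cplus_Re measurableT (measurable_itv (dyadic_itv n)).
by rewrite setTI.
Qed.

(** The ranges of Im z in the two halves of a box; both have length
    2 ^ (n + 1), so that each half lies in a Carleson square. *)
Definition box_itv (n k : nat) (b : bool) : interval R :=
  if b then `[(k%:R * (2 * 2 ^+ n))%R, (k.+1%:R * (2 * 2 ^+ n))%R[
  else `](- (k.+1%:R * (2 * 2 ^+ n)))%R, (- (k%:R * (2 * 2 ^+ n)))%R].

Lemma box_itv_length n k b : itv_length (box_itv n k b) = (2 * 2 ^+ n)%:E.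
Proof.
have N0 : (0 < 2 * 2 ^+ n :> R)%R by rewrite mulr_gt0// exprn_gt0.
have h : (k%:R * (2 * 2 ^+ n) < k.+1%:R * (2 * 2 ^+ n) :> R)%R by rewrite ltr_pM2r// ltr_nat.
rewrite /itv_length /box_itv; case: b; rewrite lebesgue_measure_itv/= lte_fin ?ltrN2 h -EFinD -natr1; congr EFin; ring.
Qed.

Lemma dyadic_boxE n k : dyadic_box n k =
  (dyadic_strip n `&` [set z | complex.Im (Cval z) \in box_itv n k true]) `|`
  (dyadic_strip n `&` [set z | complex.Im (Cval z) \in box_itv n k false]).
Proof.
have N0 : (0 < 2 * 2 ^+ n :> R)%R by rewrite mulr_gt0// exprn_gt0.
have k0 : (0 <= k%:R * (2 * 2 ^+ n) :> R)%R by rewrite mulr_ge0// ltW.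
rewrite -setIUr /dyadic_box; congr (_ `&` _).
apply/seteqP; split=> z /=; rewrite !in_itv/=; set y := complex.Im _.
  move=> /andP[h1 h2]; have [y0|y0] := leP 0%R y.
    by left; move: h1 h2; rewrite ger0_norm// => -> ->.
  right; move: h1 h2; rewrite ltr0_norm// => h1 h2.
  by rewrite lerNr h1 ltrNl h2.
case=> /andP[h1 h2].
  by rewrite ger0_norm ?h1 ?h2// (le_trans k0).
by rewrite ler0_norm ?(le_trans h2) ?oppr_le0// lerNr h2/= ltrNl.
Qed.

Lemma measurable_dyadic_half n k b : measurable
  (dyadic_strip n `&` [set z | complex.Im (Cval z) \in box_itv n k b] : set (borel (Cplus R))).
Proof. exact: measurable_Cplus_rect. Qed.

Lemma measurable_dyadic_box n k : measurable (dyadic_box n k : set (borel (Cplus R))).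
Proof. by rewrite dyadic_boxE; apply: measurableU; exact: measurable_dyadic_half. Qed.

Section measure.
Variable nu : {measure set (borel (Cplus R)) -> \bar R}.

(** The supremum of the masses of the n-th strip inside a Carleson square of side
    2 ^ (n + 1). *)
Definition strip_sup (n : nat) : \bar R :=
  ereal_sup [set nu (carleson_square I `&` dyadic_strip n) | I in
    [set I : interval R | itv_length I = (2 * 2 ^+ n)%:E]].

Lemma strip_sup_ge0 n : 0 <= strip_sup n.
Proof.
apply: le_ereal_sup_tmp; exists (nu (carleson_square (box_itv n 0 true) `&` dyadic_strip n)) => //.
by exists (box_itv n 0 true) => //; exact: box_itv_length.
Qed.

Lemma measure_dyadic_box n k : nu (dyadic_box n k) <= 2%:E * strip_sup n.
Proof.
have half b : nu (dyadic_strip n `&` [set z | complex.Im (Cval z) \in box_itv n k b]) <= strip_sup n.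
  apply: le_ereal_sup_tmp; exists (nu (carleson_square (box_itv n k b) `&` dyadic_strip n)).
    by exists (box_itv n k b) => //; exact: box_itv_length.
  apply: le_measure; rewrite ?inE.
  - exact: measurable_dyadic_half.
  - by apply: measurableI; [exact: measurable_carleson_square|exact: measurable_dyadic_strip].
  - move=> z [zn zI]; split => //; split => //; split; first exact: Cplus_Re_gt0.
    rewrite box_itv_length lee_fin; apply: ltW.
    by move/dyadic_stripP : zn => [].
rewrite dyadic_boxE; apply: (le_trans (measureU2 _ (measurable_dyadic_half n k true) (measurable_dyadic_half n k false))).
by rewrite mule_natl mule2n; exact: leeD (half true) (half false).
Qed.

Lemma strip_sup0 : strip_sup 0 <=
  ereal_sup [set nu (carleson_square I) | I in [set I : interval R | itv_length I = 2%:E]].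
Proof.
apply: ge_ereal_sup => _ [I /= II <-]; apply: le_ereal_sup_tmp.
exists (nu (carleson_square I)); first by exists I => //=; rewrite II expr0 mulr1.
apply: le_measure; rewrite ?inE.
- by apply: measurableI; [exact: measurable_carleson_square|exact: measurable_dyadic_strip].
- exact: measurable_carleson_square.
- exact: subIsetl.
Qed.

Lemma dyadic_stripE n : (0 < n)%N -> dyadic_strip n = strip R n%:Z.
Proof.
case: n => // n _; rewrite /strip (_ : (n.+1%:Z + 1)%R = n.+2%:Z); last first.
  by rewrite -PoszD addn1.
rewrite -!exprnP /dyadic_strip/=.
by apply/seteqP; split=> z /=; rewrite in_itv/= -exprS.
Qed.

Lemma strip_sup_carleson n : (0 < n)%N ->
  strip_sup n <= ((2 * 2 ^+ n) ^+ 2)%:E * carleson 2 (strip_measure nu n%:Z).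
Proof.
move=> n0; have N0 : (0 < 2 * 2 ^+ n :> R)%R by rewrite mulr_gt0// exprn_gt0.
apply: ge_ereal_sup => _ [I /= II <-].
have N2 : (0 < (2 * 2 ^+ n) ^+ 2 :> R)%R by rewrite exprn_gt0.
rewrite dyadic_stripE// -lee_pdivrMl//.
apply: le_ereal_sup_tmp.
exists (strip_measure nu n%:Z (carleson_square I) * ((fine (itv_length I) `^ 2)^-1)%:E).
  by exists I => //=; rewrite II lte_fin N0 ltry.
by rewrite II/= powR_mulrn ?(ltW N0)// muleC.
Qed.

Lemma carleson_strip_ge0 n : 0 <= carleson 2 (strip_measure nu n%:Z).
Proof.
apply: le_ereal_sup_tmp; eexists.
  exists `[0%R, 1%R[ => //=.
  by rewrite /itv_length lebesgue_measure_itv/= lte_fin ltr01 oppr0 adde0 lte_fin ltr01 ltry.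
by rewrite mule_ge0// lee_fin invr_ge0 powR_ge0.
Qed.

Section laplace_bound.
Variables (f : R -> R[i]) (kappa : R).
Hypotheses (k0 : (0 < kappa)%R)
  (mf : measurable_fun (unit_itv R) (f : R -> borel (Cplane R)))
  (fPhi : \int[lebesgue_measure]_(t in unit_itv R) (Phi (kappa^-1 * modulus (f t)))%:E <= 1).

Let F (z : borel (Cplus R)) := (modulus (laplace (ext0 f) z) ^+ 2)%:E.
Let F0 z : 0 <= F z. Proof. by rewrite lee_fin sqr_ge0. Qed.
Let mF (D : set (borel (Cplus R))) : measurable_fun D F.
Proof. by apply: measurable_funTS; exact: measurable_sqr_laplace. Qed.

Lemma integral_dyadic_strip n :
  \int[nu]_(z in dyadic_strip n) F z <=
  (2 * strip_constant * kappa ^+ 2 * ((maxn n 1)%:R / 2 ^+ n) ^+ 2)%:E * strip_sup n.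
Proof.
have [M [M0 MS MP]] := laplace_strip_sup n k0 mf fPhi.
rewrite -dyadic_box_cover ge0_integral_bigcup//; first last.
- exact: dyadic_box_trivIset.
- exact: measurable_dyadic_box.
have D0 : 0 <= 2%:E * strip_sup n by rewrite mule_ge0// strip_sup_ge0.
apply: nneseries_le => [k|K]; first exact: integral_ge0.
apply: (@le_trans _ _ (\sum_(k < K) (M k)%:E * (2%:E * strip_sup n))).
  apply: lee_sum => k _.
  apply: (@le_trans _ _ (\int[nu]_(z in dyadic_box n k) cst (M k)%:E z)).
    apply: ge0_le_integral => //; first exact: measurable_dyadic_box.
    move=> z [/dyadic_stripP[zn1 zn2] /= /andP[zk1 zk2]]; rewrite lee_fin.
    by apply: MP => //; [exact: ltW|rewrite zk1 ltW].
  rewrite integral_cst; last exact: measurable_dyadic_box.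
  by rewrite lee_wpmul2l ?lee_fin//; exact: measure_dyadic_box.
rewrite -ge0_sume_distrl; last by move=> k _; rewrite lee_fin.
rewrite sumEFin; apply: (@le_trans _ _ ((strip_constant * kappa ^+ 2 * ((maxn n 1)%:R / 2 ^+ n) ^+ 2)%:E * (2%:E * strip_sup n))).
  by rewrite lee_wpmul2r// lee_fin.
rewrite muleA -EFinM le_eqVlt; apply/orP; left; apply/eqP; congr (_%:E * _); ring.
Qed.

(** The upper bound, for a function whose Luxemburg norm is at most kappa. *)
Lemma integral_laplace_le :
  \int[nu]_z F z <= (8 * strip_constant * kappa ^+ 2)%:E * embedding_constant nu.
Proof.
rewrite -dyadic_strip_cover ge0_integral_bigcup//; first last.
- exact: dyadic_strip_trivIset.
- exact: measurable_dyadic_strip.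
rewrite nneseries_recl//; last by move=> k _; exact: integral_ge0.
have C0 := ltW (@strip_constant_gt0 R).
have K0 : (0 <= 8 * strip_constant * kappa ^+ 2 :> R)%R.
  by apply: mulr_ge0; [apply: mulr_ge0|exact: sqr_ge0].
have carl0 := carleson_strip_ge0.
have sup0 : 0 <= ereal_sup [set nu (carleson_square I) | I in [set I : interval R | itv_length I = 2%:E]].
  exact: le_trans (strip_sup_ge0 0) strip_sup0.
rewrite /embedding_constant ge0_muleDr//; last first.
  by apply: nneseries_ge0 => n _ _; rewrite mule_ge0.
rewrite addeC; apply: leeD.
  rewrite -nneseriesZl; last by move=> n _; rewrite mule_ge0.
  rewrite [leLHS]eseries_cond [leRHS]eseries_cond.
  apply: lee_nneseries => [n _ _|n]; first exact: integral_ge0.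
  move=> n0; apply: (le_trans (integral_dyadic_strip n)).
  apply: (le_trans (lee_wpmul2l _ (strip_sup_carleson n0))).
    by rewrite lee_fin; apply: mulr_ge0; [apply: mulr_ge0; [apply: mulr_ge0|exact: sqr_ge0]|exact: sqr_ge0].
  rewrite !muleA -!EFinM le_eqVlt; apply/orP; left; apply/eqP; congr (_%:E * _).
  have -> : maxn n 1 = n by apply/maxn_idPl.
  by field; rewrite expf_neq0.
apply: (le_trans (integral_dyadic_strip 0)).
apply: (le_trans (lee_wpmul2l _ strip_sup0)).
  by rewrite lee_fin; apply: mulr_ge0; [apply: mulr_ge0; [apply: mulr_ge0|exact: sqr_ge0]|exact: sqr_ge0].
rewrite lee_wpmul2r// lee_fin max0n expr0 divr1 expr1n mulr1.
rewrite ler_wpM2r ?sqr_ge0// ler_wpM2r//.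
by rewrite ler_nat.
Qed.

End laplace_bound.
End measure.
End UpperBound.

(** * Signs, suprema and waves *)

Section Signs.
Context d (T : measurableType d) (R : realType) (nu : {measure set T -> \bar R}).
Local Open Scope ereal_scope.

(** The square of the modulus of A + i B. *)
Definition sqr2 (A B : T -> R) (z : T) : \bar R := (A z ^+ 2 + B z ^+ 2)%:E.

Lemma sqr2_ge0 A B z : 0 <= sqr2 A B z.
Proof. by rewrite lee_fin addr_ge0// sqr_ge0. Qed.

Lemma measurable_sqr2 A B : measurable_fun setT A -> measurable_fun setT B ->
  measurable_fun setT (sqr2 A B).
Proof.
by move=> mA mB; apply/measurable_EFinP; apply: measurable_funD; exact: measurable_funX.
Qed.

Lemma integral_parallelogram (A B C D : T -> R) :
  measurable_fun setT A -> measurable_fun setT B ->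
  measurable_fun setT C -> measurable_fun setT D ->
  \int[nu]_z sqr2 (A \+ C)%R (B \+ D)%R z + \int[nu]_z sqr2 (A \- C)%R (B \- D)%R z =
  2%:E * (\int[nu]_z sqr2 A B z + \int[nu]_z sqr2 C D z).
Proof.
move=> mA mB mC mD.
have m1 := measurable_sqr2 (measurable_funD mA mC) (measurable_funD mB mD).
have m2 := measurable_sqr2 (measurable_funB mA mC) (measurable_funB mB mD).
have m3 := measurable_sqr2 mA mB; have m4 := measurable_sqr2 mC mD.
have s0 := sqr2_ge0.
rewrite -ge0_integralD// -ge0_integralD// -ge0_integralZl//; last 2 first.
- exact: emeasurable_funD.
- by move=> z _; rewrite adde_ge0.
apply: eq_integral => z _; rewrite /sqr2 -!EFinD -EFinM; congr EFin => /=; ring.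
Qed.

(** By the parallelogram law, signs can be chosen one after the other so that
    the square norm of the signed sum dominates the sum of the square norms. *)
Lemma exists_signs (A B : nat -> T -> R) (M : nat) :
  (forall m, measurable_fun setT (A m)) -> (forall m, measurable_fun setT (B m)) ->
  exists eps : nat -> R, (forall m, `|eps m| = 1)%R /\
    \sum_(m < M) \int[nu]_z sqr2 (A m) (B m) z <=
    \int[nu]_z sqr2 (fun z => \sum_(m < M) eps m * A m z)%R
                    (fun z => \sum_(m < M) eps m * B m z)%R z.
Proof.
move=> mA mB; elim: M => [|M [eps [eps1 IHM]]].
  exists (fun=> 1%R); split; first by move=> m; rewrite normr1.
  by rewrite big_ord0; apply: integral_ge0 => z _; exact: sqr2_ge0.
pose S z := (\sum_(m < M) eps m * A m z)%R.
pose S' z := (\sum_(m < M) eps m * B m z)%R.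
have mS : measurable_fun setT S.
  by apply: measurable_sum => m; exact: measurable_funM.
have mS' : measurable_fun setT S'.
  by apply: measurable_sum => m; exact: measurable_funM.
have next (s : R) : (`|s| = 1)%R -> \sum_(m < M.+1) \int[nu]_z sqr2 (A m) (B m) z <=
    \int[nu]_z sqr2 (fun z => S z + s * A M z)%R (fun z => S' z + s * B M z)%R z ->
  exists eps : nat -> R, (forall m, `|eps m| = 1)%R /\
    \sum_(m < M.+1) \int[nu]_z sqr2 (A m) (B m) z <=
    \int[nu]_z sqr2 (fun z => \sum_(m < M.+1) eps m * A m z)%R
                    (fun z => \sum_(m < M.+1) eps m * B m z)%R z.
  move=> s1 H; exists (fun m => if (m < M)%N then eps m else s); split.
    by move=> m; case: ifP.
  apply: (le_trans H); rewrite le_eqVlt; apply/orP; left; apply/eqP.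
  apply: eq_integral => z _; rewrite /sqr2 !big_ord_recr/= ltnn /S /S'.
  congr (((_ + _) ^+ 2 + (_ + _) ^+ 2)%:E);
    by apply: eq_bigr => m _; rewrite ltn_ord.
have := integral_parallelogram mS mS' (mA M) (mB M).
set p := \int[nu]_z sqr2 (S \+ _)%R _ z; set q := \int[nu]_z sqr2 (S \- _)%R _ z.
set u := \int[nu]_z sqr2 S S' z; set v := \int[nu]_z sqr2 (A M) (B M) z => E.
have bound : \sum_(m < M.+1) \int[nu]_z sqr2 (A m) (B m) z <= u + v.
  by rewrite big_ord_recr/=; exact: leeD.
(* p + q = 2 (u + v), so p or q is at least u + v. *)
have [up|pu] := leP (u + v) p.
  apply: (next 1%R); first by rewrite normr1.
  apply: (le_trans bound); apply: (le_trans up).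
  rewrite le_eqVlt; apply/orP; left; apply/eqP; apply: eq_integral => z _.
  by rewrite /sqr2/= !mul1r.
apply: (next (-1)%R); first by rewrite normrN1.
apply: (le_trans bound); apply: (@le_trans _ _ q); last first.
  rewrite le_eqVlt; apply/orP; left; apply/eqP; apply: eq_integral => z _.
  by rewrite /sqr2/= !mulN1r.
rewrite leNgt; apply/negP => qu; have := lteD pu qu.
by rewrite E mule_natl mule2n ltxx.
Qed.

End Signs.

Section SumOfSuprema.
Context {R : realType}.
Local Open Scope ereal_scope.

(** Independent choices: a bound on all the sums of values bounds the sum of the
    suprema. *)
Lemma sum_ereal_sup_le (I : Type) (i0 : I) (b : nat -> I -> \bar R) (A : \bar R) M :
  (forall m i, 0 <= b m i) ->
  (forall y : nat -> I, \sum_(m < M) b m (y m) <= A) ->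
  \sum_(m < M) ereal_sup (range (b m)) <= A.
Proof.
move=> b0 bA.
(* The suprema already taken are carried along in the accumulator. *)
suff H : forall K acc, 0 <= acc ->
    (forall y : nat -> I, acc + \sum_(m < K) b m (y m) <= A) ->
    acc + \sum_(m < K) ereal_sup (range (b m)) <= A.
  by rewrite -[leLHS]add0e; apply: H => // y; rewrite add0e.
have s0 m : 0 <= ereal_sup (range (b m)).
  by apply: le_ereal_sup_tmp; exists (b m i0).
elim=> [|K IHK] acc acc0 H; first by have := H (fun=> i0); rewrite !big_ord0.
rewrite big_ord_recr/= addeA.
set X := acc + _.
have X0 : 0 <= X by rewrite adde_ge0// sume_ge0.
have HX i : X + b K i <= A.
  rewrite /X addeAC; apply: IHK; first by rewrite adde_ge0.
  move=> y; have := H (fun m => if (m < K)%N then y m else i).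
  rewrite big_ord_recr/= ltnn.
  rewrite (eq_bigr (fun m : 'I_K => b m (y m))); last by move=> m _; rewrite ltn_ord.
  by rewrite addeAC addeA.
have [->|Ay] := eqVneq A +oo; first by rewrite leey.
have Xfin : X \is a fin_num.
  rewrite ge0_fin_numE//; apply: (@le_lt_trans _ _ A); last by rewrite ltey.
  by apply: le_trans (HX i0); rewrite leeDl.
rewrite addeC -leeBrDr//; apply: ge_ereal_sup => _ [i _ <-].
by rewrite leeBrDr// addeC.
Qed.

End SumOfSuprema.

Section Waves.
Context {R : realType}.
Notation mu := (@lebesgue_measure R).
Notation Phi := (Phi_exp R).
Implicit Types (p q w y t x : R).

(** Real part of t |-> w e^(iyt) on ]p, q], and zero elsewhere. *)
Definition wave_re p q w y t : R := w * \1_`]p, q] t * cos (y * t).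
(** Imaginary part of t |-> w e^(iyt) on ]p, q], and zero elsewhere. *)
Definition wave_im p q w y t : R := w * \1_`]p, q] t * sin (y * t).

Lemma measurable_wave_re p q w y : measurable_fun setT (wave_re p q w y).
Proof.
apply: measurable_funM; last by apply: continuous_measurable_fun; exact: continuous_cosM.
by apply: measurable_funM => //; apply: measurable_indic; exact: measurable_itv.
Qed.

Lemma measurable_wave_im p q w y : measurable_fun setT (wave_im p q w y).
Proof.
apply: measurable_funM; last by apply: continuous_measurable_fun; exact: continuous_sinM.
by apply: measurable_funM => //; apply: measurable_indic; exact: measurable_itv.
Qed.

Lemma indic_norm_le1 (D : set R) t : `|\1_D t| <= 1 :> R.
Proof. by rewrite indicE; case: (_ \in _); rewrite ?normr1 ?normr0. Qed.

Lemma Rintegrable_wave_re p q w y : Rintegrable mu `]0, 1] (wave_re p q w y).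
Proof.
apply: (@Rintegrable_bounded _ _ R mu [set` `]0, 1]] (measurable_itv _) _ `|w|).
- exact: lebesgue_itvoc_fin.
- by apply: measurable_funTS; exact: measurable_wave_re.
- move=> t _; rewrite /wave_re 2!normrM -[leRHS]mulr1 ler_pM ?cos_max//.
  by rewrite ler_piMr// indic_norm_le1.
Qed.

Lemma Rintegrable_wave_im p q w y : Rintegrable mu `]0, 1] (wave_im p q w y).
Proof.
apply: (@Rintegrable_bounded _ _ R mu [set` `]0, 1]] (measurable_itv _) _ `|w|).
- exact: lebesgue_itvoc_fin.
- by apply: measurable_funTS; exact: measurable_wave_im.
- move=> t _; rewrite /wave_im 2!normrM -[leRHS]mulr1 ler_pM ?sin_max//.
  by rewrite ler_piMr// indic_norm_le1.
Qed.

(** A lower bound for e^(-xt) cos (ht) when xt <= 2 and |ht| <= 1. *)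
Definition wave_constant : R := expR (- 2) * cos 1.

Lemma wave_constant_gt0 : 0 < wave_constant.
Proof. by rewrite mulr_gt0 ?expR_gt0 ?cos1_gt0. Qed.

Lemma cos_ge_cos1 (h : R) : `|h| <= 1 -> cos 1 <= cos h.
Proof.
move=> h1; rewrite -(cos_norm h) leNgt; apply/negP.
have pi2 := @pi_ge2 R; have h0 := normr_ge0 h.
by rewrite ltr_cos; [by rewrite ltNge h1|..]; rewrite in_itv/=; apply/andP; split; lra.
Qed.

(** A wave of frequency y has no cancellation in its transform at the points
    x + i eta with x <= 2 / q and |eta - y| <= 1 / q. *)
Lemma wave_lap_ge p q w y x eta : 0 <= p -> p < q -> q <= 1 -> 0 <= w ->
  0 <= x -> x * q <= 2 -> `|eta - y| * q <= 1 ->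
  w * (q - p) * wave_constant <= lapRe (wave_re p q w y) (wave_im p q w y) x eta.
Proof.
move=> p0 pq q1 w0 x0 xq hq.
have q0 : 0 < q by exact: le_lt_trans pq.
have sub : [set` `]p, q]] `<=` [set` `]0, 1]].
  move=> t /=; rewrite !in_itv/= => /andP[pt tq].
  by rewrite (le_lt_trans p0 pt) (le_trans tq q1).
have -> : lapRe (wave_re p q w y) (wave_im p q w y) x eta =
    \int[mu]_(t in `]p, q]) (w * dcos x (eta - y) t).
  rewrite -(Rintegral_restrict_itv _ sub); apply: eq_Rintegral => t _.
  rewrite /dcos /dsin /wave_re /wave_im patchE (_ : point = 0)// indicE.
  have [tpq|tpq] := pselect ([set` `]p, q]] t); [rewrite ifT; last exact: mem_set|
    rewrite ifF; last exact: memNset].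
    by rewrite (mem_set tpq) mulrBl cosB /=; ring.
  by rewrite (memNset tpq) /= !(mulr0, mul0r) addr0.
have -> : w * (q - p) * wave_constant = \int[mu]_(t in `]p, q]) (cst (w * wave_constant) t).
  rewrite Rintegral_cst//= [X in fine X](lebesgue_itvoc (ltW pq))/=; ring.
apply: le_Rintegral => //.
- by apply: continuous_Rintegrable; exact: cst_continuous.
- apply: RintegrableZ => //; apply: continuous_Rintegrable; exact: continuous_dcos.
move=> t /=; rewrite in_itv/= => /andP[pt tq].
have t0 : 0 <= t by apply: ltW; exact: le_lt_trans pt.
rewrite ler_wpM2l// /wave_constant /dcos.
have ce : 0 <= cos (1 : R) by exact/ltW/cos1_gt0.
apply: ler_pM => //.
  rewrite ler_expR mulNr lerN2; apply: le_trans xq.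
  by rewrite ler_wpM2l.
apply: cos_ge_cos1; rewrite normrM (ger0_norm t0).
by apply: le_trans hq; rewrite ler_wpM2l.
Qed.

End Waves.

(** * The operator norm *)

Section OperatorNorm.
Context {R : realType}.
Variable nu : {measure set (borel (Cplus R)) -> \bar R}.
Notation Phi := (Phi_exp R).
Local Open Scope ereal_scope.

Lemma poweR2 (x : \bar R) : 0 <= x -> x `^ 2 = x ^+ 2.
Proof.
case: x => [r| |]//; last by move=> _; rewrite poweRyr//= mulyy.
by rewrite lee_fin => r0; rewrite poweR_EFin -EFin_expe powR_mulrn.
Qed.

Lemma L2_norm_ge0 F : 0 <= L2_norm nu F.
Proof. exact: Lnorm_ge0. Qed.

Lemma L2_norm_sqr F : L2_norm nu F ^+ 2 = \int[nu]_z (modulus (F z) ^+ 2)%:E.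
Proof.
rewrite -poweR2 ?L2_norm_ge0// /L2_norm poweR_Lnorm//.
apply: eq_integral => z _; rewrite gee0_abs ?lee_fin ?modulus_ge0//.
by rewrite poweR_EFin powR_mulrn// modulus_ge0.
Qed.

Lemma orlicz_norm_has_lbound (f : R -> R[i]) : has_lbound [set k : R | (0 < k)%R /\
    \int[lebesgue_measure]_(s in unit_itv R) (Phi (k^-1 * modulus (f s)))%:E <= 1].
Proof. by exists 0%R => k [/ltW]. Qed.

Lemma measurable_orlicz_integrand (f : R -> R[i]) k :
  measurable_fun (unit_itv R) (f : R -> borel (Cplane R)) ->
  measurable_fun (unit_itv R) (fun s => (Phi (k^-1 * modulus (f s)))%:E).
Proof.
move=> mf; apply/measurable_EFinP; apply: (measurableT_comp measurable_Phi_exp).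
by apply: measurable_funM => //; exact: measurable_modulus.
Qed.

Lemma orlicz_space_unit (f : R -> R[i]) :
  measurable_fun (unit_itv R) (f : R -> borel (Cplane R)) ->
  \int[lebesgue_measure]_(s in unit_itv R) (Phi (modulus (f s)))%:E <= 1 ->
  orlicz_space Phi f /\ (orlicz_norm Phi f <= 1)%R.
Proof.
move=> mf f1.
have f1' : \int[lebesgue_measure]_(s in unit_itv R) (Phi (1^-1 * modulus (f s)))%:E <= 1.
  by under eq_integral do rewrite invr1 mul1r.
split; last by apply: ge_inf; [exact: orlicz_norm_has_lbound|split].
split => //; exists 1%R => //; apply/integrableP; split.
  exact: measurable_orlicz_integrand.
apply: le_lt_trans (ltry 1%R); apply: le_trans f1'.
rewrite le_eqVlt; apply/orP; left; apply/eqP; apply: eq_integral => t _.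
by rewrite gee0_abs// lee_fin Phi_exp_ge0.
Qed.

Lemma opnorm_ge0 : 0 <= laplace_opnorm Phi nu.
Proof.
apply: le_ereal_sup_tmp; exists (L2_norm nu (laplace (ext0 (fun=> 0%R)))); last exact: L2_norm_ge0.
exists (fun=> 0%R) => //; apply: orlicz_space_unit; first exact: measurable_cst.
rewrite integral0_eq// => t _.
by rewrite Normc.normc0 /Phi_exp expR0 subr0 subrr.
Qed.

(** Any function a + i b of Luxemburg norm at most 1 tests the operator norm. *)
Lemma opnorm_test (a b : R -> R) : measurable_fun setT a -> measurable_fun setT b ->
  (forall t, t \notin unit_itv R -> a t = 0%R /\ b t = 0%R) ->
  \int[lebesgue_measure]_(s in unit_itv R) (Phi (Num.sqrt (a s ^+ 2 + b s ^+ 2)))%:E <= 1 ->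
  \int[nu]_z sqr2
    (fun z : borel (Cplus R) => lapRe a b (complex.Re (Cval z)) (complex.Im (Cval z)))
    (fun z : borel (Cplus R) => lapIm a b (complex.Re (Cval z)) (complex.Im (Cval z))) z
  <= laplace_opnorm Phi nu ^+ 2.
Proof.
move=> ma mb ab0 abPhi; pose f t := Complex (a t) (b t).
have mf : measurable_fun (unit_itv R) (f : R -> borel (Cplane R)).
  by apply: measurable_borel_complex; exact: measurable_funTS.
have [fO f1] := orlicz_space_unit mf abPhi.
have re : re0 f = a.
  by apply/funext => t; rewrite /re0 /ext0; case: ifPn => // /ab0[-> _].
have im : im0 f = b.
  by apply/funext => t; rewrite /im0 /ext0; case: ifPn => // /ab0[_ ->].
apply: (@le_trans _ _ (L2_norm nu (laplace (ext0 f)) ^+ 2)).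
  rewrite L2_norm_sqr le_eqVlt; apply/orP; left; apply/eqP; apply: eq_integral => z _.
  by rewrite sqr_modulus_laplace re im.
rewrite lee_sqr ?L2_norm_ge0 ?opnorm_ge0//.
by apply: ereal_sup_ubound; exists f.
Qed.

Lemma Phi_exp_scale (s v : R) : (0 <= s <= 1)%R -> (0 <= v)%R -> (Phi (s * v) <= s * Phi v)%R.
Proof.
move=> /andP[s0 s1] v0; rewrite /Phi_exp.
have h1 : (expR (s * v) * (1 + (1 - s) * v) <= expR v)%R.
  have -> : expR v = (expR (s * v) * expR ((1 - s) * v))%R by rewrite -expRD; congr expR; ring.
  by rewrite ler_wpM2l ?expR_ge0// expR_ge1Dx.
have h2 : (expR (s * v) * (1 - s * v) <= 1)%R.
  rewrite -[leRHS]expR0 -(subrr (s * v)%R) expRD.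
  by rewrite ler_wpM2l ?expR_ge0// expR_ge1Dx.
have h3 : (0 <= 1 - s)%R by rewrite subr_ge0.
have := ler_wpM2l s0 h1; have := ler_wpM2l h3 h2.
by set E := expR (s * v); set F := expR v; lra.
Qed.

Lemma orlicz_norm_nonempty (f : R -> R[i]) : orlicz_space Phi f ->
  [set k : R | (0 < k)%R /\
    \int[lebesgue_measure]_(s in unit_itv R) (Phi (k^-1 * modulus (f s)))%:E <= 1] !=set0.
Proof.
move=> [mf [k k0 Ik]].
have Phi0 x : 0 <= (Phi x)%:E by rewrite lee_fin Phi_exp_ge0.
set I := \int[lebesgue_measure]_(s in unit_itv R) (Phi (k^-1 * modulus (f s)))%:E.
have I0 : 0 <= I by exact: integral_ge0.
have Ifin : I \is a fin_num by apply: integrable_fin_num => //; exact: measurable_itv.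
(* By convexity, enlarging k by the factor c divides the integral by c. *)
pose c := (1 + fine I)%R.
have c1 : (1 <= c)%R by rewrite lerDl fine_ge0.
have c0 : (0 < c)%R by exact: lt_le_trans c1.
exists (k * c)%R; split; first exact: mulr_gt0.
apply: (@le_trans _ _ (\int[lebesgue_measure]_(s in unit_itv R) ((c^-1)%:E * (Phi (k^-1 * modulus (f s)))%:E))).
  apply: ge0_le_integral => //.
  - exact: measurable_itv.
  - exact: measurable_orlicz_integrand.
  - by apply: measurable_funeM; exact: measurable_orlicz_integrand.
  - move=> t _; rewrite -EFinM lee_fin invfM [(k^-1 * c^-1)%R]mulrC -[(_ / _ * _)%R]mulrA.
    apply: Phi_exp_scale.
      by rewrite invr_ge0 (ltW c0)/= invf_le1.
    by rewrite mulr_ge0 ?modulus_ge0// invr_ge0 ltW.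
rewrite ge0_integralZl//; last 3 first.
- exact: measurable_itv.
- exact: measurable_orlicz_integrand.
- by rewrite lee_fin invr_ge0 ltW.
rewrite -/I -(fineK Ifin) -EFinM lee_fin ler_pdivrMl// mulr1 /c.
by rewrite lerDr.
Qed.

(** A quadratic estimate that holds on a set passes to its infimum. *)
Lemma inf_sqr_le (S : set R) (X K : R) : S !=set0 -> (forall k, S k -> 0 < k)%R ->
  (0 <= K)%R -> (forall k, S k -> X <= K * k ^+ 2)%R -> (X <= K * inf S ^+ 2)%R.
Proof.
move=> S0 Spos K0 SX.
have i0 : (0 <= inf S)%R by apply: lb_le_inf => // k /Spos/ltW.
rewrite leNgt; apply/negP => lt.
have [k Sk] := S0; have Kp : (0 < K)%R.
  rewrite lt_neqAle K0 andbT; apply/eqP => K00.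
  by have := SX k Sk; move: lt; rewrite -K00 !mul0r ltNge => /negP.
have X0 : (0 <= X / K)%R by rewrite divr_ge0// ltW// (le_lt_trans _ lt)// mulr_ge0// sqr_ge0.
have : (inf S < Num.sqrt (X / K))%R.
  rewrite -[ltLHS]ger0_norm// -sqrtr_sqr ltr_sqrt.
    by rewrite ltr_pdivlMr// mulrC.
  rewrite divr_gt0// (le_lt_trans _ lt)// mulr_ge0// sqr_ge0//.
move=> /(inf_lt S0)[j Sj jlt].
have := SX j Sj; rewrite leNgt => /negP; apply.
rewrite mulrC -ltr_pdivlMr// -[ltRHS](sqr_sqrtr X0).
by rewrite ltr_pXn2r// ?nnegrE ?sqrtr_ge0// ltW// Spos.
Qed.

(** The constant of the upper estimate of the square of the operator norm. *)
Definition upper_constant : R := (8 * strip_constant)%R.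

Lemma upper_constant_gt0 : (0 < upper_constant)%R.
Proof. by apply: mulr_gt0; [rewrite ltr0n|exact: strip_constant_gt0]. Qed.

Lemma L2_norm_sqr_le (f : R -> R[i]) : orlicz_space Phi f ->
  embedding_constant nu < +oo -> 0 <= embedding_constant nu ->
  L2_norm nu (laplace (ext0 f)) ^+ 2 <=
    (upper_constant * fine (embedding_constant nu) * orlicz_norm Phi f ^+ 2)%:E.
Proof.
move=> fO Efin E0; have [mf _] := fO.
have S0 := orlicz_norm_nonempty fO.
set S := [set k : R | _] in S0; rewrite L2_norm_sqr.
set X := \int[nu]_z _; set e := fine _.
have Ee : embedding_constant nu = e%:E by rewrite fineK// ge0_fin_numE.
have XS k : S k -> X <= (upper_constant * e * k ^+ 2)%:E.
  move=> [k0 kPhi]; apply: (le_trans (integral_laplace_le nu k0 mf kPhi)).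
  by rewrite Ee -EFinM le_eqVlt; apply/orP; left; apply/eqP; congr EFin; rewrite /upper_constant mulrAC.
have X0 : 0 <= X by apply: integral_ge0 => z _; rewrite lee_fin sqr_ge0.
have Xfin : X \is a fin_num.
  by have [k Sk] := S0; rewrite ge0_fin_numE// (le_lt_trans (XS k Sk))// ltry.
rewrite -(fineK Xfin) lee_fin; apply: inf_sqr_le => //.
- by move=> k [].
- by rewrite mulr_ge0// ?fine_ge0// ltW// upper_constant_gt0.
- by move=> k Sk; rewrite -lee_fin fineK//; exact: XS.
Qed.

End OperatorNorm.

(** * Tiles and Carleson squares *)

Section Tiles.
Context {R : realType}.
Variable nu : {measure set (borel (Cplus R)) -> \bar R}.
Local Open Scope ereal_scope.

Lemma finite_itv (I : interval R) : 0 < itv_length I < +oo ->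
  exists a : R, forall y, y \in I -> (a <= y <= a + fine (itv_length I))%R.
Proof.
rewrite /itv_length; case: I => [[b a|[|]] [b' c|[|]]];
  rewrite lebesgue_measure_itv/= ?lte_fin ?ltNyr ?ltry ?ltxx// => /andP[I0 Ioo] //.
move: I0; case: ifP => [ac _|]; last by rewrite ltxx.
exists a => y; rewrite itv_boundlr => /andP[ay yc] /=.
move: ay yc.
have -> : (a + (c - a) = c)%R by ring.
by case: b {Ioo}; case: b'; rewrite ?bnd_simp => h1 h2; apply/andP; split => //; exact: ltW.
Qed.

(** The part of the n-th strip with y <= Im z < y + 2 ^ n. *)
Definition tile (n : nat) (y : R) : set (Cplus R) :=
  strip R n%:Z `&` [set z | (y <= complex.Im (Cval z) < y + 2 ^+ n)%R].

Lemma measurable_strip n : measurable (strip R n%:Z : set (borel (Cplus R))).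
Proof.
have := measurable_Cplus_Re measurableT (measurable_itv `[((2 : R) ^ n%:Z)%R, (2 ^ (n%:Z + 1))%R[).
rewrite setTI; congr (measurable _); apply/seteqP; by split=> z; rewrite /= in_itv.
Qed.

Lemma measurable_tile n y : measurable (tile n y : set (borel (Cplus R))).
Proof.
apply: measurableI; first exact: measurable_strip.
have := measurable_Cplus_Im measurableT (measurable_itv `[y, (y + 2 ^+ n)%R[).
rewrite setTI; congr (measurable _); apply/seteqP; by split=> z; rewrite /= in_itv.
Qed.

(** The supremum of the masses of the tiles of the n-th strip. *)
Definition tile_sup (n : nat) : \bar R := ereal_sup (range (fun y => nu (tile n y))).

Lemma tile_sup_ge0 n : 0 <= tile_sup n.
Proof. by apply: le_ereal_sup_tmp; exists (nu (tile n 0%R)) => //; exists 0%R. Qed.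

(** A Carleson square of side less than 2 ^ n misses the n-th strip, and one of
    side l >= 2 ^ n meets it in a set covered by at most 2 l / 2 ^ n tiles. *)
Lemma carleson_le_tile n :
  carleson 2 (strip_measure nu n%:Z) <= (2 / (2 ^+ n) ^+ 2)%:E * tile_sup n.
Proof.
have N0 : (0 < (2 : R) ^+ n)%R by rewrite exprn_gt0.
apply: ge_ereal_sup => _ [I /= Ilen <-].
set l := fine (itv_length I).
have lE : itv_length I = l%:E.
  by rewrite fineK// ge0_fin_numE; case/andP: Ilen => // /ltW.
have l0 : (0 < l)%R by move: Ilen; rewrite lE lte_fin => /andP[].
rewrite powR_mulrn ?(ltW l0)//.
have rhs0 : 0 <= (2 / (2 ^+ n) ^+ 2)%:E * tile_sup n.
  by rewrite mule_ge0 ?tile_sup_ge0// lee_fin divr_ge0// sqr_ge0.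
have [lN|Nl] := ltP l (2 ^+ n)%R.
  rewrite /strip_measure (_ : carleson_square I `&` _ = set0) ?measure0 ?mul0e//.
  apply/seteqP; split=> // z [[_ [_ zl]] /= /andP[zn _]].
  move: zl; rewrite lE lee_fin => zl.
  by have := le_lt_trans zl lN; rewrite ltNge exprnP zn.
have [a aI] := finite_itv Ilen.
(* K tiles cover the square; since l >= 2 ^ n, K is at most 2 l / 2 ^ n. *)
pose K := (Num.truncn (l / 2 ^+ n)).+1.
have lK : (l < K%:R * 2 ^+ n)%R by rewrite -ltr_pdivrMr// truncnS_gt.
have K2 : (K%:R <= 2 * (l / 2 ^+ n))%R.
  have r1 : (1 <= l / 2 ^+ n)%R by rewrite ler_pdivlMr// mul1r.
  have : ((Num.truncn (l / 2 ^+ n))%:R <= l / 2 ^+ n)%R by rewrite truncn_le// divr_ge0// ltW.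
  by rewrite /K -natr1; lra.
have cover : carleson_square I `&` strip R n%:Z `<=`
    \big[setU/set0]_(j < K) tile n (a + j%:R * 2 ^+ n)%R.
  move=> z [[zI _] zn]; rewrite -(bigcup_mkord K (fun j => tile n (a + j%:R * 2 ^+ n)%R)).
  have /andP[h1 h2] := aI _ zI; rewrite -/l in h2.
  set y := complex.Im (Cval z) in h1 h2.
  have ya0 : (0 <= (y - a) / 2 ^+ n)%R by rewrite divr_ge0 ?(ltW N0)// subr_ge0.
  have /andP[t1 t2] := truncn_itv ya0.
  exists (Num.truncn ((y - a) / 2 ^+ n)%R).
    rewrite /= -(ltr_nat R); apply: (le_lt_trans t1).
    by rewrite ltr_pdivrMr//; apply: le_lt_trans lK; lra.
  split => //=; rewrite -/y.
  set k := Num.truncn _ in t1 t2 *.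
  have e : (k.+1%:R * 2 ^+ n = k%:R * 2 ^+ n + 2 ^+ n :> R)%R by rewrite -natr1 mulrDl mul1r.
  move: t1 t2; rewrite ler_pdivlMr// ltr_pdivrMr// e => t1 t2.
  by apply/andP; split; lra.
have : nu (carleson_square I `&` strip R n%:Z) <= K%:R%:E * tile_sup n.
  have mA : measurable (carleson_square I `&` strip R n%:Z : set (borel (Cplus R))).
    by apply: measurableI; [exact: measurable_carleson_square|exact: measurable_strip].
  have := @content_subadditive _ _ _ nu (carleson_square I `&` strip R n%:Z)
    (fun j => tile n (a + j%:R * 2 ^+ n)%R) K (fun j _ => measurable_tile _ _) mA cover.
  move=> /le_trans; apply.
  apply: (@le_trans _ _ (\sum_(j < K) tile_sup n)).
    apply: lee_sum => j _; apply: ereal_sup_ubound; by exists (a + j%:R * 2 ^+ n)%R.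
  under eq_bigr do rewrite -[tile_sup n]mul1e.
  by rewrite -ge0_sume_distrl// sumEFin sumr_const card_ord.
move=> H; rewrite /strip_measure.
apply: (@le_trans _ _ (K%:R%:E * tile_sup n * (l ^- 2)%:E)).
  by rewrite lee_wpmul2r// lee_fin invr_ge0 sqr_ge0.
rewrite muleAC -EFinM lee_wpmul2r ?tile_sup_ge0// lee_fin.
rewrite ler_pdivrMr ?exprn_gt0//; apply: (le_trans K2).
have -> : (2 / (2 ^+ n) ^+ 2 * l ^+ 2 = 2 * (l / 2 ^+ n) * (l / 2 ^+ n))%R.
  by field; rewrite gt_eqF.
apply: ler_peMr; last by rewrite ler_pdivlMr// mul1r.
by apply: mulr_ge0; rewrite // divr_ge0// ltW.
Qed.

End Tiles.

(** * The lower bound and the equivalence *)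

Section LowerBound.
Context {R : realType}.
Notation mu := (@lebesgue_measure R).
Notation Phi := (Phi_exp R).
Variable nu : {measure set (borel (Cplus R)) -> \bar R}.

Local Notation p_ m := ((2 ^+ m.+2)^-1 : R).
Local Notation q_ m := ((2 ^+ m.+1)^-1 : R).
Local Notation w_ m := (m.+1%:R / 4 : R).

Let p0 m : 0 < p_ m. Proof. by rewrite invr_gt0 exprn_gt0. Qed.
Let pq m : p_ m < q_ m.
Proof. by rewrite ltf_pV2 ?posrE ?exprn_gt0// ltr_eXn2l// ltr1n. Qed.
Let q1 m : q_ m <= 2^-1.
Proof. by rewrite lef_pV2 ?posrE ?exprn_gt0// -[leLHS]expr1 ler_weXn2l// ler1n. Qed.
Let qBp m : q_ m - p_ m = p_ m.
Proof. by rewrite [2 ^+ m.+2]exprS; field; rewrite expf_neq0. Qed.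

(** The supports of the waves are pairwise disjoint. *)
Lemma dyadic_wave_itv_inj m k (t : R) :
  t \in `]p_ m, q_ m] -> t \in `]p_ k, q_ k] -> m = k.
Proof.
have H i j : (i < j)%N -> t \in `]p_ i, q_ i] -> t \in `]p_ j, q_ j] -> False.
  move=> ij; rewrite !in_itv/= => /andP[h1 _] /andP[_ h2].
  have := lt_le_trans h1 h2.
  by rewrite ltf_pV2 ?posrE ?exprn_gt0// ltr_eXn2l ?ltr1n// ltnNge ltnS ij.
move=> tm tk; case: (ltngtP m k) => // mk; first by have := H _ _ mk tm tk.
by have := H _ _ mk tk tm.
Qed.

Lemma wave_notin p q w y (t : R) : t \notin `]p, q] ->
  wave_re p q w y t = 0 /\ wave_im p q w y t = 0.
Proof.
move=> tpq; rewrite /wave_re /wave_im indicE memNset ?mulr0 ?mul0r//=.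
by rewrite (negbTE tpq).
Qed.

Lemma wave_in p q w y (t : R) : t \in `]p, q] ->
  wave_re p q w y t = w * cos (y * t) /\ wave_im p q w y t = w * sin (y * t).
Proof. by move=> tpq; rewrite /wave_re /wave_im indicE mem_set// mulr1. Qed.

(** Since e^(1/4) <= 4 / 3 < 2, the values of Phi at m / 4 are summable against
    the lengths 2 ^ (- m) of the supports of the waves. *)
Lemma Phi_exp_quarter (m : nat) : Phi (m%:R / 4) <= (4 / 3) ^+ m.
Proof.
apply: (@le_trans _ _ (expR (m%:R / 4))).
  have m0 : 0 <= m%:R / 4 :> R by rewrite divr_ge0.
  by rewrite /Phi_exp; lra.
rewrite expRM_natl; apply: lerXn2r; rewrite ?nnegrE ?expR_ge0//.
have := expR_ge1Dx (- (4^-1) : R); rewrite expRN => h.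
have e0 := expR_gt0 (4^-1 : R).
have : (1 - 4^-1) * expR (4^-1 : R) <= 1.
  by rewrite -[leRHS](mulVf (lt0r_neq0 e0)) ler_wpM2r// ltW.
by lra.
Qed.

Section superposition_of_waves.
Variables (M : nat) (eps y : nat -> R).
Hypothesis eps1 : forall m, `|eps m| = 1.

(** Real part of a signed sum of waves: the m-th one has weight (m + 1) / 4 and
    is supported in ]2 ^ (- m - 2), 2 ^ (- m - 1)]. *)
Definition superposition_re t := \sum_(m < M) eps m * wave_re (p_ m) (q_ m) (w_ m) (y m) t.
(** Imaginary part of the same signed sum of waves. *)
Definition superposition_im t := \sum_(m < M) eps m * wave_im (p_ m) (q_ m) (w_ m) (y m) t.

Lemma measurable_superposition_re : measurable_fun setT superposition_re.
Proof.
by apply: measurable_sum => m; apply: measurable_funM => //; exact: measurable_wave_re.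
Qed.

Lemma measurable_superposition_im : measurable_fun setT superposition_im.
Proof.
by apply: measurable_sum => m; apply: measurable_funM => //; exact: measurable_wave_im.
Qed.

Lemma superposition_unit t : t \notin unit_itv R -> superposition_re t = 0 /\ superposition_im t = 0.
Proof.
move=> t01; have h m : t \notin `]p_ m, q_ m].
  apply: contra t01; rewrite in_itv/= => /andP[pt tq]; apply: mem_set.
  rewrite /unit_itv /= in_itv/= (lt_trans (p0 m) pt) (le_lt_trans tq)//.
  by apply: le_lt_trans (q1 m) _; rewrite invf_lt1// ltr1n.
by split; apply: big1 => m _; have [re im] := wave_notin (w_ m) (y m) (h m);
  rewrite ?re ?im mulr0.
Qed.

Lemma Phi_superposition_le t : Phi (Num.sqrt (superposition_re t ^+ 2 + superposition_im t ^+ 2)) <=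
  \sum_(m < M) (4 / 3) ^+ m.+1 * \1_`]p_ m, q_ m] t.
Proof.
have rhs0 (m : nat) : 0 <= (4 / 3) ^+ m.+1 * \1_`]p_ m, q_ m] t :> R.
  by rewrite mulr_ge0 ?exprn_ge0 ?divr_ge0// indicE.
have [/existsP[k tk]|/existsPn none] := boolP [exists k : 'I_M, t \in `]p_ k, q_ k]]; last first.
  have re0 : superposition_re t = 0.
    by apply: big1 => m _; have [-> _] := wave_notin (w_ m) (y m) (none m); rewrite mulr0.
  have im0 : superposition_im t = 0.
    by apply: big1 => m _; have [_ ->] := wave_notin (w_ m) (y m) (none m); rewrite mulr0.
  rewrite re0 im0 expr0n/= addr0 sqrtr0 /Phi_exp expR0 subr0 subrr.
  by apply: sumr_ge0 => m _.
have other (m : 'I_M) : m != k -> t \notin `]p_ m, q_ m].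
  by apply: contra => tm; apply/eqP/val_inj; exact: dyadic_wave_itv_inj tm tk.
have [ck sk] := wave_in (w_ k) (y k) tk.
have -> : superposition_re t = eps k * (w_ k * cos (y k * t)).
  rewrite /superposition_re (bigD1 k)//= big1 ?addr0 ?ck// => m mk.
  by have [-> _] := wave_notin (w_ m) (y m) (other m mk); rewrite mulr0.
have -> : superposition_im t = eps k * (w_ k * sin (y k * t)).
  rewrite /superposition_im (bigD1 k)//= big1 ?addr0 ?sk// => m mk.
  by have [_ ->] := wave_notin (w_ m) (y m) (other m mk); rewrite mulr0.
have -> : (eps k * (w_ k * cos (y k * t))) ^+ 2 + (eps k * (w_ k * sin (y k * t))) ^+ 2 = w_ k ^+ 2.
  rewrite !exprMn -mulrDr -mulrDr cos2Dsin2 mulr1.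
  by rewrite -(real_normK (num_real (eps k))) eps1 expr1n mul1r.
rewrite sqrtr_sqr ger0_norm ?divr_ge0//.
rewrite (bigD1 k)//= indicE mem_set// mulr1.
apply: (le_trans (Phi_exp_quarter k.+1)); rewrite lerDl.
by apply: sumr_ge0.
Qed.

(** Whatever the signs and the frequencies are, the superposition has Luxemburg
    norm at most 1. *)
Lemma integral_Phi_superposition : (\int[mu]_(t in unit_itv R)
  (Phi (Num.sqrt (superposition_re t ^+ 2 + superposition_im t ^+ 2)))%:E <= 1)%E.
Proof.
have mU : measurable (unit_itv R) by exact: measurable_itv.
pose g (m : nat) t : \bar R := (((4 / 3) ^+ m.+1)%:E * (\1_`]p_ m, q_ m] t : R)%:E)%E.
have r0 m : 0 <= (4 / 3) ^+ m :> R by rewrite exprn_ge0// divr_ge0.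
have g0 m t : (0 <= g m t)%E by rewrite mule_ge0 ?lee_fin// indicE.
have mi m : measurable_fun (unit_itv R) (fun t => (\1_`]p_ m, q_ m] t : R)%:E).
  by apply/measurable_EFinP; apply: measurable_indic; exact: measurable_itv.
have mg m : measurable_fun (unit_itv R) (g m) by exact: measurable_funeM.
apply: (@le_trans _ _ (\int[mu]_(t in unit_itv R) (\sum_(m < M) g m t))%E).
  apply: ge0_le_integral => //.
  - by move=> t _; rewrite lee_fin Phi_exp_ge0.
  - apply/measurable_EFinP; apply: (measurableT_comp measurable_Phi_exp).
    apply: (@measurableT_comp _ _ _ _ _ _ (@Num.sqrt R)).
      by apply: continuous_measurable_fun; exact: sqrt_continuous.
    apply: measurable_funTS; apply: measurable_funD; apply: measurable_funX.
      exact: measurable_superposition_re.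
    exact: measurable_superposition_im.
  - by apply: emeasurable_sum => m; exact: mg.
  - move=> t _; under eq_bigr do rewrite /g -EFinM.
    by rewrite sumEFin lee_fin; exact: Phi_superposition_le.
rewrite ge0_integral_sum//; last by move=> m; exact: mg.
apply: (@le_trans _ _ (\sum_(m < M) (2^-1 * (2 / 3) ^+ m.+1)%:E)%E).
  apply: lee_sum => m _; rewrite ge0_integralZl//; last exact: (mi m).
  rewrite integral_indic//.
  have -> : 2^-1 * (2 / 3) ^+ m.+1 = (4 / 3) ^+ m.+1 * (q_ m - p_ m) :> R.
    have -> : 4 / 3 = 2 * (2 / 3) :> R by field.
    rewrite qBp [2 ^+ m.+2]exprS (@exprMn_comm _ 2 (2 / 3)); last exact: mulrC.
    have : 2 ^+ m.+1 != 0 :> R by rewrite expf_neq0.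
    by set u := 2 ^+ m.+1; set v := (2 / 3) ^+ m.+1; move=> u0; field.
  rewrite EFinM lee_wpmul2l ?lee_fin// -(lebesgue_itvoc (ltW (pq m))).
  apply: le_measure; rewrite ?inE; [apply: measurableI; exact: measurable_itv|exact: measurable_itv|exact: subIsetl].
rewrite sumEFin lee_fin -mulr_sumr.
have -> : \sum_(m < M) (2 / 3) ^+ m.+1 = 2 - 2 * (2 / 3) ^+ M :> R.
  elim: M => [|k IHk]; first by rewrite big_ord0 expr0; ring.
  by rewrite big_ord_recr/= IHk exprS; field.
have : 0 <= (2 / 3) ^+ M :> R by rewrite exprn_ge0// divr_ge0.
by lra.
Qed.

Lemma lapRe_superposition x h : 0 <= x -> lapRe superposition_re superposition_im x h =
  \sum_(m < M) eps m * lapRe (wave_re (p_ m) (q_ m) (w_ m) (y m))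
                             (wave_im (p_ m) (q_ m) (w_ m) (y m)) x h.
Proof.
move=> x0.
have I (m : nat) : Rintegrable mu `]0, 1] (fun t =>
    dcos x h t * wave_re (p_ m) (q_ m) (w_ m) (y m) t +
    dsin x h t * wave_im (p_ m) (q_ m) (w_ m) (y m) t).
  apply: RintegrableD => //.
    by apply: Rintegrable_dcos => //; exact: Rintegrable_wave_re.
  by apply: Rintegrable_dsin => //; exact: Rintegrable_wave_im.
under eq_bigr => m _ do rewrite -(RintegralZl_itv _ (I m)).
rewrite -Rintegral_sum//; last by move=> m; apply: RintegrableZ => //; exact: I.
apply: eq_Rintegral => t _; rewrite /superposition_re /superposition_im !mulr_sumr -big_split/=.
by apply: eq_bigr => m _; ring.
Qed.

Lemma lapIm_superposition x h : 0 <= x -> lapIm superposition_re superposition_im x h =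
  \sum_(m < M) eps m * lapIm (wave_re (p_ m) (q_ m) (w_ m) (y m))
                             (wave_im (p_ m) (q_ m) (w_ m) (y m)) x h.
Proof.
move=> x0.
have I (m : nat) : Rintegrable mu `]0, 1] (fun t =>
    dcos x h t * wave_im (p_ m) (q_ m) (w_ m) (y m) t -
    dsin x h t * wave_re (p_ m) (q_ m) (w_ m) (y m) t).
  apply: RintegrableB => //.
    by apply: Rintegrable_dcos => //; exact: Rintegrable_wave_im.
  by apply: Rintegrable_dsin => //; exact: Rintegrable_wave_re.
under eq_bigr => m _ do rewrite -(RintegralZl_itv _ (I m)).
rewrite -Rintegral_sum//; last by move=> m; apply: RintegrableZ => //; exact: I.
apply: eq_Rintegral => t _; rewrite /superposition_re /superposition_im !mulr_sumr -sumrB.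
by apply: eq_bigr => m _; ring.
Qed.

End superposition_of_waves.

Local Open Scope ereal_scope.

Let LRe (a b : R -> R) (z : borel (Cplus R)) := lapRe a b (complex.Re (Cval z)) (complex.Im (Cval z)).
Let LIm (a b : R -> R) (z : borel (Cplus R)) := lapIm a b (complex.Re (Cval z)) (complex.Im (Cval z)).

(** The square integral of the transform of a wave, bounded below by the mass of
    a set on which the transform has no cancellation. *)
Lemma wave_integral_ge (A : set (borel (Cplus R))) (p q w y : R) : measurable A ->
  (0 <= p)%R -> (p < q)%R -> (q <= 1)%R -> (0 <= w)%R ->
  (forall z, A z -> complex.Re (Cval z) * q <= 2 /\ `|complex.Im (Cval z) - y| * q <= 1)%R ->
  ((w * (q - p) * wave_constant) ^+ 2)%:E * nu A <=
  \int[nu]_z sqr2 (LRe (wave_re p q w y) (wave_im p q w y))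
                  (LIm (wave_re p q w y) (wave_im p q w y)) z.
Proof.
move=> mA hp hpq hq hw HA.
have [mRe mIm] := measurable_lap (measurable_wave_re p q w y) (measurable_wave_im p q w y).
have mS := measurable_sqr2 mRe mIm.
rewrite -integral_cst//.
apply: (@le_trans _ _ (\int[nu]_(z in A) sqr2 (LRe (wave_re p q w y) (wave_im p q w y))
                  (LIm (wave_re p q w y) (wave_im p q w y)) z)).
  apply: ge0_le_integral => //.
  - by move=> z _; rewrite lee_fin sqr_ge0.
  - exact: measurable_funTS.
  - move=> z Az; have [h1 h2] := HA z Az; rewrite lee_fin.
    have x0 : (0 <= complex.Re (Cval z))%R by apply/ltW/Cplus_Re_gt0.
    have := wave_lap_ge hp hpq hq hw x0 h1 h2; rewrite -/(LRe _ _ z) => H.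
    apply: (@le_trans _ _ (LRe (wave_re p q w y) (wave_im p q w y) z ^+ 2)%R); last by rewrite lerDl sqr_ge0.
    have c0 : (0 <= w * (q - p) * wave_constant)%R.
      by rewrite mulr_ge0 ?(ltW wave_constant_gt0)// mulr_ge0// subr_ge0 ltW.
    by apply: lerXn2r; rewrite ?nnegrE// (le_trans c0).
by apply: ge0_subset_integral => // z _; exact: sqr2_ge0.
Qed.

(** The waves e^(iyt) / 2 on ]0, 1/2] account for the Carleson squares of side 2. *)
Lemma square_sup_le : ((wave_constant ^+ 2 / 16)%R)%:E *
    ereal_sup [set nu (carleson_square I) | I in [set I : interval R | itv_length I = 2%:E]]
  <= laplace_opnorm Phi nu ^+ 2.
Proof.
have c0 : (0 < wave_constant ^+ 2 / 16 :> R)%R by rewrite divr_gt0// exprn_gt0// wave_constant_gt0.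
rewrite muleC -lee_pdivlMr//; apply: ge_ereal_sup => _ [I /= I2 <-].
rewrite lee_pdivlMr// muleC.
have [|a aI] := @finite_itv R I; first by rewrite I2 lte_fin ltr0n ltry.
rewrite I2/= in aI.
(* The test function e^(iyt) / 2 on ]0, 1/2], y being the centre of I. *)
pose h : R := 2^-1%R; pose y : R := (a + 1)%R.
have h0 : (0 < h)%R by rewrite invr_gt0.
have h1 : (h < 1)%R by rewrite invf_lt1// ltr1n.
have zero_out t : t \notin unit_itv R -> wave_re 0 h h y t = 0%R /\ wave_im 0 h h y t = 0%R.
  move=> t01; apply: wave_notin; apply: contra t01; rewrite in_itv/= => /andP[t0 th].
  by apply: mem_set; rewrite /unit_itv/= in_itv/= t0 (le_lt_trans th).
have Phih : (Phi h <= 1)%R.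
  rewrite /Phi_exp; have := expR_ge1Dx (- h); rewrite expRN.
  have e0 := expR_gt0 h; have hh : h = 2^-1%R by [].
  have : (0 <= h)%R by exact: ltW.
  move=> hge H.
  have : ((1 - h) * expR h <= 1)%R by rewrite -[leRHS](mulVf (lt0r_neq0 e0)) ler_wpM2r// ltW.
  by rewrite hh; lra.
have Phi_le t : (Phi (Num.sqrt (wave_re 0 h h y t ^+ 2 + wave_im 0 h h y t ^+ 2)) <= 1)%R.
  have [tin|tout] := boolP (t \in `]0%R, h]).
    have [-> ->] := wave_in h y tin.
    rewrite !exprMn -mulrDr cos2Dsin2 mulr1 sqrtr_sqr ger0_norm//; exact: ltW.
  have [-> ->] := wave_notin h y tout.
  by rewrite expr0n/= addr0 sqrtr0 /Phi_exp expR0 subr0 subrr ler01.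
have mU : measurable (unit_itv R) by exact: measurable_itv.
have mre := measurable_wave_re 0 h h y; have mim := measurable_wave_im 0 h h y.
have Phi_int : \int[mu]_(s in unit_itv R)
    (Phi (Num.sqrt (wave_re 0 h h y s ^+ 2 + wave_im 0 h h y s ^+ 2)))%:E <= 1.
  apply: (@le_trans _ _ (\int[mu]_(s in unit_itv R) cst 1 s)).
    apply: ge0_le_integral => //.
    - by move=> t _; rewrite lee_fin Phi_exp_ge0.
    - apply/measurable_EFinP; apply: (measurableT_comp measurable_Phi_exp).
      apply: (@measurableT_comp _ _ _ _ _ _ (@Num.sqrt R)).
        by apply: continuous_measurable_fun; exact: sqrt_continuous.
      by apply: measurable_funTS; apply: measurable_funD; apply: measurable_funX.
    - by move=> t _; rewrite lee_fin.
  rewrite integral_cst// mul1e.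
  have U1 : lebesgue_measure (unit_itv R) = 1.
    by rewrite /unit_itv lebesgue_measure_itv/= lte_fin ltr01 oppr0 adde0.
  by rewrite [X in X <= _]U1.
apply: le_trans (opnorm_test nu mre mim zero_out Phi_int).
apply: le_trans (wave_integral_ge (measurable_carleson_square I) (lexx 0%R) h0 (ltW h1) (ltW h0) _).
  rewrite le_eqVlt; apply/orP; left; apply/eqP; congr (_%:E * _).
  by rewrite /h; field.
move=> z [zI [z0 z2]]; have /andP[ay ya] := aI _ zI.
rewrite I2 lee_fin in z2; split; first by rewrite /h; lra.
have : (`|complex.Im (Cval z) - y| <= 1)%R by rewrite ler_norml /y; apply/andP; split; lra.
by move=> H; rewrite /h; have := normr_ge0 (complex.Im (Cval z) - y)%R; lra.
Qed.

(** One tile per strip, at an arbitrary height: the signed superposition of waves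
    with these heights as frequencies tests all of them at once. *)
Lemma dyadic_tiles_le (M : nat) (y : nat -> R) :
  \sum_(m < M) ((wave_constant ^+ 2 / 64 * (m.+1%:R / 2 ^+ m.+1) ^+ 2)%R)%:E *
     nu (tile m.+1 (y m)) <= laplace_opnorm Phi nu ^+ 2.
Proof.
pose A m := LRe (wave_re (p_ m) (q_ m) (w_ m) (y m)) (wave_im (p_ m) (q_ m) (w_ m) (y m)).
pose B m := LIm (wave_re (p_ m) (q_ m) (w_ m) (y m)) (wave_im (p_ m) (q_ m) (w_ m) (y m)).
have mAB m : measurable_fun setT (A m) /\ measurable_fun setT (B m).
  exact: measurable_lap (measurable_wave_re _ _ _ _) (measurable_wave_im _ _ _ _).
have [eps [eps1 Heps]] := exists_signs nu M (fun m => (mAB m).1) (fun m => (mAB m).2).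
apply: (@le_trans _ _ (\sum_(m < M) \int[nu]_z sqr2 (A m) (B m) z)).
  apply: lee_sum => m _.
  have w0 : (0 <= w_ m)%R by rewrite divr_ge0.
  have q1' : (q_ m <= 1)%R by apply: (le_trans (q1 m)); rewrite invf_le1// ler1n.
  (* On the tile, Re z < 2 ^ (m + 2) and |Im z - y m| <= 2 ^ (m + 1). *)
  apply: le_trans (wave_integral_ge (measurable_tile m.+1 (y m)) (ltW (p0 m)) (pq m) q1' w0 _).
    rewrite qBp le_eqVlt; apply/orP; left; apply/eqP; congr (_%:E * _).
    by rewrite [(2 ^+ m.+2)%R]exprS; field; rewrite expf_neq0.
  have N0 : (0 < (2 : R) ^+ m.+1)%R by rewrite exprn_gt0.
  move=> z [/= /andP[_ z2] /andP[yz zy]]; split.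
    rewrite ler_pdivrMr// -exprS; apply: ltW; move: z2.
    by rewrite (_ : (m.+1%:Z + 1)%R = m.+2%:Z) -?exprnP// -PoszD addn1.
  rewrite ler_pdivrMr// mul1r ger0_norm ?subr_ge0//; lra.
apply: (le_trans Heps).
apply: le_trans (opnorm_test nu (measurable_superposition_re M eps y) (measurable_superposition_im M eps y)
  (@superposition_unit M eps y) (integral_Phi_superposition M y eps1)).
rewrite le_eqVlt; apply/orP; left; apply/eqP; apply: eq_integral => z _.
have x0 : (0 <= complex.Re (Cval z))%R by apply/ltW/Cplus_Re_gt0.
by rewrite /sqr2 lapRe_superposition// lapIm_superposition.
Qed.

Lemma carleson_series_le : ((wave_constant ^+ 2 / 128)%R)%:E *
    (\sum_(1 <= n <oo) (n%:R ^+ 2)%:E * carleson 2 (strip_measure nu n%:Z))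
  <= laplace_opnorm Phi nu ^+ 2.
Proof.
have c0 : (0 < wave_constant :> R)%R by exact: wave_constant_gt0.
have carl0 := carleson_strip_ge0 nu.
rewrite -nneseriesZl; last by move=> n _; rewrite mule_ge0 ?lee_fin ?sqr_ge0.
rewrite -nneseries_addn; last first.
  by move=> n; rewrite !mule_ge0 ?lee_fin ?sqr_ge0 ?divr_ge0 ?sqr_ge0.
apply: nneseries_le => [n|M].
  by rewrite !mule_ge0 ?lee_fin ?sqr_ge0 ?divr_ge0 ?sqr_ge0.
pose r (m : nat) := (wave_constant ^+ 2 / 64 * (m.+1%:R / 2 ^+ m.+1) ^+ 2 : R)%R.
have r0 m : (0 < r m)%R.
  by rewrite mulr_gt0 ?divr_gt0// exprn_gt0// divr_gt0// exprn_gt0.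
pose b m (y : R) := (r m)%:E * nu (tile m.+1 y).
apply: (@le_trans _ _ (\sum_(m < M) ereal_sup (range (b m)))); last first.
  apply: (sum_ereal_sup_le 0%R) => [m y|y].
    by rewrite mule_ge0// lee_fin ltW.
  exact: dyadic_tiles_le.
apply: lee_sum => m _; rewrite addn1.
have -> : ereal_sup (range (b m)) = (r m)%:E * tile_sup nu m.+1.
  rewrite -ereal_sup_pZl//; congr ereal_sup; apply/seteqP; split=> x /=.
    by move=> [y _ <-]; exists (nu (tile m.+1 y)) => //; exists y.
  by move=> [_ [y _ <-] <-]; exists y.
rewrite muleA -EFinM.
apply: (le_trans (lee_wpmul2l _ (carleson_le_tile nu m.+1))).
  by rewrite lee_fin mulr_ge0 ?sqr_ge0// divr_ge0// sqr_ge0.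
rewrite muleA -EFinM le_eqVlt; apply/orP; left; apply/eqP; congr (_%:E * _).
by rewrite /r; field; rewrite expf_neq0.
Qed.

Lemma embedding_constant_ge0 : 0 <= embedding_constant nu.
Proof.
have carl0 := carleson_strip_ge0 nu.
apply: adde_ge0; last exact: le_trans (strip_sup_ge0 nu 0) (strip_sup0 nu).
by apply: nneseries_ge0 => n _ _; rewrite mule_ge0 ?lee_fin ?sqr_ge0.
Qed.

(** The constant of the lower estimate of the square of the operator norm. *)
Definition lower_constant : R := (wave_constant ^+ 2 / 256)%R.

Lemma lower_constant_gt0 : (0 < lower_constant)%R.
Proof.
by apply: divr_gt0; [apply: exprn_gt0; exact: wave_constant_gt0|rewrite ltr0n].
Qed.

Lemma embedding_le_opnorm :
  lower_constant%:E * embedding_constant nu <= laplace_opnorm Phi nu ^+ 2.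
Proof.
have O0 : 0 <= laplace_opnorm Phi nu ^+ 2 by exact: sqre_ge0.
have w0 : (0 <= (wave_constant : R) ^+ 2)%R by exact: sqr_ge0.
have H1 := carleson_series_le; have H2 := square_sup_le.
have carl0 := carleson_strip_ge0 nu.
have S0 : 0 <= ereal_sup [set nu (carleson_square I) | I in [set I : interval R | itv_length I = 2%:E]].
  exact: le_trans (strip_sup_ge0 nu 0) (strip_sup0 nu).
rewrite /embedding_constant ge0_muleDr//; last first.
  by apply: nneseries_ge0 => n _ _; rewrite mule_ge0 ?lee_fin ?sqr_ge0.
move: H1 H2 S0; set X := \sum_(_ <= _ <oo) _; set Y := ereal_sup _; set O := _ ^+ 2 => H1 H2 S0.
have half : O = (2^-1)%:E * O + (2^-1)%:E * O.
  by rewrite -ge0_muleDl ?lee_fin// -EFinD (_ : (2^-1 + 2^-1 = 1 :> R)%R) ?mul1e//; field.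
rewrite half; apply: leeD.
  rewrite (_ : lower_constant%:E * X = (2^-1)%:E * ((wave_constant ^+ 2 / 128)%:E * X)); last first.
    by rewrite muleA -EFinM; congr (_%:E * _); rewrite /lower_constant; field.
  by rewrite lee_wpmul2l// lee_fin.
apply: (@le_trans _ _ ((2^-1)%:E * ((wave_constant ^+ 2 / 16)%:E * Y))).
  rewrite muleA -EFinM lee_wpmul2r// lee_fin /lower_constant; lra.
by rewrite lee_wpmul2l// lee_fin.
Qed.

End LowerBound.

Theorem theorem2p16 (R : realType) :
  exists c C : R, 0 < c /\ 0 < C /\
    forall mu : {measure set (borel (Cplus R)) -> \bar R},
      regular_measure mu ->
      (laplace_bounded (Phi_exp R) mu <-> (embedding_constant mu < +oo)%E) /\
      (c%:E * embedding_constant mu <= laplace_opnorm (Phi_exp R) mu ^+ 2)%E /\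
      (laplace_opnorm (Phi_exp R) mu ^+ 2 <= C%:E * embedding_constant mu)%E.
Proof.
exists lower_constant, upper_constant.
have c0 := @lower_constant_gt0 R; have C0 := @upper_constant_gt0 R.
split => //; split => // mu _.
have E0 := embedding_constant_ge0 mu.
have low := embedding_le_opnorm mu.
split; [split|split => //].
- move=> [K HK].
  have opK : (laplace_opnorm (Phi_exp R) mu <= (Num.max K 0)%:E)%E.
    apply: ge_ereal_sup => _ [f [fO f1] <-]; have [_ /le_trans] := HK f fO; apply.
    rewrite lee_fin; apply: (@le_trans _ _ (Num.max K 0 * orlicz_norm (Phi_exp R) f)).
      apply: ler_wpM2r; last by rewrite le_max lexx.
      by apply: lb_le_inf; [exact: orlicz_norm_nonempty|move=> k [/ltW]].
    by rewrite -[leRHS]mulr1 ler_wpM2l// le_max lexx orbT.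
  rewrite ltey; apply/eqP => Eoo.
  move: low; rewrite Eoo gt0_muley ?lte_fin// leye_eq => /eqP opoo.
  have : (laplace_opnorm (Phi_exp R) mu ^+ 2 <= (Num.max K 0)%:E ^+ 2)%E.
    by rewrite lee_sqr ?opnorm_ge0// lee_fin le_max lexx orbT.
  by rewrite opoo -EFin_expe leye_eq.
- move=> Efin; exists (Num.sqrt (upper_constant * fine (embedding_constant mu))) => f fO.
  have B := L2_norm_sqr_le fO Efin E0.
  have n0 : 0 <= orlicz_norm (Phi_exp R) f.
    by apply: lb_le_inf; [exact: orlicz_norm_nonempty|move=> k [/ltW]].
  have ce0 : 0 <= upper_constant * fine (embedding_constant mu).
    by rewrite mulr_ge0 ?fine_ge0// ltW.
  have L2 : (L2_norm mu (laplace (ext0 f)) <=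
     (Num.sqrt (upper_constant * fine (embedding_constant mu)) * orlicz_norm (Phi_exp R) f)%:E)%E.
    rewrite -lee_sqr ?L2_norm_ge0//; last by rewrite lee_fin mulr_ge0// sqrtr_ge0.
    by rewrite -EFin_expe exprMn sqr_sqrtr.
  split=> //; split; last by apply: le_lt_trans L2 _; rewrite ltry.
  by apply: measurable_laplace; have [] := fO.
- have [->|Efin] := eqVneq (embedding_constant mu) +oo%E.
    by rewrite gt0_muley ?lte_fin// leey.
  have {}Efin : (embedding_constant mu < +oo)%E by rewrite ltey.
  have ce0 : 0 <= upper_constant * fine (embedding_constant mu).
    by rewrite mulr_ge0 ?fine_ge0// ltW.
  have opS : (laplace_opnorm (Phi_exp R) mu <= (Num.sqrt (upper_constant * fine (embedding_constant mu)))%:E)%E.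
    apply: ge_ereal_sup => _ [f [fO f1] <-].
    rewrite -lee_sqr ?L2_norm_ge0 ?lee_fin ?sqrtr_ge0//.
    apply: (le_trans (L2_norm_sqr_le fO Efin E0)).
    rewrite -EFin_expe sqr_sqrtr// lee_fin -[leRHS]mulr1 ler_wpM2l//.
    rewrite expr_le1//; apply: lb_le_inf; [exact: orlicz_norm_nonempty|by move=> k [/ltW]].
  rewrite -(lee_sqr (opnorm_ge0 _)) ?lee_fin ?sqrtr_ge0// in opS.
  apply: (le_trans opS); rewrite -EFin_expe sqr_sqrtr// EFinM fineK//.
  by rewrite ge0_fin_numE.
Qed.
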